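(* Let $F$ be a rigid field and let $\varphi$ be an anisotropic quadratic form over $F$ of dimension $16$ whose Witt class lies in $I^3F$. Then the following are equivalent: (i) $\varphi$ is isometric to an orthogonal sum of $4$ forms in $GP_2F$; (ii) $\varphi$ contains a subform in $GP_2F$; (iii) $\varphi$ is Witt equivalent to a sum of at most $3$ forms in $GP_3F$.
   Context: All fields have characteristic different from $2$; quadratic form means finite-dimensional non-degenerate quadratic form. $IF$ is the fundamental ideal of the Witt ring $WF$ and $I^3F=(IF)^3$. For $a_1,\dots,a_n\in F^\ast$, the $n$-fold Pfister form is $\langle\langle a_1,\ldots,a_n\rangle\rangle:=\langle 1,-a_1\rangle\otimes\cdots\otimes\langle 1,-a_n\rangle$, and $GP_nF$ denotes the set of forms similar to some $n$-fold Pfister form. A field $F$ is rigid if every binary anisotropic quadratic form over $F$ represents at most $2$ square classes of $F^\ast/F^{\ast 2}$. *)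

(* Defs.v *)
From HB Require Import structures.
From mathcomp Require Import all_boot all_algebra.
From mathcomp Require Import sesquilinear mxtens.

Set Implicit Arguments.
Unset Strict Implicit.
Unset Printing Implicit Defensive.

Import GRing.Theory.
Local Open Scope ring_scope.

Definition nonzero (F : fieldType) := {a : F | a != 0}.

Definition nonzero1 (F : fieldType) : nonzero F := exist _ 1 (oner_neq0 F).

Lemma oppr_neq0 (F : fieldType) (a : nonzero F) : - val a != 0.
Proof. by rewrite oppr_eq0 (valP a). Qed.

Definition nonzero_opp (F : fieldType) (a : nonzero F) : nonzero F :=
  exist _ (- val a) (oppr_neq0 a).

(* A non-degenerate quadratic form on F^n, as the Gram matrix of the symmetric
   bilinear form b such that q(v) = b(v, v). As 2 is invertible in all that
   follows, q and b determine each other, and q is non-degenerate exactly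
   when the Gram matrix is invertible. *)
Record qform (F : fieldType) := QForm {
  qdim : nat;
  gram : 'M[F]_qdim;
  gram_sym : gram \is symmetricmx;
  gram_unit : gram \in unitmx
}.

Definition qval (F : fieldType) (q : qform F) (v : 'rV[F]_(qdim q)) : F :=
  (v *m gram q *m v^T) 0 0.

Definition isometric (F : fieldType) (q r : qform F) : Prop :=
  exists P : 'M[F]_(qdim q, qdim r),
    [/\ row_free P, row_full P & forall v, qval (v *m P) = qval v].

Definition anisotropic (F : fieldType) (q : qform F) : Prop :=
  forall v : 'rV[F]_(qdim q), qval v = 0 -> v = 0.

Lemma symmetricmxP (F : fieldType) n (A : 'M[F]_n) :
  reflect (A^T = A) (A \is symmetricmx).
Proof.
rewrite qualifE /= expr0 scale1r (eq_map_mx_id _ (fun=> erefl)).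
by rewrite eq_sym; apply: eqP.
Qed.

Lemma qzero_sym (F : fieldType) : (0 : 'M[F]_0) \is symmetricmx.
Proof. by apply/symmetricmxP; rewrite trmx0. Qed.

Lemma qzero_unit (F : fieldType) : (0 : 'M[F]_0) \in unitmx.
Proof. by rewrite unitmxE det_mx00 unitr1. Qed.

Definition qzero (F : fieldType) : qform F := QForm (qzero_sym F) (qzero_unit F).

Section Operations.
Variable F : fieldType.
Implicit Types (q r : qform F) (c : nonzero F).

Lemma qsum_sym q r : block_mx (gram q) 0 0 (gram r) \is symmetricmx.
Proof.
have /symmetricmxP eq := gram_sym q; have /symmetricmxP er := gram_sym r.
by apply/symmetricmxP; rewrite tr_block_mx !trmx0 eq er.
Qed.

Lemma qsum_unit q r : block_mx (gram q) 0 0 (gram r) \in unitmx.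
Proof.
by rewrite unitmxE det_ublock unitrM -!unitmxE !gram_unit.
Qed.

Definition qsum q r : qform F := QForm (qsum_sym q r) (qsum_unit q r).

Lemma qtens_sym q r : gram q *t gram r \is symmetricmx.
Proof.
have /symmetricmxP eq := gram_sym q; have /symmetricmxP er := gram_sym r.
by apply/symmetricmxP; rewrite trmx_tens eq er.
Qed.

Lemma unitmx_dim0 n (A : 'M[F]_n) : n = 0%N -> A \in unitmx.
Proof. by move=> n0; subst n; rewrite unitmxE det_mx00 unitr1. Qed.

Lemma qtens_unit q r : gram q *t gram r \in unitmx.
Proof.
have [q0|q0] := eqVneq (qdim q) 0%N; first by rewrite unitmx_dim0 // q0.
have [r0|r0] := eqVneq (qdim r) 0%N; first by rewrite unitmx_dim0 // r0 muln0.
by rewrite tensmx_unit // gram_unit.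
Qed.

Definition qtens q r : qform F := QForm (qtens_sym q r) (qtens_unit q r).

Lemma qscale_sym c q : val c *: gram q \is symmetricmx.
Proof.
have /symmetricmxP eq := gram_sym q.
by apply/symmetricmxP; rewrite linearZ /= eq.
Qed.

Lemma qscale_unit c q : val c *: gram q \in unitmx.
Proof. by rewrite unitmxZ ?gram_unit // unitfE (valP c). Qed.

Definition qscale c q : qform F := QForm (qscale_sym c q) (qscale_unit c q).

Section Diagonal.
Variables (n : nat) (a : n.-tuple (nonzero F)).

Lemma qdiag_sym : diag_mx (\row_i val (tnth a i)) \is symmetricmx.
Proof. by apply/symmetricmxP; rewrite tr_diag_mx. Qed.

Lemma qdiag_unit : diag_mx (\row_i val (tnth a i)) \in unitmx.
Proof.
rewrite unitmxE det_diag unitfE; apply/prodf_neq0 => i _.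
by rewrite mxE (valP (tnth a i)).
Qed.

Definition qdiag : qform F := QForm qdiag_sym qdiag_unit.

End Diagonal.

End Operations.

Definition hyperbolic_plane (F : fieldType) : qform F :=
  qdiag [tuple nonzero1 F; nonzero_opp (nonzero1 F)].

Definition hyperbolic (F : fieldType) (m : nat) : qform F :=
  \big[@qsum F/qzero F]_(i < m) hyperbolic_plane F.

Definition witt_equiv (F : fieldType) (q r : qform F) : Prop :=
  exists m n : nat,
    isometric (qsum q (hyperbolic F m)) (qsum r (hyperbolic F n)).

(* Ideals of the Witt ring are represented by the predicates "the Witt class
   of q lies in the ideal" on forms. *)
Definition fund_ideal (F : fieldType) (q : qform F) : Prop := ~~ odd (qdim q).

(* Addition and multiplication in the Witt ring are induced by qsum and qtens,
   so these are the finite sums of products of an element of I and one of J. *)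
Definition ideal_mul (F : fieldType) (I J : qform F -> Prop) (q : qform F) : Prop :=
  exists (n : nat) (x y : 'I_n -> qform F),
    [/\ forall i, I (x i), forall i, J (y i)
      & witt_equiv q (\big[@qsum F/qzero F]_(i < n) qtens (x i) (y i))].

Definition fund_ideal3 (F : fieldType) : qform F -> Prop :=
  ideal_mul (ideal_mul (@fund_ideal F) (@fund_ideal F)) (@fund_ideal F).

(* <<a_1, ..., a_n>> = <1, -a_1> (x) ... (x) <1, -a_n>, with minus signs. *)
Definition pfister (F : fieldType) (n : nat) (a : n.-tuple (nonzero F)) : qform F :=
  \big[@qtens F/qdiag [tuple nonzero1 F]]_(i < n)
    qdiag [tuple nonzero1 F; nonzero_opp (tnth a i)].

Definition GP (F : fieldType) (n : nat) (q : qform F) : Prop :=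
  exists (c : nonzero F) (a : n.-tuple (nonzero F)),
    isometric q (qscale c (pfister a)).

Definition subform (F : fieldType) (s q : qform F) : Prop :=
  exists r : qform F, isometric q (qsum s r).

Definition represents (F : fieldType) (q : qform F) (a : nonzero F) : Prop :=
  exists v : 'rV[F]_(qdim q), qval v = val a.

Definition same_square_class (F : fieldType) (a b : nonzero F) : Prop :=
  exists c : nonzero F, val a = val b * val c ^+ 2.

Definition rigid (F : fieldType) : Prop :=
  forall q : qform F, qdim q = 2%N -> anisotropic q ->
    exists b c : nonzero F, forall a : nonzero F, represents q a ->
      same_square_class a b \/ same_square_class a c.

(* Main.v *)
From HB Require Import structures.
From mathcomp Require Import fingroup perm.
From mathcomp Require Import all_boot all_algebra zify ring.
From mathcomp Require Import sesquilinear mxtens generic_quotient.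
From mathcomp Require Import boolp classical_sets.
Require Import Defs.

Set Implicit Arguments.
Unset Strict Implicit.
Unset Printing Implicit Defensive.

Import GRing.Theory.
Local Open Scope ring_scope.

(** Over a rigid field, a binary form <a, b> that is not hyperbolic has no values
    outside the square classes of a and b, except that <a, a> also represents -a
    when -1 is a sum of two squares ([binary_value]). So the values of a diagonal
    form can be read off from its entries ([reduced_value]), and Witt equivalence
    becomes a combinatorial relation between lists of elements of the group G of
    square classes, written additively, in which eps is the class of -1: two forms
    are equivalent if and only if, for each class x, the multiplicities of x minus
    those of -x agree modulo m, where m is 2 if -1 is a square, 4 if it is only a
    sum of two squares, and 0 otherwise ([weq], [isometric_weq],
    [witt_equiv_class]).

    Membership in I^3 enters through necessary conditions ([inI3],
    [fund_ideal3_inI3]). A character chi of G that is trivial at -1 behaves like a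
    valuation: the entries on either side of it form two residues, which are in
    I^2, that is, have even dimension and trivial discriminant. A character that
    is nontrivial at -1 behaves like an ordering, and the signature there is
    divisible by 8. Characters separate the classes, so that an anisotropic form
    has many residues ([split_or_nseq]); residues of dimension 4 are similar to
    twofold Pfister forms. From this, the anisotropic forms in I^3 of dimension
    below 16 have dimension 0, 8, 12 or 14, and are sums of at most two forms in
    GP_3 ([inI3_le15]).

    A form of dimension 16 in I^3 that contains a form pi in GP_2 and a further
    entry y differs by a form in GP_3, which contains pi and <y>, from a form of
    dimension 16 - 5 + 3 = 14 in I^3, which is a sum of two forms in GP_3
    ([weq_step]): this is how the second condition implies the third.

    For the way back from the third condition to the first, let the form be
    A + B + C with A, B, C in GP_3 anisotropic. The sum loses four hyperbolic
    planes, and there are only three pairs of summands, so that two summands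
    share a binary form <p, q> up to sign. Then both are multiples of <1, pq>, as is
    their sum ([linked_gp3]), and adding the third summand gives a sum of
    multiples of one or two binary forms ([link]), which splits into forms in GP_2
    ([sum_gp2_dbl]). If -1 is a sum of two squares, A, B and C can also lose a
    plane because of a value x common to all three, as <x, x, x> = <-x, x, -x>;
    splitting off this value and counting planes again, one either finds a binary
    form shared by two or by all three summands, or reads off four forms in GP_2
    ([triple_common_value], [common_final]). *)

(** * Elementary abelian 2-groups and their characters *)

(** Sums in a group of exponent 2, reified: two of them agree as soon as each
    atom occurs in both with the same parity, which can be computed. *)
Inductive gterm := Gvar of nat | Gzero | Gadd of gterm & gterm.

Fixpoint gcount (i : nat) (t : gterm) : nat :=
  match t with
  | Gvar j => (i == j)
  | Gzero => 0
  | Gadd t u => gcount i t + gcount i u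
  end.

Fixpoint geval (G : zmodType) (e : seq G) (t : gterm) : G :=
  match t with
  | Gvar j => e`_j
  | Gzero => 0
  | Gadd t u => geval e t + geval e u
  end.

Lemma geval_even (G : zmodType) (exp2 : forall x : G, x + x = 0) (e : seq G)
    (t u : gterm) :
  all (fun i => ~~ odd (gcount i t + gcount i u)) (iota 0 (size e)) ->
  geval e t = geval e u.
Proof.
have sumE v : geval e v = \sum_(i < size e) e`_i *+ gcount i v.
  elim: v => [j||v IHv v' IHv'] /=; last 1 first.
  - by rewrite IHv IHv' -big_split; apply: eq_bigr => i _; rewrite mulrnDr.
  - have [lt_j|le_j] := ltnP j (size e).
      rewrite (bigD1 (Ordinal lt_j)) //= eqxx big1 ?addr0 //.
      by move=> i /negPf; rewrite -val_eqE /= => ->.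
    rewrite nth_default // big1 // => i _; case: eqP => // ij.
    by have:= ltn_ord i; rewrite ij ltnNge le_j.
  - by rewrite big1.
move=> /allP even_tu; have oppE (x : G) : - x = x.
  by apply/eqP; rewrite eq_sym -addr_eq0 exp2.
apply/eqP; rewrite -subr_eq0 oppE !sumE -big_split big1 //= => i _.
have := even_tu i; rewrite mem_iota /= ltn_ord -mulrnDr => /(_ isT) ev.
by rewrite -[X in _ *+ X]odd_double_half (negPf ev) add0n -muln2 mulnC mulrnA
   mulr2n exp2 mul0rn.
Qed.

Ltac g2_mem x l :=
  lazymatch l with
  | nil => constr:(false)
  | cons x _ => constr:(true)
  | cons _ ?l => g2_mem x l
  end.
Ltac g2_atoms t l :=
  lazymatch t with
  | 0%R => l
  | (?a + ?b)%R => let l := g2_atoms a l in g2_atoms b l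
  | _ => lazymatch g2_mem t l with true => l | false => constr:(cons t l) end
  end.
Ltac g2_index x l :=
  lazymatch l with
  | cons x _ => constr:(0%N)
  | cons _ ?l => let i := g2_index x l in constr:(S i)
  end.
Ltac g2_reify t l :=
  lazymatch t with
  | 0%R => constr:(Gzero)
  | (?a + ?b)%R =>
      let a := g2_reify a l in let b := g2_reify b l in constr:(Gadd a b)
  | _ => let i := g2_index t l in constr:(Gvar i)
  end.
(* Closes an equality of sums that follows from x + x = 0 alone. *)
Ltac g2 exp2 :=
  lazymatch goal with
  | |- @eq ?G ?a ?b =>
      let l := g2_atoms a (@nil G) in let l := g2_atoms b l in
      let ta := g2_reify a l in let tb := g2_reify b l in
      exact (@geval_even _ exp2 l ta tb isT)
  end.

Section Characters.
Variables (G : zmodType) (exp2 : forall x : G, x + x = 0).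

Lemma eq_addr0 (x y : G) : (x + y == 0) = (x == y).
Proof.
apply/eqP/eqP => [E|->]; last exact: exp2.
by rewrite -[x]addr0 -(exp2 y) addrA E add0r.
Qed.

Lemma eq_by (a b x y : G) : a = b -> x + y = a + b -> x = y.
Proof. by move=> -> /eqP; rewrite exp2 eq_addr0 => /eqP. Qed.

Definition character (chi : G -> bool) :=
  {morph chi : x y / x + y >-> (x (+) y)}.

Lemma character0 chi : character chi -> chi 0 = false.
Proof. by move=> chiD; have := chiD 0 0; rewrite addr0; case: (chi 0). Qed.

Lemma character_sum chi s : character chi ->
  chi (\sum_(x <- s) x) = odd (count chi s).
Proof.
move=> chiD; elim: s => [|x s IH]; first by rewrite big_nil character0.
by rewrite big_cons chiD IH /= oddD; case: (chi x).
Qed.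

Fixpoint span (l : seq G) : seq G :=
  if l is a :: l' then span l' ++ [seq a + x | x <- span l'] else [:: 0].

Lemma span0 l : 0 \in span l.
Proof. by elim: l => [|a l IH]; rewrite ?mem_head //= mem_cat IH. Qed.

Lemma span_gen l a : a \in l -> a \in span l.
Proof.
elim: l => [|b l IH] //; rewrite inE => /orP[/eqP->|/IH al] /=.
  by rewrite mem_cat orbC -[X in X \in _]addr0 map_f ?span0.
by rewrite mem_cat al.
Qed.

Lemma spanD l a b : a \in span l -> b \in span l -> a + b \in span l.
Proof.
elim: l a b => [|c l IH] a b /=.
  by rewrite !inE => /eqP-> /eqP->; rewrite addr0.
rewrite !mem_cat => /orP[al|/mapP[x xl ->]] /orP[bl|/mapP[y yl ->]].
- by rewrite IH.
- by rewrite addrCA map_f ?orbT // IH.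
- by rewrite -addrA map_f ?orbT // IH.
- have ->: c + x + (c + y) = x + y by g2 exp2.
  by rewrite IH.
Qed.

(** A subgroup maximal among those that contain [l] and avoid [x] has index 2:
    adding any [y] outside it would catch [x], so [y] lies in its coset of [x].
    Zorn's lemma is needed as the group may be infinite. *)
Lemma character_separates l x : x \notin span l ->
  exists chi, [/\ character chi, {in l, forall a, chi a = false} & chi x].
Proof.
move=> xl; pose subgroup (A : set G) := forall a b, A a -> A b -> A (a + b).
pose P (A : set G) := [/\ subgroup A, ~ A x &
  forall a, A a -> [set` span l] `<=` A]%classic.
have [F FP totF|A [[Asub Ax lA] Amax]] := @Zorn_bigcup G P.
  split.
  - move=> a b [B FB Ba] [C FC Cb]; have [BC|CB] := totF _ _ FB FC.
      by exists C => //; have [+ _ _] := FP _ FC; apply => //; apply: BC.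
    by exists B => //; have [+ _ _] := FP _ FB; apply => //; apply: CB.
  - by move=> [B FB Bx]; have [_ + _] := FP _ FB.
  - move=> a [B FB Ba] y ly; exists B => //.
    by have [_ _ /(_ a Ba)] := FP _ FB; apply.
have {}lA : ([set` span l] `<=` A)%classic.
  have [[a Aa]|A0] := pselect (exists a, A a); first exact: lA Aa.
  exfalso; apply: (Amax [set` span l]%classic).
    split=> [a Aa|/(_ 0 (span0 l)) A00]; first by case: A0; exists a.
    by apply: A0; exists 0.
  split=> [a b al bl|/(negP xl) //|a _ y //]; exact: (spanD al bl).
have A0 : A 0 by apply/lA/span0.
have outA y : ~ A y -> A (x + y).
  move=> nAy; pose B : set G := fun z => A z \/ A (z + y).
  have AB : (A `<=` B)%classic by move=> z; left.
  have [Bx|nBx] := pselect (B x); first by case: Bx => //.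
  exfalso; apply: (Amax B).
    by split=> // BA; apply/nAy/BA; right; rewrite exp2.
  split=> // [a b [Aa|Aa] [Ab|Ab]|a _ z lz].
  - by left; apply: Asub.
  - by right; rewrite -addrA; apply: Asub.
  - by right; rewrite addrAC; apply: Asub.
  - left; have ->: a + b = (a + y) + (b + y) by g2 exp2.
    exact: Asub.
  - by left; apply: lA.
exists (fun y => ~~ `[< A y >]); split.
- move=> a b; have [Aa|nAa] := asboolP (A a); have [Ab|nAb] := asboolP (A b).
  + by rewrite asboolT //; apply: Asub.
  + rewrite asboolF // => Aab; apply: nAb.
    have ->: b = a + (a + b) by g2 exp2.
    exact: Asub.
  + rewrite asboolF // => Aab; apply: nAa.
    have ->: a = (a + b) + b by g2 exp2.
    exact: Asub.
  + rewrite asboolT //; have ->: a + b = (x + a) + (x + b) by g2 exp2.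
    by apply: Asub; apply: outA.
- by move=> a al; rewrite asboolT //; apply/lA/span_gen.
- by rewrite asboolF.
Qed.

Lemma characterD chi chi' : character chi -> character chi' ->
  character (fun x => chi x (+) chi' x).
Proof.
move=> H H' x y /=; rewrite H H'.
by case: (chi x); case: (chi y); case: (chi' x); case: (chi' y).
Qed.

End Characters.

(* Compares the multiplicities in two concatenations of the same pieces. *)
Ltac perm_count :=
  apply/permP => ?; rewrite /=; do ?rewrite !count_cat /=;
  repeat match goal with
  | |- context [nat_of_bool ?b] => generalize (nat_of_bool b); intro
  end; lia.

(** * Witt equivalence of lists of square classes *)

(** A list stands for the diagonal form with these entries, [eps] for the class
    of -1, and [h] for the truth of: -1 is a sum of two squares. *)
Section Witt.
Variables (G : zmodType) (exp2 : forall x : G, x + x = 0) (eps : G) (h : bool).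
Implicit Types (s t r : seq G) (x y c u : G).

Local Notation shift c s := (map (fun x : G => x + c) s).

Definition mult s x := count_mem x s.

Lemma mem_mult s x : (x \in s) = (0 < mult s x)%N.
Proof. by rewrite -has_pred1 has_count. Qed.

Lemma mult_cons y s x : mult (y :: s) x = ((y == x) + mult s x)%N.
Proof. by []. Qed.

Lemma mult_nil x : mult [::] x = 0%N.
Proof. by []. Qed.

Lemma mult_cat s t x : mult (s ++ t) x = (mult s x + mult t x)%N.
Proof. exact: count_cat. Qed.

Lemma mult_perm s t : perm_eq s t -> mult s =1 mult t.
Proof. by move=> /permP st x; apply: st. Qed.

Definition multE := (mult_cons, mult_nil, mult_cat).

Lemma size_perm s t : perm_eq s t -> size s = size t.
Proof. exact: perm_size. Qed.

(** The additive order of <1> in the Witt ring, for the level 1, 2 or infinity. *)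
Definition modulus : int := if eps == 0 then 2%:Z else if h then 4%:Z else 0%:Z.

Definition weight s x : int :=
  (mult s x)%:Z - (if eps == 0 then 0%:Z else (mult s (x + eps))%:Z).

(** Equality in the Witt ring, which over a rigid field is the group ring of [G]
    over the integers modulo [modulus], with [eps] set equal to -1. *)
Definition weq s t : Prop :=
  forall x, exists k : int, weight s x = weight t x + modulus * k.

Lemma weq_refl s : weq s s.
Proof. by move=> x; exists 0; rewrite mulr0 addr0. Qed.

Lemma weq_sym s t : weq s t -> weq t s.
Proof. by move=> st x; have [k ->] := st x; exists (- k); ring. Qed.

Lemma weq_trans s t r : weq s t -> weq t r -> weq s r.
Proof.
by move=> st tr x; have [k ->] := st x; have [l ->] := tr x; exists (l + k); ring.
Qed.

Lemma weight_perm s t : perm_eq s t -> weight s =1 weight t.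
Proof. by move=> st x; rewrite /weight !(mult_perm st). Qed.

Lemma weight_cat s t x : weight (s ++ t) x = weight s x + weight t x.
Proof. by rewrite /weight !multE; case: ifP => _; lia. Qed.

Lemma weq_perm s t : perm_eq s t -> weq s t.
Proof. by move=> st x; exists 0; rewrite (weight_perm st) mulr0 addr0. Qed.

Lemma weq_cat s s' t t' : weq s s' -> weq t t' -> weq (s ++ t) (s' ++ t').
Proof.
move=> ss tt x; have [k Ek] := ss x; have [l El] := tt x.
by exists (k + l); rewrite !weight_cat Ek El; ring.
Qed.

Lemma weq_cancel s s' t t' : weq s s' -> weq (s ++ t) (s' ++ t') -> weq t t'.
Proof.
move=> ss st x; have [k Ek] := ss x; have [l El] := st x.
exists (l - k); move: El; rewrite !weight_cat Ek => El.
have ->: weight t x = weight s' x + modulus * k + weight t x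
  - weight s' x - modulus * k by ring.
by rewrite El; ring.
Qed.

Lemma weq_cons x s t : weq s t -> weq (x :: s) (x :: t).
Proof. exact: (@weq_cat [:: x] [:: x] _ _ (weq_refl _)). Qed.

Lemma weq_consK x s t : weq (x :: s) (x :: t) -> weq s t.
Proof. exact: (@weq_cancel [:: x] [:: x] _ _ (weq_refl _)). Qed.

Lemma count_shift c s x : mult (shift c s) x = mult s (x + c).
Proof.
rewrite /mult count_map; apply: eq_count => y /=.
apply/eqP/eqP => [<-|->]; g2 exp2.
Qed.

Lemma weight_shift c s x : weight (shift c s) x = weight s (x + c).
Proof. by rewrite /weight !count_shift addrAC. Qed.

Lemma weq_shift c s t : weq s t -> weq (shift c s) (shift c t).
Proof. by move=> st x; rewrite !weight_shift. Qed.

Lemma eq_addC x c y : (x + c == y) = (x == y + c).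
Proof. by apply/eqP/eqP => [<-|->]; g2 exp2. Qed.

Lemma weq_pair x : weq [:: x; x + eps] [::].
Proof.
move=> y; rewrite /weight /modulus !multE; have [e0|eps0] := eqVneq eps 0.
  by exists (x == y)%:Z; rewrite e0 !addr0; case: (x == y).
exists 0; rewrite (inj_eq (addIr eps)) eq_addC ?mulr0.
by case: (x == y); case: (x == y + eps).
Qed.

Lemma weq_flip x : h -> weq [:: x; x] [:: x + eps; x + eps].
Proof.
move=> hT y; rewrite /weight /modulus hT !multE; have [e0|eps0] := eqVneq eps 0.
  by exists 0; rewrite e0 !addr0; case: (x == y).
exists ((x == y)%:Z - (x == y + eps)%:Z); rewrite (inj_eq (addIr eps)) eq_addC ?mulr0.
by case: (x == y); case: (x == y + eps).
Qed.

Lemma weq_opp s : weq (s ++ shift eps s) [::].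
Proof.
elim: s => [|x s IH]; first exact: weq_refl.
apply: weq_trans (weq_cat (weq_pair x) IH); apply: weq_perm.
by rewrite /= perm_cons perm_sym -cat1s perm_catCA.
Qed.

Lemma perm_head x s : x \in s -> exists s', perm_eq s (x :: s').
Proof. by move=> xs; exists (rem x s); apply: perm_to_rem. Qed.

Lemma count_perm x s n : (n <= mult s x)%N ->
  exists s', perm_eq s (nseq n x ++ s').
Proof.
elim: n s => [|n IH] s le_n; first by exists s.
have [|s' ss] := @perm_head x s; first by rewrite mem_mult; lia.
have [|s'' ss'] := IH s'.
  by move: le_n; rewrite (mult_perm ss) multE eqxx; lia.
by exists s''; apply: (perm_trans ss); rewrite /= perm_cons.
Qed.

(** Cancelling a pair of opposite entries, and negating two equal ones when
    -1 is a sum of two squares, generate Witt equivalence. *)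
Lemma weq_ind (P : seq G -> Prop) :
    (forall s t, perm_eq s t -> P s -> P t) ->
    (forall x s, P s <-> P [:: x, x + eps & s]) ->
    (forall x s, h -> P [:: x, x & s] -> P [:: x + eps, x + eps & s]) ->
  forall s t, weq s t -> P s -> P t.
Proof.
move=> Pperm Ppair Pflip.
have Pp s t : perm_eq s t -> P s <-> P t.
  by move=> st; split; apply: Pperm; rewrite // perm_sym.
have Pf x s : h -> P [:: x, x & s] <-> P [:: x + eps, x + eps & s].
  move=> hT; split; first exact: Pflip.
  by move/(Pflip _ _ hT); rewrite -addrA exp2 addr0.
have P0 n : forall r s, (size r <= n)%N -> weq r [::] -> P (r ++ s) <-> P s.
  elim: n => [|n IH] [|y r] s //= le_r r0.
  have Hpair : y + eps \in r -> P (y :: (r ++ s)) <-> P s.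
    move=> /perm_head [r' rr'].
    rewrite -(IH r' s); last 2 first.
    - by have:= perm_size rr' => /=; lia.
    - apply: (@weq_cancel [:: y; y + eps] [::]); first exact: weq_pair.
      by apply: weq_trans r0; apply: weq_perm; rewrite perm_sym /= perm_cons.
    rewrite (Ppair y (r' ++ s)); apply: Pp; rewrite perm_cons.
    exact: (@perm_cat _ r (y + eps :: r') s s).
  have [k] := r0 y; rewrite /weight /modulus !multE eqxx.
  have [e0|eN0] := eqVneq eps 0.
    rewrite e0 addr0 in Hpair; move=> /= E; apply: Hpair.
    by rewrite mem_mult; lia.
  have yN: (y == y + eps) = false.
    apply/negbTE; apply: contra eN0 => /eqP E; apply/eqP.
    by apply: (eq_by exp2 E); g2 exp2.
  rewrite yN; case: ifPn => hh E; last first.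
    by apply: Hpair; rewrite mem_mult; lia.
  case: (posnP (mult r (y + eps))) => [c0|c0]; last first.
    by apply: Hpair; rewrite mem_mult.
  have [|r' rr'] := @count_perm y r 3; first lia.
  rewrite (Pp _ ([:: y, y & [:: y, y & r' ++ s]])); last first.
    rewrite perm_cons; exact: (perm_cat rr' (perm_refl s)).
  rewrite (Pf _ _ hh) (Pp _ ([:: y, y + eps, y, y + eps & r' ++ s])).
    rewrite -!Ppair; apply: IH; first by have := perm_size rr' => /=; lia.
    have E2: weq [:: y, y, y & y :: r'] [::].
      by apply: weq_trans r0; apply: weq_perm; rewrite perm_sym /= perm_cons.
    apply: weq_trans E2; apply: weq_sym.
    apply: (@weq_cat [:: y; y; y; y] [::]); last exact: weq_refl.
    apply: (@weq_trans _ [:: y + eps; y + eps; y; y]).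
      apply: (@weq_cat [:: y; y] [:: y + eps; y + eps]); last exact: weq_refl.
      exact: weq_flip.
    apply: (@weq_trans _ ([:: y; y + eps] ++ [:: y; y + eps])).
      by apply/weq_perm/permP => a /=; lia.
    by apply: (@weq_cat _ [::] _ [::]); exact: weq_pair.
  by apply/permP => a /=; lia.
(* Pass from s to s - t + t, and then remove s - t. *)
move=> s t st; have E := P0 _ (t ++ shift eps t) s (leqnn _) (weq_opp _).
rewrite -E (Pp _ ((s ++ shift eps t) ++ t)); last first.
  by apply/permP => a; rewrite !count_cat; lia.
rewrite P0 //; apply: weq_trans (weq_opp t).
by apply: weq_cat => //; exact: weq_refl.
Qed.

Lemma odd_size_weq s t : weq s t -> odd (size s) = odd (size t).
Proof.
move=> st; symmetry.
apply: (@weq_ind (fun r => odd (size r) = odd (size s))) st _ => //.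
- by move=> r r' /perm_size ->.
- by move=> x r /=; rewrite negbK.
Qed.

(** * Anisotropic lists *)

Definition aniso s := forall t, weq s t -> (size s <= size t)%N.

Lemma aniso_min s : exists t, [/\ weq s t, aniso t & (size t <= size s)%N].
Proof.
pose P n := `[< exists2 t, weq s t & size t = n >].
have exP : exists n, P n by exists (size s); apply/asboolP; exists s => //; exact: weq_refl.
case: (ex_minnP exP) => n /asboolP[t st tn] minn.
exists t; split=> //.
  move=> r tr; rewrite tn; apply: minn; apply/asboolP; exists r => //.
  exact: weq_trans tr.
by rewrite tn; apply: minn; apply/asboolP; exists s => //; exact: weq_refl.
Qed.

Lemma aniso_weq s t : aniso s -> weq s t -> (size t <= size s)%N -> aniso t.
Proof.
move=> As st le r tr; apply: leq_trans le _; apply: As; exact: weq_trans tr.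
Qed.

Lemma aniso_perm s t : perm_eq s t -> aniso s -> aniso t.
Proof.
move=> st As; apply: aniso_weq As _ _; first exact: weq_perm.
by rewrite (perm_size st).
Qed.

Lemma aniso_catl s t : aniso (s ++ t) -> aniso s.
Proof.
move=> A r sr; have := A (r ++ t); rewrite !size_cat leq_add2r; apply.
by apply: weq_cat => //; exact: weq_refl.
Qed.

Lemma aniso_catr s t : aniso (s ++ t) -> aniso t.
Proof.
move=> A; apply: (@aniso_catl _ s); apply: aniso_perm A.
by rewrite perm_catC.
Qed.

Lemma aniso_size s t : aniso s -> aniso t -> weq s t -> size s = size t.
Proof.
by move=> As At st; apply/eqP; rewrite eqn_leq As // At //; exact: weq_sym.
Qed.

(** <x, -x> cancels, and <x, x, x> = <x, -x, -x> if -1 is a sum of two squares. *)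
Definition shortens s x :=
  if eps == 0 then (1 < mult s x)%N
  else (0 < mult s x)%N && (0 < mult s (x + eps))%N
       || h && (2 < mult s x)%N.

Definition reduced s := forall x, ~~ shortens s x.

Lemma reduced_cons x s : reduced (x :: s) -> reduced s.
Proof.
by move=> R y; have := R y; rewrite /shortens !multE; case: ifP => _ /=; lia.
Qed.

(** An entry of a reduced list survives in every Witt-equivalent list, up to
    the relation <x, x> = <-x, -x>, which holds if -1 is a sum of two squares. *)
Lemma reduced_in s t x : reduced s -> weq s t -> x \in s ->
  x \in t \/ [/\ h, eps != 0 & (1 < mult t (x + eps))%N].
Proof.
move=> R st xs; have [k] := st x; have := R x; rewrite /shortens /weight /modulus.
have c0 : (0 < mult s x)%N by rewrite -mem_mult.
case: (posnP (mult t x)) => [E|c]; last first.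
  by move=> _ _; left; rewrite mem_mult.
by rewrite E; case: ifPn => e0; [lia|case: ifP => hT ? ?; [right; split=> //|]; lia].
Qed.

Lemma reduced_aniso s : reduced s -> aniso s.
Proof.
elim: s => [|x s IH] // R t st; have Rs := reduced_cons R.
have [/perm_head[t' tt']|[hT e c]] := reduced_in R st (mem_head _ _).
  rewrite (perm_size tt') /= ltnS; apply: (IH Rs).
  exact: weq_consK (weq_trans st (weq_perm tt')).
have [t' tt'] := count_perm c; rewrite (perm_size tt') /= ltnS.
apply: (IH Rs (x :: t')); apply: (@weq_consK x).
apply: weq_trans st _; apply: weq_trans (weq_perm tt') _.
apply: weq_sym; apply: (@weq_cat [:: x; x] [:: x + eps; x + eps]).
  exact: weq_flip.
exact: weq_refl.
Qed.

Lemma nonaniso_shortens s : ~ aniso s -> exists x, shortens s x.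
Proof.
move=> nA; apply: contrapT => nex; apply/nA/reduced_aniso => x.
by apply/negP => ex; apply: nex; exists x.
Qed.

Lemma aniso_reduced s : aniso s -> reduced s.
Proof.
move=> As x; apply/negP; rewrite /shortens.
have pairF s' : perm_eq s [:: x, x + eps & s'] -> False.
  move=> ss; have := perm_size ss.
  suff /As : weq s s' by move=> /=; lia.
  apply: weq_trans (weq_perm ss) _; apply: (@weq_cat [:: x; x + eps] [::]).
    exact: weq_pair.
  exact: weq_refl.
have [e0|eN0] := eqVneq eps 0.
  by case/(@count_perm _ _ 2) => s' /=; rewrite -{2}[x]addr0 -e0 => /pairF.
case/orP=> [/andP[c c']|/andP[hT /(@count_perm _ _ 3) [s' /= ss]]].
  have [s1 ss1] := @count_perm _ _ 1 c; rewrite /= in ss1.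
  have [|s2 ss2] := @count_perm (x + eps) s1 1; last first.
    by apply: (pairF s2); apply: perm_trans ss1 _; rewrite perm_cons.
  move: c'; rewrite (mult_perm ss1) multE; case: eqP => // E.
  by case/eqP: eN0; apply: (eq_by exp2 E); g2 exp2.
have := perm_size ss; suff /As : weq s (x + eps :: s') by move=> /=; lia.
apply: weq_trans (weq_perm ss) _.
apply: (@weq_trans _ [:: x, x + eps, x + eps & s']).
  apply/weq_cons/(@weq_cat [:: x; x] [:: x + eps; x + eps]); last exact: weq_refl.
  exact: weq_flip.
apply: (@weq_cat [:: x; x + eps] [::]); [exact: weq_pair|exact: weq_refl].
Qed.

(** * Invariants of the powers of the fundamental ideal *)

(** Even dimension and trivial signed discriminant: membership in I^2. *)
Definition disc_trivial s :=
  ~~ odd (size s) && (\sum_(x <- s) x == eps *+ (size s)./2).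

(** The entries at which [chi] vanishes are the positive ones of an ordering, and
    the signature there is divisible by 8. *)
Definition sgn8 chi s : Prop :=
  exists k : int, (count chi s)%:Z = (count (predC chi) s)%:Z + 8%:Z * k.

(** Conditions that every form in I^3 satisfies: a character that is trivial at -1
    gives two residues, which are in I^2, and one that is not gives a signature. *)
Definition inI3 s : Prop :=
  (forall chi, character chi -> chi eps = false ->
     disc_trivial (filter chi s) /\ disc_trivial (filter (predC chi) s)) /\
  (~~ h -> forall chi, character chi -> chi eps -> sgn8 chi s).

Lemma disc_trivialE s : disc_trivial s <->
  exists k, size s = k.*2 /\ \sum_(x <- s) x = eps *+ k.
Proof.
rewrite /disc_trivial; split=> [/andP[ev /eqP ->]|[k [-> ->]]].
  by exists (size s)./2; rewrite even_halfK.
by rewrite odd_double doubleK eqxx.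
Qed.

Lemma disc_trivial_perm s t : perm_eq s t -> disc_trivial s = disc_trivial t.
Proof. by move=> st; rewrite /disc_trivial (perm_size st) (perm_big _ st). Qed.

Lemma disc_trivial_cat s t :
  disc_trivial s -> disc_trivial t -> disc_trivial (s ++ t).
Proof.
move=> /disc_trivialE[k [sk Ek]] /disc_trivialE[l [tl El]].
apply/disc_trivialE; exists (k + l)%N.
by rewrite size_cat sk tl doubleD big_cat /= Ek El mulrnDr.
Qed.

Lemma disc_trivial_catK s t :
  disc_trivial s -> disc_trivial (s ++ t) -> disc_trivial t.
Proof.
move=> /disc_trivialE[k [sk Ek]] /disc_trivialE[l [tl El]].
move: tl El; rewrite size_cat big_cat /= sk Ek => tl El.
apply/disc_trivialE; exists (l - k)%N; split; first lia.
apply: (@addrI _ (eps *+ k)); rewrite El -mulrnDr; congr (_ *+ _); lia.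
Qed.

Lemma disc_trivial_pair x s : disc_trivial [:: x, x + eps & s] = disc_trivial s.
Proof.
rewrite /disc_trivial /= negbK !big_cons mulrS; congr (_ && _).
have ->: x + (x + eps + \sum_(y <- s) y) = eps + \sum_(y <- s) y by g2 exp2.
by rewrite (inj_eq (addrI eps)).
Qed.

Lemma disc_trivial_flip x s :
  disc_trivial [:: x + eps, x + eps & s] = disc_trivial [:: x, x & s].
Proof.
rewrite /disc_trivial /= !big_cons.
have E y : x + eps + (x + eps + y) = x + (x + y) by g2 exp2.
by rewrite E.
Qed.

Lemma disc_trivial_weq s t : weq s t -> disc_trivial s -> disc_trivial t.
Proof.
apply: (@weq_ind disc_trivial).
- by move=> r r' /disc_trivial_perm->.
- by move=> x r; rewrite disc_trivial_pair.
- by move=> x r _; rewrite disc_trivial_flip.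
Qed.

Lemma inI3_weq s t : weq s t -> inI3 s -> inI3 t.
Proof.
move=> st [J S]; split=> [chi chiD e0|hN chi chiD e1].
  have xe x : chi (x + eps) = chi x by rewrite chiD e0 addbF.
  have F (f : G -> bool) : (forall x, f (x + eps) = f x) ->
      disc_trivial (filter f s) -> disc_trivial (filter f t).
    move=> fe; apply: (@weq_ind (fun r => disc_trivial (filter f r))) st.
    - by move=> r r' rr'; rewrite (disc_trivial_perm (perm_filter _ rr')).
    - by move=> x r; rewrite /= fe; case: (f x); rewrite ?disc_trivial_pair.
    - by move=> x r _; rewrite /= fe; case: (f x); rewrite ?disc_trivial_flip.
  have [J0 J1] := J _ chiD e0; split; first exact: F.
  by apply: F J1 => x; congr (~~ _); apply: xe.
apply: (@weq_ind (sgn8 chi)) st (S hN _ chiD e1).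
- by move=> r r' /permP rr' [k E]; exists k; rewrite -!rr'.
- move=> x r; have xe : chi (x + eps) = ~~ chi x by rewrite chiD e1 addbT.
  rewrite /sgn8 /= xe.
  by case: (chi x) => /=; split=> -[k E]; exists k; lia.
- by move=> x r hT; rewrite hT in hN.
Qed.

Lemma inI3_disc s : inI3 s -> disc_trivial s.
Proof.
case=> J _; have [|//|_] := J (fun=> false); first by [].
by rewrite (@eq_filter _ _ predT) ?filter_predT.
Qed.

Lemma inI3_cat s t : inI3 s -> inI3 t -> inI3 (s ++ t).
Proof.
move=> [Js Ss] [Jt St]; split=> [chi chiD e0|hN chi chiD e1].
  have [J0 J1] := Js _ chiD e0; have [K0 K1] := Jt _ chiD e0.
  by rewrite !filter_cat; split; apply: disc_trivial_cat.
have [k Ek] := Ss hN _ chiD e1; have [l El] := St hN _ chiD e1.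
by exists (k + l); rewrite !count_cat; lia.
Qed.

Lemma inI3_catK s t : inI3 s -> inI3 (s ++ t) -> inI3 t.
Proof.
move=> [Js Ss] [Jt St]; split=> [chi chiD e0|hN chi chiD e1].
  have [J0 J1] := Js _ chiD e0; have := Jt _ chiD e0.
  rewrite !filter_cat => -[K0 K1].
  by split; [apply: disc_trivial_catK K0|apply: disc_trivial_catK K1].
have [k Ek] := Ss hN _ chiD e1; have [l El] := St hN _ chiD e1.
by exists (l - k); move: El; rewrite !count_cat; lia.
Qed.

Lemma inI3_nil : inI3 [::].
Proof.
split=> [chi _ _|_ chi _ _]; last by exists 0.
by rewrite /disc_trivial /= big_nil.
Qed.

(** c <<-a, -b>> and c <<-a, -b, -d>>: the sign of the slots is absorbed in the
    classes. *)
Definition gp2 c a b := [:: c; c + a; c + b; c + a + b].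
Definition gp3 c a b d := gp2 c a b ++ gp2 (c + d) a b.

Lemma inI3_gp3 c a b d : inI3 (gp3 c a b d).
Proof.
split=> [chi chiD e0|hN chi chiD e1].
  rewrite /gp3 /= !chiD; case: (chi c); case: (chi a); case: (chi b);
    case: (chi d) => /=; rewrite /disc_trivial /= ?big_cons ?big_nil;
    rewrite ?mulrS ?mulr0n ?eqxx //; split; try (apply/eqP; g2 exp2); by [].
rewrite /sgn8 /gp3 /= !chiD; case: (chi c); case: (chi a); case: (chi b);
  case: (chi d) => /=; by [exists 0|exists 1|exists (-1)].
Qed.

Lemma disc_trivial_4 x y z w : disc_trivial [:: x; y; z; w] ->
  [:: x; y; z; w] = gp2 x (x + y) (x + z).
Proof.
rewrite /disc_trivial /= !big_cons big_nil => /eqP E.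
congr [:: _; _; _; _]; try g2 exp2.
by apply: (eq_by exp2 E); rewrite mulr2n; g2 exp2.
Qed.

Lemma disc_trivial_size4 s : disc_trivial s -> size s = 4%N ->
  exists x a b, s = gp2 x a b.
Proof.
case: s => [|x [|y [|z [|w [|]]]]] // /disc_trivial_4 -> _.
by exists x, (x + y), (x + z).
Qed.

Lemma aniso_pairF x s : aniso [:: x, x + eps & s] -> False.
Proof.
move=> /(_ s) /=; suff H : weq [:: x, x + eps & s] s by move=> /(_ H); lia.
by apply: (@weq_cat [:: x; x + eps] [::]); [apply: weq_pair|apply: weq_refl].
Qed.

Lemma disc_trivial_aniso s : aniso s -> disc_trivial s ->
  s = [::] \/ (4 <= size s)%N.
Proof.
case: s => [|x [|y [|z [|w s]]]] //; rewrite /disc_trivial /=; [by left| |by right].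
move=> A; rewrite !big_cons big_nil addr0 mulr1n => /eqP E.
suff Ey : y = x + eps by rewrite Ey in A; case: (aniso_pairF A).
by apply: (eq_by exp2 E); g2 exp2.
Qed.

Lemma perm_filter_cat (f : G -> bool) s :
  perm_eq s (filter f s ++ filter (predC f) s).
Proof. by rewrite perm_sym perm_filterC. Qed.

Lemma aniso_filter (f : G -> bool) s : aniso s -> aniso (filter f s).
Proof. by move/(aniso_perm (perm_filter_cat f s))/aniso_catl. Qed.

Lemma aniso_opposite s x : aniso s -> x \in s -> x + eps \in s -> eps = 0.
Proof.
move=> As xs xes; apply/eqP; apply: contraT => eN.
have := aniso_reduced As x; rewrite /shortens (negPf eN) -!mem_mult xs.
by rewrite xes.
Qed.

Lemma nseq_mult s x : {in s, forall y, y = x} -> s = nseq (size s) x.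
Proof. by move=> H; apply/all_pred1P/allP => y /H /= ->. Qed.

(** If no residue map separates the entries, then they agree up to sign, so
    there is only one of them up to multiplicity, and a signature forces the
    multiplicity to be divisible by 8. *)
Lemma split_or_nseq s : aniso s -> inI3 s ->
  (exists x k, s = nseq (8 * k) x) \/
  exists chi, [/\ character chi, chi eps = false, has chi s & has (predC chi) s].
Proof.
move=> As I3; have [|nsplit] := pselect (exists chi,
  [/\ character chi, chi eps = false, has chi s & has (predC chi) s]).
  by right.
left; case: s => [|x s] in As I3 nsplit *; first by exists 0, 0%N.
have same y : y \in x :: s -> y = x.
  move=> ys; have [xy|/(character_separates exp2)[chi [chiD l xy]]] :=
    boolP (x + y \in span [:: eps]).
    move: xy; rewrite /= !inE addr0 => /orP[/eqP E|/eqP E].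
      by apply: (eq_by exp2 E); g2 exp2.
    have Ey : y = x + eps by apply: (eq_by exp2 E); g2 exp2.
    move: ys; rewrite Ey => /(aniso_opposite As (mem_head _ _)) ->.
    by rewrite addr0.
  case: nsplit; exists chi; split=> //; first by apply: l; rewrite mem_head.
    apply/hasP; move: xy; rewrite chiD.
    by case E: (chi x) => cy; [exists x; rewrite ?mem_head|exists y].
  apply/hasP; move: xy; rewrite chiD.
  by case E: (chi x) => cy; [exists y|exists x; rewrite ?mem_head //= E].
exists x; have sE := nseq_mult same; set n := size (x :: s) in sE.
suff [k nk] : exists k, n = (8 * k)%N by exists k; rewrite -nk.
have mn : mult (x :: s) x = n.
  by apply/eqP; rewrite /mult -all_count; apply/allP => y /same -> /=.
have := aniso_reduced As x; have := inI3_disc I3.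
rewrite /shortens mn /disc_trivial -/n; have [e0|eN0] := eqVneq eps 0.
  by move=> /andP[ev _] /= c; exists 0%N; lia.
case: (boolP h) => hT.
  have [n2|] := eqVneq n 2%N; last first.
    by move=> n2 /andP[ev _] c; exists 0%N; lia.
  rewrite sE n2 /= !big_cons big_nil addr0 exp2 mulr1n eq_sym => E.
  by rewrite (negPf eN0) in E.
have [|chi [chiD _ e1]] := @character_separates _ exp2 [::] eps.
  by rewrite inE.
have [_ /(_ hT chi chiD e1) [k]] := I3.
rewrite sE !count_nseq [predC chi x]/(~~ chi x) => E _ _; exists `|k|%N.
by move: E; case: (chi x) => /=; lia.
Qed.

Lemma inI3_split s : aniso s -> inI3 s ->
  (exists x k, s = nseq (8 * k) x) \/
  exists s0 s1, [/\ perm_eq s (s0 ++ s1), disc_trivial s0, disc_trivial s1,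
    (4 <= size s0)%N & (4 <= size s1)%N].
Proof.
move=> As I3; have [|[chi [chiD e0 h1 h0]]] := split_or_nseq As I3; first by left.
have [J _] := I3; have [J1 J0] := J _ chiD e0; right.
exists (filter chi s), (filter (predC chi) s); split=> //.
- exact: perm_filter_cat.
- have [E|//] := disc_trivial_aniso (@aniso_filter chi _ As) J1.
  by move: h1; rewrite has_filter E.
- have [E|//] := disc_trivial_aniso (@aniso_filter (predC chi) _ As) J0.
  by move: h0; rewrite has_filter E.
Qed.

(** * Values of a list and cancellation between lists *)

(** For anisotropic lists, these are the values of the form: [x] can be split off. *)
Definition value s x := exists s', weq s (x :: s') /\ size s = (size s').+1.

Lemma value_mem s x : x \in s -> value s x.
Proof.
by case/perm_head=> s' ss; exists s'; split; [apply: weq_perm|rewrite (size_perm ss)].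
Qed.

Lemma value_flip s x : h -> (1 < mult s x)%N -> value s (x + eps).
Proof.
move=> hT /count_perm[s' ss]; exists (x + eps :: s').
split; last by rewrite (size_perm ss).
apply: weq_trans (weq_perm ss) (@weq_cat [:: x; x] [:: x + eps; x + eps] _ _ _ _).
  exact: weq_flip.
exact: weq_refl.
Qed.

Lemma aniso_mult s x : aniso s ->
  [/\ eps = 0 -> (mult s x <= 1)%N,
      eps <> 0 -> (0 < mult s x)%N -> mult s (x + eps) = 0%N
    & h -> eps <> 0 -> (mult s x <= 2)%N].
Proof.
move=> /aniso_reduced /(_ x); rewrite /shortens.
by have [e0|/eqP eN] := eqVneq eps 0; move=> H; split=> //; lia.
Qed.

(** When three anisotropic lists have an isotropic sum, either two of them
    contain opposite values, or -1 is a sum of two squares and the three have a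
    common value. *)
Lemma nonaniso_cat3 A B C : aniso A -> aniso B -> aniso C ->
    ~ aniso (A ++ B ++ C) ->
  [\/ exists2 e, value A e & value B (e + eps),
      exists2 e, value A e & value C (e + eps),
      exists2 e, value B e & value C (e + eps)
    | h /\ exists y, [/\ value A y, value B y & value C y]].
Proof.
move=> AA AB AC /nonaniso_shortens[x].
have [A0 A1 A2] := aniso_mult x AA; have [B0 B1 B2] := aniso_mult x AB.
have [C0 C1 C2] := aniso_mult x AC.
have xe : x + eps + eps = x by g2 exp2.
have V s : (0 < mult s x)%N -> value s x by rewrite -mem_mult; apply: value_mem.
have Ve s : (0 < mult s (x + eps))%N -> value s (x + eps).
  by rewrite -mem_mult; apply: value_mem.
rewrite /shortens !multE; have [e0|/eqP eN] := eqVneq eps 0.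
  have {}V s : (0 < mult s x)%N -> value s x /\ value s (x + eps).
    by rewrite e0 addr0 => /V.
  move: (A0 e0) (B0 e0) (C0 e0) (V A) (V B) (V C).
  case: (mult A x) => [|a]; case: (mult B x) => [|b];
    case: (mult C x) => [|c] H1 H2 H3 VA VB VC H; try lia;
  solve [ by constructor 1; exists x; [apply VA|apply VB]
        | by constructor 2; exists x; [apply VA|apply VC]
        | by constructor 3; exists x; [apply VB|apply VC] ].
case/orP=> [/andP[c c']|/andP[hT c]].
  move: c c' (A1 eN) (B1 eN) (C1 eN) (V A) (V B) (V C) (Ve A) (Ve B) (Ve C).
  case: (posnP (mult A x)) => [->|a] c c';
  case: (posnP (mult B x)) => [EB|b]; case: (posnP (mult C x)) => [EC|d];
  move=> H1 H2 H3 VA VB VC VA' VB' VC'; try lia;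
  case: (posnP (mult A (x + eps))) => [EA'|a'];
  case: (posnP (mult B (x + eps))) => [EB'|b'];
  case: (posnP (mult C (x + eps))) => [EC'|d']; try lia;
  solve [ by constructor 1; exists x; auto
        | by constructor 2; exists x; auto
        | by constructor 3; exists x; auto
        | by constructor 1; exists (x + eps); rewrite ?xe; auto
        | by constructor 2; exists (x + eps); rewrite ?xe; auto
        | by constructor 3; exists (x + eps); rewrite ?xe; auto ].
have F s : (1 < mult s x)%N -> value s (x + eps) by apply: value_flip.
move: c (A2 hT eN) (B2 hT eN) (C2 hT eN) (V A) (V B) (V C) (F A) (F B) (F C).
case: (posnP (mult A x)) => [->|a]; case: (posnP (mult B x)) => [->|b];
case: (posnP (mult C x)) => [->|d]; move=> c H1 H2 H3 VA VB VC FA FB FC;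
  try lia;
case: (ltnP 1 (mult A x)) => a'; case: (ltnP 1 (mult B x)) => b';
case: (ltnP 1 (mult C x)) => d'; try lia;
solve [ by constructor 4; split=> //; exists x; split; auto
      | by constructor 1; exists (x + eps); rewrite ?xe; auto
      | by constructor 2; exists (x + eps); rewrite ?xe; auto
      | by constructor 3; exists (x + eps); rewrite ?xe; auto
      | by constructor 1; exists x; auto
      | by constructor 2; exists x; auto
      | by constructor 3; exists x; auto ].
Qed.

Lemma value_nil x : ~ value [::] x.
Proof. by case=> s []. Qed.

Lemma nonaniso_cat A B : aniso A -> aniso B -> ~ aniso (A ++ B) ->
  exists2 e, value A e & value B (e + eps).
Proof.
move=> AA AB nA; have A0 : aniso [::] by move=> t.
have := nonaniso_cat3 AA AB A0; rewrite cats0 => /(_ nA).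
by case=> [|[e _ /value_nil]|[e _ /value_nil]|[_ [y [_ _ /value_nil]]]].
Qed.

Lemma weq_drop l s t : perm_eq t (l ++ shift eps l ++ s) -> weq t s.
Proof.
move=> /weq_perm tl; apply: weq_trans tl _; rewrite catA.
apply: (@weq_cat _ [::]); [exact: weq_opp|exact: weq_refl].
Qed.

Lemma weq_cat_drop A B A' B' e : weq A (e :: A') -> weq B (e + eps :: B') ->
  weq (A ++ B) (A' ++ B').
Proof.
move=> AA BB; apply: weq_trans (weq_cat AA BB) (@weq_drop [:: e] _ _ _).
by perm_count.
Qed.

(** * Forms of dimension at most 10 in I^3 *)

(** The Hauptsatz for I^3: a form splits into two residues of dimension at least
    4, or has all entries equal, in a number divisible by 8. *)
Lemma inI3_small s : aniso s -> inI3 s -> (size s < 8)%N -> s = [::].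
Proof.
move=> As I3 lt8; have [[x [k E]]|[s0 [s1 [/size_perm E _ _ l0 l1]]]] :=
  inI3_split As I3.
  by move: lt8; rewrite E size_nseq; case: k {E} => // k; rewrite mulnS.
by exfalso; move: lt8; rewrite E size_cat; lia.
Qed.

Definition tail3 y a b := [:: y + a + eps; y + b + eps; y + a + b + eps].

(** A binary multiple <x, y> of the twofold Pfister form is a general threefold
    one, and subtracting it trades [y] for the three entries of [tail3]. *)
Lemma weq_step x a b y s1 :
  weq (gp2 x a b ++ y :: s1) (gp3 x a b (x + y) ++ (tail3 y a b ++ s1)).
Proof.
apply: weq_sym; apply: (@weq_drop [:: y + a; y + b; y + a + b]).
rewrite /gp3 /gp2; have ->: x + (x + y) = y by g2 exp2.
by perm_count.
Qed.

Lemma inI3_step x a b y s1 : inI3 (gp2 x a b ++ y :: s1) ->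
  inI3 (tail3 y a b ++ s1).
Proof. by move=> /(inI3_weq (weq_step _ _ _ _ _)); apply/inI3_catK/inI3_gp3. Qed.

Lemma inI3_step_small x a b y s1 : inI3 (gp2 x a b ++ y :: s1) -> size s1 = 3%N ->
  weq (gp2 x a b ++ y :: s1) (gp3 x a b (x + y)).
Proof.
move=> /inI3_step I3 s1E; apply: weq_trans (weq_step _ _ _ _ _) _.
have [t [st At le_t]] := aniso_min (tail3 y a b ++ s1).
have t0 := inI3_small At (inI3_weq st I3).
have {}t0 : t = [::] by apply: t0; move: le_t; rewrite /= s1E; lia.
rewrite -[X in weq _ X]cats0; apply: weq_cat; first exact: weq_refl.
by rewrite -t0.
Qed.

Lemma inI3_size8 s : aniso s -> inI3 s -> size s = 8%N ->
  exists c a b d, weq s (gp3 c a b d).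
Proof.
move=> As I3 s8; have [[x [k E]]|[s0 [s1 [ss J0 J1 l0 l1]]]] := inI3_split As I3.
  exists x, 0, 0, 0; rewrite /gp3 /gp2 !addr0 E.
  have ->: k = 1%N by move: s8; rewrite E size_nseq; lia.
  exact: weq_refl.
have := size_perm ss; rewrite size_cat s8 => E.
have [|x [a [b E0]]] := disc_trivial_size4 J0; first lia.
case: s1 => [|y s1] // in ss J1 l1 E *; exists x, a, b, (x + y).
apply: weq_trans (weq_perm ss) _; rewrite E0.
apply: inI3_step_small; last by move: E l1 => /=; lia.
by rewrite -E0; apply: inI3_weq I3; apply: weq_perm.
Qed.

(** A binary subform <p, q> of an anisotropic threefold Pfister form divides it:
    a residue map that does not separate [p] from [q] cuts out a twofold form
    that contains both. *)
Lemma gp3_binary p q s : aniso [:: p, q & s] -> inI3 [:: p, q & s] ->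
  size s = 6%N -> exists b c, weq [:: p, q & s] (gp3 p (p + q) b c).
Proof.
move=> As I3 s6; have [Jchi _] := I3; set l := [:: p, q & s] in As I3 Jchi *.
have [pl ql] : p \in l /\ q \in l by rewrite !inE !eqxx orbT.
have l8 : size l = 8%N by rewrite /= s6.
have cut (f : G -> bool) : f p -> has (predC f) l ->
    disc_trivial (filter f l) -> disc_trivial (filter (predC f) l) ->
    size (filter f l) = 4%N /\ size (filter (predC f) l) = 4%N.
  move=> fp hf J0 J1.
  have [E|l0] := disc_trivial_aniso (@aniso_filter f _ As) J0.
    by have := mem_filter f p l; rewrite E fp pl.
  have [E|l1] := disc_trivial_aniso (@aniso_filter (predC f) _ As) J1.
    by rewrite has_filter E in hf.
  by have := size_perm (perm_filter_cat f l); rewrite size_cat l8; lia.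
have [[chi [chiD e0 pq hf hC]]|nchi] := pselect (exists chi, [/\ character chi,
    chi eps = false, chi p = chi q, has chi l & has (predC chi) l]).
  have [f [fp fq hCf [J0 J1]]] : exists f : G -> bool, [/\ f p, f q,
      has (predC f) l &
      disc_trivial (filter f l) /\ disc_trivial (filter (predC f) l)].
    have J := Jchi _ chiD e0; case E: (chi p); first by exists chi; rewrite -pq E.
    exists (predC chi); split; [by rewrite /= E|by rewrite /= -pq E| |].
      case/hasP: hf => z zl cz; apply/hasP; exists z => //.
      by change (~~ ~~ chi z); rewrite cz.
    by rewrite (@eq_filter _ (predC (predC chi)) chi) => [|z /=];
      [case: J|rewrite negbK].
  have [s0 s1] := cut f fp hCf J0 J1; have ll := perm_filter_cat f l.
  have Fl : filter f l = [:: p, q & filter f s] by rewrite /l /= fp fq.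
  rewrite {}Fl in s0 J0 ll; case: (filter f s) s0 J0 ll => [|r [|z []]] // _.
  move=> /disc_trivial_4 ->; case: (filter _ l) s1 => [|y [|y1 [|y2 [|y3 []]]]] // _.
  move=> ll; exists (p + r), (p + y); apply: weq_trans (weq_perm ll) _.
  by apply: inI3_step_small => //; apply: inI3_weq I3; apply: weq_perm.
have lpq (r : G) : r \in l -> r = p \/ r = q.
  move=> rl; have [|/(character_separates exp2)[chi [chiD ll pr]]] :=
    boolP (p + r \in span [:: eps; p + q]); last first.
    case: nchi; exists chi; split=> //; first by apply: ll; rewrite mem_head.
    - have := ll (p + q); rewrite !inE eqxx orbT => /(_ isT).
      by rewrite chiD; case: (chi p); case: (chi q).
    - apply/hasP; move: pr; rewrite chiD.
      by case E: (chi p) => c; [exists p|exists r].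
    - apply/hasP; move: pr; rewrite chiD.
      by case E: (chi p) => c; [exists r|exists p; rewrite //= E].
  rewrite /= !inE !addr0 => /or4P[] /eqP E.
  - by left; apply: (eq_by exp2 E); g2 exp2.
  - by right; apply: (eq_by exp2 E); g2 exp2.
  - have Er : r = p + eps by apply: (eq_by exp2 E); g2 exp2.
    by left; rewrite Er (aniso_opposite As pl) ?addr0 // -Er.
  - have Er : r = q + eps by apply: (eq_by exp2 E); g2 exp2.
    by right; rewrite Er (aniso_opposite As ql) ?addr0 // -Er.
exists 0, 0; have [Epq|Npq] := eqVneq p q.
  have E : l = nseq 8 p by rewrite -l8; apply: nseq_mult => r /lpq; rewrite -Epq => -[].
  by rewrite E Epq exp2 /gp3 /gp2 !addr0; apply: weq_refl.
have [|chi [chiD ll cpq]] := @character_separates _ exp2 [:: eps] (p + q).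
  rewrite /= !inE addr0 eq_addr0 //; apply/norP; split=> //; apply/eqP => E.
  have Eq : q = p + eps by apply: (eq_by exp2 E); g2 exp2.
  by move: As; rewrite /l Eq => /aniso_pairF.
have e0 : chi eps = false by apply: ll; rewrite mem_head.
have [J0 J1] := Jchi _ chiD e0.
have [f [fp fq]] : exists f : G -> bool, [/\ f p, ~~ f q &
    disc_trivial (filter f l) /\ disc_trivial (filter (predC f) l)].
  move: cpq; rewrite chiD; case E: (chi p) => cq; first by exists chi.
  exists (predC chi); split; [by rewrite /= E|by rewrite /= negbK|].
  by rewrite (@eq_filter _ (predC (predC chi)) chi) => // z /=; rewrite negbK.
case=> {}J0 {}J1; have [|s0 s1] := cut f fp _ J0 J1.
  by apply/hasP; exists q.
have E0 : filter f l = nseq 4 p.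
  rewrite -s0; apply: nseq_mult => r; rewrite mem_filter => /andP[fr /lpq[]//].
  by move=> E; rewrite E (negPf fq) in fr.
have E1 : filter (predC f) l = nseq 4 q.
  rewrite -s1; apply: nseq_mult => r; rewrite mem_filter => /andP[fr /lpq[]//].
  by move=> E; rewrite E /= fp in fr.
apply: weq_trans (weq_perm (perm_filter_cat f l)) _; rewrite E0 E1; apply: weq_perm.
rewrite /gp3 /gp2 !addr0; have ->: p + (p + q) = q by g2 exp2.
by perm_count.
Qed.

(** * Multiples of a binary form *)

(** The multiple <1, u> x [s]. *)
Definition dbl u s := s ++ shift u s.

Ltac perm_count_dbl :=
  repeat match goal with
  | |- context [dbl ?u ?s] => generalize (dbl u s); intro
  end; perm_count.

Lemma size_dbl u s : size (dbl u s) = (size s).*2.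
Proof. by rewrite size_cat size_map addnn. Qed.

Lemma weq_dbl u s t : weq s t -> weq (dbl u s) (dbl u t).
Proof. by move=> st; apply: weq_cat => //; apply: weq_shift. Qed.

Lemma dbl_cons u x s : perm_eq (dbl u (x :: s)) [:: x, x + u & dbl u s].
Proof.
by rewrite /dbl /= perm_cons -cat1s perm_catCA.
Qed.

Lemma dbl_cat u s t : perm_eq (dbl u (s ++ t)) (dbl u s ++ dbl u t).
Proof. by apply/permP => a; rewrite /dbl map_cat !count_cat; lia. Qed.

Lemma mult_dbl u s x : mult (dbl u s) x = (mult s x + mult s (x + u))%N.
Proof. by rewrite mult_cat count_shift. Qed.

Lemma dbl_partner u x s : perm_eq (dbl u (x + u :: s)) (dbl u (x :: s)).
Proof.
apply: (perm_trans (dbl_cons _ _ _)); rewrite perm_sym.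
apply: (perm_trans (dbl_cons _ _ _)).
by rewrite -addrA exp2 addr0 (perm_catCA [:: x] [:: x + u]).
Qed.

Lemma weq_flip_dbl u x s : h ->
  weq (dbl u [:: x + eps, x + eps & s]) (dbl u [:: x, x & s]).
Proof.
move=> hT; apply: weq_dbl; apply: weq_sym.
apply: (@weq_cat [:: x; x] [:: x + eps; x + eps]); first exact: weq_flip.
exact: weq_refl.
Qed.

(** Every value of a multiple <1, u> x s can be taken as an entry of [s], because
    <x, u x> = <y, u y> for each value [y] of <x, u x>. *)
Lemma dbl_value u s x :
    x \in dbl u s \/ h /\ (1 < mult (dbl u s) (x + eps))%N ->
  exists s', size s = (size s').+1 /\ weq (dbl u s) (dbl u (x :: s')).
Proof.
case=> [|[hT]].
  rewrite mem_cat => /orP[/perm_head[s' ss]|/mapP[y /perm_head[s' ss] ->]].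
    exists s'; rewrite (size_perm ss); split=> //.
    exact/weq_dbl/weq_perm.
  exists s'; rewrite (size_perm ss); split=> //.
  apply: weq_trans (weq_dbl _ (weq_perm ss)) (weq_perm _).
  by rewrite perm_sym dbl_partner.
set z := x + eps; have two s' : perm_eq (dbl u s) (dbl u [:: z, z & s']) ->
    exists s', size s = (size s').+1 /\ weq (dbl u s) (dbl u (x :: s')).
  move=> ss; exists (x :: s'); split.
    by have := size_perm ss; rewrite !size_dbl /=; lia.
  exact: weq_trans (weq_perm ss) (weq_flip_dbl _ _ _ hT).
have pdbl r r' : perm_eq r r' -> perm_eq (dbl u r) (dbl u r').
  by move=> rr; apply: perm_cat => //; apply: perm_map.
rewrite mult_dbl => c.
have [|c0] := posnP (mult s z) => [c0|].
  have [|s' /= ss] := @count_perm (z + u) s 2; first by lia.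
  apply: (two s'); apply: (perm_trans (pdbl _ _ ss)).
  apply: (perm_trans (dbl_partner _ _ _)).
  apply: perm_trans (_ : perm_eq _ (dbl u [:: z + u, z & s'])) _.
    by apply: pdbl; perm_count.
  by apply: (perm_trans (dbl_partner _ _ _)).
have [s1 /= ss1] := @count_perm z s 1 c0.
have [c1|] := posnP (mult s1 (z + u)); last first.
  case/(@count_perm _ _ 1) => s2 /= ss2; apply: (two s2).
  apply: (perm_trans (pdbl _ _ ss1)).
  apply: perm_trans (_ : perm_eq _ (dbl u [:: z + u, z & s2])) _.
    apply: pdbl; apply: perm_trans (_ : perm_eq _ [:: z, z + u & s2]) _.
      by rewrite perm_cons.
    by perm_count.
  exact: dbl_partner.
move: c; rewrite !(mult_perm ss1) !multE c1 eqxx.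
have [s1z|] := posnP (mult s1 z); last first.
  by move=> /(@count_perm _ _ 1) [s2 /= ss2] _; apply: (two s2);
     apply: (perm_trans (pdbl _ _ ss1)); apply: pdbl; rewrite perm_cons.
rewrite s1z; case: eqP => // E _; have u0 : u = 0.
  by apply: (@addrI _ z); rewrite addr0 -E.
exists s1; rewrite (size_perm ss1); split=> //.
apply: weq_trans (weq_dbl _ (weq_perm ss1)) _; rewrite u0.
apply: weq_trans (weq_perm (dbl_cons _ _ _)) _.
apply: weq_trans _ (weq_sym (weq_perm (dbl_cons 0 x s1))).
rewrite !addr0 /z; apply: weq_sym.
apply: (@weq_cat [:: x; x] [:: x + eps; x + eps]); first exact: weq_flip.
exact: weq_refl.
Qed.

Lemma dbl_value_weq u s x t : aniso (x :: t) -> weq (x :: t) (dbl u s) ->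
  exists s', [/\ size s = (size s').+1, weq (dbl u s) (dbl u (x :: s'))
    & weq t (x + u :: dbl u s')].
Proof.
move=> A xt; have [|s' [sE ss]] := @dbl_value u s x.
  have [|[hT _ c]] := reduced_in (aniso_reduced A) xt (mem_head _ _); first by left.
  by right.
exists s'; split=> //; apply: (@weq_consK x); apply: weq_trans xt _.
exact: weq_trans ss (weq_perm (dbl_cons _ _ _)).
Qed.

Lemma weq_dbl_eps s : weq (dbl eps s) [::].
Proof. exact: weq_opp. Qed.

Lemma aniso1 x : aniso [:: x].
Proof. by move=> [|y t] // /odd_size_weq. Qed.

Lemma value1 x y : value [:: x] y -> y = x.
Proof.
case=> -[|z t] [//] xy _; have := reduced_in (aniso_reduced (@aniso1 x)) xy.
move=> /(_ x (mem_head _ _)) [|[_ _]]; first by rewrite inE => /eqP.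
by rewrite multE; case: eqP.
Qed.

Lemma aniso_dbl1 u x : u != eps -> aniso (dbl u [:: x]).
Proof.
move=> u_eps; apply: contrapT => nA.
have [e /value1 -> /value1 E] := nonaniso_cat (@aniso1 x) (@aniso1 (x + u)) nA.
by case/eqP: u_eps; apply: (@addrI _ x).
Qed.

(** The anisotropic part of a multiple of <1, u> is again such a multiple. *)
Lemma dbl_min u s : exists t, [/\ weq (dbl u s) (dbl u t), aniso (dbl u t)
  & (size t <= size s)%N].
Proof.
have [->|u_eps] := eqVneq u eps.
  by exists [::]; split=> //; exact: weq_dbl_eps.
elim: s => [|x s [t [st At le_t]]].
  by exists [::]; split=> //; exact: weq_refl.
have E : weq (dbl u (x :: s)) (dbl u [:: x] ++ dbl u t).
  apply: weq_trans (weq_perm (dbl_cat u [:: x] s)) _.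
  by apply: weq_cat => //; apply: weq_refl.
have E' r r' : weq (dbl u (r ++ r')) (dbl u r ++ dbl u r').
  exact/weq_perm/dbl_cat.
have [Axt|nA] := pselect (aniso (dbl u [:: x] ++ dbl u t)).
  exists (x :: t); split=> //; first by apply: weq_trans E _; apply/weq_sym/(E' [:: x]).
  apply: aniso_weq Axt _ _; first exact/weq_sym/(E' [:: x]).
  by rewrite size_cat !size_dbl /=; lia.
have [e [r [xr rE]] [r' [tr' r'E]]] := nonaniso_cat (@aniso_dbl1 u x u_eps) At nA.
have Ar : aniso (e :: r).
  by apply: aniso_weq (@aniso_dbl1 u x u_eps) xr _; rewrite rE.
have Ar' : aniso (e + eps :: r') by apply: aniso_weq At tr' _; rewrite r'E.
have [[|z w] [sE xe _]] := dbl_value_weq Ar (weq_sym xr); last by [].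
have [t' [t'E tt' _]] := dbl_value_weq Ar' (weq_sym tr').
have Att' : aniso (dbl u (e + eps :: t')).
  by apply: aniso_weq At tt' _; rewrite !size_dbl t'E.
exists t'; split.
- apply: weq_trans E _; apply: weq_trans (weq_cat xe tt') _.
  apply: (@weq_drop (dbl u [:: e])); rewrite /dbl /=.
  have -> : e + eps + u = e + u + eps by g2 exp2.
  perm_count.
- exact: aniso_catr (aniso_perm (dbl_cat u [:: e + eps] t') Att').
- by move: le_t; rewrite t'E /=; lia.
Qed.

Lemma gp3_dbl p u b c :
  perm_eq (gp3 p u b c) (dbl u [:: p; p + b; p + c; p + c + b]).
Proof.
have E1 : p + u + b = p + b + u by g2 exp2.
have E2 : p + c + u + b = p + c + b + u by g2 exp2.
by apply/permP => a; rewrite /gp3 /gp2 E1 E2 /=; lia.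
Qed.

(** Subtracting a threefold Pfister form leaves an eight-dimensional form in I^3
    that contains [tail3] and [s]. If it is anisotropic, it is a multiple of
    <1, ab>, hence contains the partner of its third entry, which is the opposite
    of [y]: this makes the original form isotropic. *)
Lemma inI3_size10_gp2 x a b y s : aniso (gp2 x a b ++ y :: s) ->
  inI3 (gp2 x a b ++ y :: s) -> size s = 5%N -> False.
Proof.
move=> As I3 s5; have It := inI3_step I3.
have [At|nAt] := pselect (aniso (tail3 y a b ++ s)); last first.
  have [t [st At le_t]] := aniso_min (tail3 y a b ++ s).
  have t0 : t = [::].
    apply: (inI3_small At (inI3_weq st It)); rewrite ltn_neqAle.
    have tE : size (tail3 y a b ++ s) = 8%N by rewrite size_cat s5.
    rewrite -{2}tE le_t andbT; apply/eqP => t8; apply: nAt.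
    by apply: (aniso_weq At (weq_sym st)); rewrite t8 tE.
  have := As (gp3 x a b (x + y) ++ [::]); rewrite size_cat /= s5.
  suff H : weq (gp2 x a b ++ y :: s) (gp3 x a b (x + y) ++ [::]).
    by move=> /(_ H).
  apply: weq_trans (weq_step _ _ _ _ _) _.
  by apply: weq_cat; [exact: weq_refl|rewrite -t0].
set p := y + a + eps; set q := y + b + eps; set r := y + a + b + eps.
have [|b' [c' H]] := @gp3_binary p q (r :: s) At It; first by rewrite /= s5.
set u := p + q in H *; set w := [:: p + b'; p + c'; p + c' + b'].
have Hr : weq (r :: s) (dbl u w).
  apply: (@weq_consK q); apply: (@weq_consK p); apply: weq_trans H _.
  apply: weq_trans (weq_perm (gp3_dbl _ _ _ _)) _.
  apply: weq_trans (weq_perm (dbl_cons _ _ _)) _.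
  by have -> : p + u = q; [rewrite /u; g2 exp2|exact: weq_refl].
have Ar : aniso (r :: s) by apply: (@aniso_catr [:: p; q]).
have [w' [wE _ sw]] := dbl_value_weq Ar Hr.
have ru : r + u = y + eps by rewrite /r /u /p /q; g2 exp2.
have Ays : aniso (y :: s) := aniso_catr As.
have H' : weq (y :: s) (dbl u w').
  apply: weq_trans (weq_cons y sw) _; rewrite ru.
  apply: (@weq_cat [:: y; y + eps] [::]); [exact: weq_pair|exact: weq_refl].
by have := Ays _ H'; rewrite size_dbl /= s5; case: wE => <-.
Qed.

Lemma inI3_size10 s : aniso s -> inI3 s -> size s <> 10%N.
Proof.
move=> As I3 s10; have [[x [k E]]|[s0 [s1 [ss J0 J1 l0 l1]]]] := inI3_split As I3.
  by move: s10; rewrite E size_nseq; lia.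
have sE := size_perm ss; rewrite size_cat in sE.
wlog s0E : s0 s1 ss J0 J1 l0 l1 sE / size s0 = 4%N.
  move=> W; have [ev0 _] := andP J0; have [ev1 _] := andP J1.
  have [s04|s04] : size s0 = 4%N \/ size s1 = 4%N by lia.
    exact: (W s0 s1).
  apply: (W s1 s0) => //; last by rewrite addnC.
  by rewrite (permPl ss) perm_catC.
have [x [a [b E0]]] := disc_trivial_size4 J0 s0E.
case: s1 ss {J1} l1 sE => [|y s1] // ss _; rewrite s0E => sE.
rewrite E0 in ss; apply: (@inI3_size10_gp2 x a b y s1).
- exact: aniso_perm As.
- by apply: inI3_weq I3; apply: weq_perm.
- by move: sE => /=; lia.
Qed.

Lemma inI3_le11 s : inI3 s -> (size s <= 11)%N ->
  weq s [::] \/ exists c a b d, weq s (gp3 c a b d).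
Proof.
move=> I3 le11; have [t [st At le_t]] := aniso_min s.
have It := inI3_weq st I3; have [ev _] := andP (inI3_disc It).
have [lt8|ge8] := ltnP (size t) 8.
  by left; rewrite -(inI3_small At It lt8).
have t10 := inI3_size10 At It.
have [|c [a [b [d H]]]] := inI3_size8 At It; first by lia.
by right; exists c, a, b, d; apply: weq_trans st H.
Qed.

(** * Forms of dimension 12 and 14 in I^3 *)

(** Distinct entries of an anisotropic form are not opposite, hence lie in distinct
    cosets of the group generated by -1. *)
Lemma separate_entries s x y : aniso s -> x \in s -> y \in s -> x != y ->
  exists chi, [/\ character chi, chi eps = false & chi (x + y)].
Proof.
move=> As xs ys xy; have [|/(character_separates exp2)[chi [chiD l c]]] :=
  boolP (x + y \in span [:: eps]); last first.
  by exists chi; split=> //; apply: l; rewrite mem_head.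
rewrite /= !inE addr0 eq_addr0 // (negPf xy) /= => /eqP E.
have Ey : y = x + eps by apply: (eq_by exp2 E); g2 exp2.
move: ys xy; rewrite Ey => /(aniso_opposite As xs) ->.
by rewrite addr0 eqxx.
Qed.

(** Characters trivial at -1 up to complementation, which exchanges the two
    residues. *)
Definition residue (f : G -> bool) :=
  exists chi b, [/\ character chi, chi eps = false & forall x, f x = chi x (+) b].

Lemma residue_char chi : character chi -> chi eps = false -> residue chi.
Proof. by move=> H e; exists chi, false; split=> // x; rewrite addbF. Qed.

Lemma residueN f : residue f -> residue (predC f).
Proof.
case=> chi [b [H e fE]]; exists chi, (~~ b); split=> // x.
by rewrite addbN -fE.
Qed.

Lemma residueD f g : residue f -> residue g -> residue (fun x => f x (+) g x).
Proof.
case=> chi [b [H e fE]] [chi' [b' [H' e' gE]]].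
exists (fun x => chi x (+) chi' x), (b (+) b'); split.
- exact: characterD.
- by rewrite e e'.
- by move=> x; rewrite fE gE addbACA.
Qed.

Lemma residue_disc f s : residue f -> inI3 s -> disc_trivial (filter f s).
Proof.
case=> chi [b [H e fE]] [J _]; rewrite (eq_filter fE); have [J1 J0] := J _ H e.
case: b {fE}; last by rewrite (@eq_filter _ _ chi) // => x; rewrite addbF.
by rewrite (@eq_filter _ _ (predC chi)) // => x; rewrite addbT.
Qed.

Lemma residue_even f s : residue f -> disc_trivial s -> ~~ odd (count f s).
Proof.
case=> chi [b [H e fE]] /disc_trivialE[k [sE E]]; rewrite (eq_count fE).
have ev : ~~ odd (count chi s).
  rewrite -character_sum // E; elim: k {E sE} => [|k IH].
    by rewrite mulr0n character0.
  by rewrite mulrS H e.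
case: b {fE}; last by rewrite (@eq_count _ _ chi) // => x; rewrite addbF.
rewrite (@eq_count _ _ (predC chi)) => [|x]; last by rewrite addbT.
by have := count_predC chi s; lia.
Qed.

Lemma count_split3 (P : bool -> bool -> bool -> bool) (f g k : G -> bool) s :
  let n (a b c : bool) := count (fun x => [&& f x == a, g x == b & k x == c]) s in
  count (fun x => P (f x) (g x) (k x)) s =
  (P true true true * n true true true + P true true false * n true true false +
   P true false true * n true false true + P true false false * n true false false +
   P false true true * n false true true + P false true false * n false true false +
   P false false true * n false false true +
   P false false false * n false false false)%N.
Proof.
elim: s => [|x s IH] /=; first by rewrite !muln0.
rewrite /= in IH; rewrite {}IH.
by case: (f x); case: (g x); case: (k x); rewrite /= ?add0n; lia.
Qed.

Lemma count_filter2 (f g : G -> bool) s :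
  count g (filter f s) = count (fun x => f x && g x) s.
Proof. by rewrite count_filter; apply: eq_count => x /=; rewrite andbC. Qed.

(** Six entries with determinant -1 cannot be grouped into pairs of equal ones,
    so that some residue cuts out two distinct entries. *)
Lemma disc_trivial_size6 s : aniso s -> disc_trivial s -> size s = 6%N ->
  exists g p q, [/\ residue g, p != q & perm_eq (filter g s) [:: p; q]].
Proof.
move=> As Js s6; have sumE : \sum_(x <- s) x = eps.
  move: Js; rewrite /disc_trivial s6 /= => /eqP ->.
  by rewrite !mulrS mulr0n addr0 exp2 addr0.
have [g [Rg c2]] : exists g, residue g /\ count g s = 2%N.
  have [x [y [xs ys xy]]] : exists x y, [/\ x \in s, y \in s & x != y].
    apply: contrapT => nex; case: s => [|x s] // in As Js s6 sumE nex *.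
    have E : x :: s = nseq 6 x.
      rewrite -s6; apply: nseq_mult => y ys; apply/eqP/negP => /negP yx.
      by apply: nex; exists y, x; rewrite mem_head.
    have e0 : eps = 0.
      rewrite -sumE E !big_cons big_nil; g2 exp2.
    by have [/(_ e0) + _ _] := aniso_mult x As; rewrite E /mult count_nseq /= eqxx.
  have [chi [H e c]] := separate_entries As xs ys xy.
  have Rc := residue_char H e; have ev := residue_even Rc Js.
  have c0 : (0 < count chi s)%N /\ (0 < count (predC chi) s)%N.
    rewrite -!has_count; move: c; rewrite H.
    case Ex: (chi x); case Ey: (chi y) => // _; split; apply/hasP;
      by [exists x|exists y|exists x; rewrite //= Ex|exists y; rewrite //= Ey].
  have cC := count_predC chi s; rewrite s6 in cC.
  have [c2|c2] : count chi s = 2%N \/ count (predC chi) s = 2%N by lia.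
    by exists chi.
  by exists (predC chi); split=> //; apply: residueN.
have [p [q E2]] : exists p q, filter g s = [:: p; q].
  by move: c2; rewrite -size_filter; case: (filter g s) => [|p [|q []]] // _; exists p, q.
have [pq|pq] := eqVneq p q; last by exists g, p, q; rewrite E2.
have : size (filter (predC g) s) = 4%N.
  by rewrite size_filter; have := count_predC g s; rewrite s6 c2; lia.
case E4: (filter (predC g) s) => [|a [|b [|c [|d []]]]] // _.
have ss : perm_eq s [:: p; p; a; b; c; d].
  by rewrite (permPl (perm_filter_cat g s)) E2 E4 pq.
have {}As := aniso_perm ss As.
have abcd : a + b + c + d = eps.
  by rewrite -sumE (perm_big _ ss) !big_cons big_nil /=; g2 exp2.
have eN : eps <> 0.
  by move=> e0; have [/(_ e0) + _ _] := aniso_mult p As; rewrite !multE eqxx.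
have diff x y z w : perm_eq [:: a; b; c; d] [:: x; y; z; w] -> x != y.
  move=> pp; apply/eqP => xy; have E : x + y + z + w = eps.
    rewrite -abcd -[RHS]addr0.
    transitivity (\sum_(i <- [:: x; y; z; w]) i).
      by rewrite !big_cons big_nil; g2 exp2.
    by rewrite -(perm_big _ pp) !big_cons big_nil /=; g2 exp2.
  rewrite xy exp2 add0r in E.
  have mem v : v \in [:: x; y; z; w] -> v \in [:: p; p; a; b; c; d].
    by rewrite -(perm_mem pp) => m; rewrite in_cons in_cons m !orbT.
  apply/eN/(aniso_opposite As (x := z)); first by rewrite mem // !inE eqxx !orbT.
  have -> : z + eps = w by rewrite -E; g2 exp2.
  by rewrite mem // !inE eqxx !orbT.
have [|||chi [H e cab]] := separate_entries As (x := a) (y := b).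
- by rewrite !inE eqxx !orbT.
- by rewrite !inE eqxx !orbT.
- exact: (diff a b c d).
have ccd : chi (c + d).
  have E : c + d = eps + (a + b) by rewrite -abcd; g2 exp2.
  by rewrite E H e cab.
pose k x := chi x (+) chi p; exists k.
have R : residue k by exists chi, (chi p).
have kp : k p = false by rewrite /k addbb.
have kab : k a != k b by move: cab; rewrite H /k; do 3!case: (chi _).
have kcd : k c != k d by move: ccd; rewrite H /k; do 3!case: (chi _).
have := perm_filter k ss; rewrite /= kp; move: kab kcd; clearbody k.
case: (k a); case: (k b) => //; case: (k c); case: (k d) => // _ _ E; solve
  [ exists a, c; split=> //; apply: (diff a c b d); perm_count
  | exists a, d; split=> //; apply: (diff a d b c); perm_count
  | exists b, c; split=> //; apply: (diff b c a d); perm_count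
  | exists b, d; split=> //; apply: (diff b d a c); perm_count ].
Qed.

(** If no residue had dimension 4, every proper one would have dimension 6 or 8.
    Three residues, chosen such that the first two cut out two distinct entries
    and the third separates these, split the form into eight parts. As all products
    of the three are proper residues too, and residues have even dimension, the
    dimensions of the parts satisfy linear constraints that have no solution. *)
Lemma inI3_split4 s : aniso s -> inI3 s -> size s = 12%N \/ size s = 14%N ->
  exists s0 s1, [/\ perm_eq s (s0 ++ s1), disc_trivial s0 & size s0 = 4%N].
Proof.
move=> As I3 s12; apply: contrapT => nex.
have cut f : residue f -> has f s -> has (predC f) s ->
    (6 <= count f s)%N /\ (count f s + 6 <= size s)%N.
  have {}cut f' : residue f' -> has f' s ->
      (4 < count f' s)%N /\ ~~ odd (count f' s).
    move=> R hf; have J := residue_disc R I3; split; last first.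
      exact: residue_even R (inI3_disc I3).
    have [E|] := disc_trivial_aniso (@aniso_filter f' _ As) J.
      by move: hf; rewrite has_filter E.
    rewrite leq_eqVlt size_filter => /orP[/eqP c4|//]; case: nex.
    by exists (filter f' s), (filter (predC f') s);
       rewrite size_filter c4; split=> //; apply: perm_filter_cat.
  move=> R h1 h0; have [c1 e1] := cut f R h1.
  have [c0 e0] := cut _ (residueN R) h0.
  by have := count_predC f s; lia.
have [f [Rf f6]] : exists f, residue f /\ count f s = 6%N.
  have [[x [k E]]|[chi [H e h1 h0]]] := split_or_nseq As I3.
    by move: s12; rewrite E size_nseq; lia.
  have R := residue_char H e; have [c c'] := cut _ R h1 h0.
  have ev := residue_even R (inI3_disc I3); have cC := count_predC chi s.
  have [c6|c6] : count chi s = 6%N \/ count (predC chi) s = 6%N by lia.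
    by exists chi.
  by exists (predC chi); split=> //; apply: residueN.
pose S := filter f s; have JS : disc_trivial S by apply: residue_disc.
have [|g [p [q [Rg pq Sg]]]] := @disc_trivial_size6 S (@aniso_filter f _ As) JS.
  by rewrite size_filter.
have pqS : p \in filter g S /\ q \in filter g S.
  by rewrite !(perm_mem Sg) !inE !eqxx orbT.
move: pqS; rewrite !mem_filter => -[/and3P[gp fp ps] /and3P[gq fq qs]].
have fg2 : count (fun x => f x && g x) s = 2%N.
  by rewrite -count_filter2 -size_filter (size_perm Sg).
have [r rs /andP[fr gr]] : exists2 r, r \in s & f r && ~~ g r.
  have: has (predC g) S.
    have := count_predC g S; rewrite count_filter2 fg2 size_filter f6 has_count.
    lia.
  by case/hasP=> r; rewrite mem_filter => /andP[fr rs] /= gr; exists r; rewrite ?fr.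
have [chi [H e cpq]] := separate_entries As ps qs pq.
have Rk := residue_char H e; have kpq : chi p != chi q.
  by move: cpq; rewrite H; case: (chi p); case: (chi q).
have c2 (g' : G -> bool) u v : residue g' -> u \in s -> v \in s ->
    g' u != g' v -> (6 <= count g' s)%N /\ (count g' s + 6 <= size s)%N.
  move=> R us vs uv; have gv : g' v = ~~ g' u.
    by move: uv; case: (g' u); case: (g' v).
  apply: cut => //; apply/hasP; case E: (g' u).
  - by exists u.
  - by exists v; rewrite // gv E.
  - by exists v; rewrite //= gv E.
  - by exists u; rewrite //= E.
have Cg := c2 _ _ _ Rg ps rs; rewrite gp (negPf gr) in Cg.
have Cfg := c2 _ _ _ (residueD Rf Rg) ps rs; rewrite fp gp fr (negPf gr) in Cfg.
have Ck := c2 _ _ _ Rk ps qs kpq.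
have Cfk := c2 _ _ _ (residueD Rf Rk) ps qs; rewrite fp fq in Cfk.
have Cgk := c2 _ _ _ (residueD Rg Rk) ps qs; rewrite gp gq in Cgk.
have Cfgk := c2 _ _ _ (residueD (residueD Rf Rg) Rk) ps qs.
rewrite fp fq gp gq in Cfgk.
have {}Cfk : (6 <= count (fun x => f x (+) chi x) s)%N /\
  (count (fun x => f x (+) chi x) s + 6 <= size s)%N.
  by apply: Cfk; move: kpq; case: (chi p); case: (chi q).
have {}Cgk : (6 <= count (fun x => g x (+) chi x) s)%N /\
  (count (fun x => g x (+) chi x) s + 6 <= size s)%N.
  by apply: Cgk; move: kpq; case: (chi p); case: (chi q).
have {}Cfgk : (6 <= count (fun x => f x (+) g x (+) chi x) s)%N /\
  (count (fun x => f x (+) g x (+) chi x) s + 6 <= size s)%N.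
  by apply: Cfgk; move: kpq; case: (chi p); case: (chi q).
have {}Cg := Cg isT; have {}Cfg := Cfg isT.
have Efk := residue_even Rk JS; rewrite count_filter2 in Efk.
have Egk := residue_even Rk (residue_disc Rg I3); rewrite count_filter2 in Egk.
have Ek := residue_even Rk (inI3_disc I3).
have Efg : count (fun x => [&& f x, g x & chi x]) s = 1%N.
  have: count chi (filter g S) = 1%N.
    rewrite (permP Sg) /=; move: kpq; case: (chi p); by case: (chi q).
  rewrite !count_filter => <-; apply: eq_count => x /=.
  by case: (f x); case: (g x); case: (chi x).
have sE : size s = count (fun x => true) s by rewrite count_predT.
have Ev1 := residue_even (residueD Rf Rg) (inI3_disc I3).
have Ev2 := residue_even Rg (inI3_disc I3).
move: f6 fg2 Cg Cfg Ck Cfk Cgk Cfgk Efk Egk Ek Efg sE Ev1 Ev2 s12.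
rewrite (count_split3 (fun a b c : bool => a) f g chi).
rewrite (count_split3 (fun a b c : bool => a && b) f g chi).
rewrite (count_split3 (fun a b c : bool => b) f g chi).
rewrite (count_split3 (fun a b c : bool => c) f g chi).
rewrite (count_split3 (fun a b c : bool => a (+) b) f g chi).
rewrite (count_split3 (fun a b c : bool => a (+) c) f g chi).
rewrite (count_split3 (fun a b c : bool => b (+) c) f g chi).
rewrite (count_split3 (fun a b c : bool => a && c) f g chi).
rewrite (count_split3 (fun a b c : bool => b && c) f g chi).
rewrite (count_split3 (fun a b c : bool => a (+) b (+) c) f g chi).
rewrite (count_split3 (fun a b c : bool => [&& a, b & c]) f g chi).
rewrite (count_split3 (fun a b c : bool => true) f g chi).
set n1 := count _ s; set n2 := count _ s; set n3 := count _ s; set n4 := count _ s.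
set n5 := count _ s; set n6 := count _ s; set n7 := count _ s; set n8 := count _ s.
move: n1 n2 n3 n4 n5 n6 n7 n8 => /=; move: (size s); clear; lia.
Qed.

Definition gp3s (l : seq (G * G * G * G)) :=
  flatten [seq gp3 i.1.1.1 i.1.1.2 i.1.2 i.2 | i <- l].

Lemma inI3_size12 s : aniso s -> inI3 s -> size s = 12%N ->
  exists c a b d c' a' b' d', weq s (gp3 c a b d ++ gp3 c' a' b' d').
Proof.
move=> As I3 s12; have [|s0 [s1 [ss J0 s04]]] := inI3_split4 As I3; first by left.
have [x [a [b E0]]] := disc_trivial_size4 J0 s04.
have sE := size_perm ss; rewrite size_cat s12 s04 in sE.
case: s1 => [|y s1] // in ss sE *; rewrite E0 in ss.
have I3' := inI3_step (inI3_weq (weq_perm ss) I3).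
have st := weq_trans (weq_perm ss) (weq_step x a b y s1).
have [|t0|[c [a' [b' [d H]]]]] := inI3_le11 I3'.
- by move: sE; rewrite size_cat /=; lia.
- have := As _ (weq_trans st (weq_cat (weq_refl _) t0)).
  by rewrite s12.
- exists x, a, b, (x + y), c, a', b', d; apply: weq_trans st _.
  by apply: weq_cat => //; apply: weq_refl.
Qed.

(** Two lost hyperbolic planes come from two common values, up to sign, of the
    summands. *)
Lemma cancel2 s A B : aniso A -> aniso B -> weq s (A ++ B) ->
    (size s + 4 <= size A + size B)%N ->
  exists p q A' B', [/\ weq A [:: p, q & A'], weq B [:: p + eps, q + eps & B'],
    size A = (size A').+2 & size B = (size B').+2].
Proof.
move=> AA AB sAB le.
have nA r A' B' : weq s (A' ++ B') -> (size s < size A' + size B')%N ->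
    r = A' ++ B' -> ~ aniso r.
  move=> sr lt -> Ar; have := Ar _ (weq_sym sr).
  by rewrite size_cat leqNgt lt.
have [|p [A1 [AA1 A1E]] [B1 [BB1 B1E]]] := nonaniso_cat AA AB.
  by apply: nA sAB _ erefl; lia.
have AA1' : aniso A1.
  by apply: (@aniso_catr [:: p]); apply: (aniso_weq AA AA1); rewrite A1E.
have AB1' : aniso B1.
  by apply: (@aniso_catr [:: p + eps]); apply: (aniso_weq AB BB1); rewrite B1E.
have [|q [A2 [AA2 A2E]] [B2 [BB2 B2E]]] := nonaniso_cat AA1' AB1'.
  apply: nA (weq_trans sAB (weq_cat_drop AA1 BB1)) _ erefl; lia.
exists p, q, A2, B2; rewrite A1E A2E B1E B2E; split=> //.
  exact: weq_trans AA1 (weq_cons _ AA2).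
exact: weq_trans BB1 (weq_cons _ BB2).
Qed.

Lemma gp3_binary_weq r p q s : aniso r -> inI3 r -> size r = 8%N ->
    weq r [:: p, q & s] -> size s = 6%N ->
  exists b c, weq r (dbl (p + q) [:: p; p + b; p + c; p + c + b]).
Proof.
move=> Ar I3 r8 rs s6; have [|b [c H]] := gp3_binary _ (inI3_weq rs I3) s6.
  by apply: (aniso_weq Ar rs); rewrite /= s6 r8.
exists b, c; apply: weq_trans rs (weq_trans H _).
exact: weq_perm (gp3_dbl _ _ _ _).
Qed.

(** Two threefold Pfister forms that share a binary form <p, q> up to sign are
    multiples of <1, pq>, and the two copies of <p, q> cancel. *)
Lemma linked_gp3 A B p q A' B' : aniso A -> inI3 A -> size A = 8%N ->
    aniso B -> inI3 B -> size B = 8%N ->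
    weq A [:: p, q & A'] -> weq B [:: p + eps, q + eps & B'] ->
    size A' = 6%N -> size B' = 6%N ->
  exists s, weq (A ++ B) (dbl (p + q) s) /\ size s = 6%N.
Proof.
move=> AA IA A8 AB IB B8 AA' BB' sA sB.
have [b [c HA]] := gp3_binary_weq AA IA A8 AA' sA.
have [b' [c' HB]] := gp3_binary_weq AB IB B8 BB' sB.
exists [:: p + b; p + c; p + c + b; p + eps + b'; p + eps + c'; p + eps + c' + b'].
split=> //; apply: weq_trans (weq_cat HA HB) _.
have -> : p + eps + (q + eps) = p + q by g2 exp2.
apply: (@weq_drop (dbl (p + q) [:: p])); rewrite /dbl /=.
have ->: p + eps + (p + q) = p + (p + q) + eps by g2 exp2.
by perm_count.
Qed.

(** Adding a threefold Pfister form [r] to a 12-dimensional multiple of <1, u>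
    with which it shares a binary form, up to sign, leaves a sum of multiples of
    two binary forms. *)
Lemma link s u a r : aniso (dbl u a) -> size a = 6%N -> aniso r -> inI3 r ->
    size r = 8%N -> weq s (dbl u a ++ r) -> (size s <= 16)%N ->
  (exists b, weq s (dbl u b)) \/
  exists p v z a' b, [/\ size a' = 4%N /\ size b = 4%N, aniso (dbl u a'),
    weq s (dbl u a' ++ dbl v b), weq (dbl v b) (r ++ dbl v [:: z; p])
    & z = p + u \/ [/\ h, z = p & v = u + eps]].
Proof.
move=> At a6 Ar Ir r8 st le16.
have [|p [q [A [B [tA rB tE rE]]]]] := cancel2 At Ar st.
  by rewrite size_dbl a6 r8; lia.
rewrite size_dbl a6 in tE; rewrite r8 in rE.
have [|b [c]] := gp3_binary_weq Ar Ir r8 rB; first by case: rE => <-.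
have -> : p + eps + (q + eps) = p + q by g2 exp2.
set v := p + q; set b0 := [:: p + eps + b; _; _] => rb.
have {}rb : weq r (dbl v (p + eps :: b0)) by [].
have pqv : p + eps + v = q + eps by rewrite /v; g2 exp2.
have Apq : aniso [:: p, q & A].
  by apply: (aniso_weq At tA); rewrite size_dbl a6 tE.
have [a1 [a1E ta1 qA]] := dbl_value_weq Apq (weq_sym tA).
have a1E5 : size a1 = 5%N by move: a1E; rewrite a6 => -[<-].
have Aq : aniso (q :: A) := @aniso_catr [:: p] _ Apq.
have sA : weq s (A ++ dbl v b0).
  apply: weq_trans st (weq_trans (weq_cat tA rb) _).
  apply: weq_trans (weq_cat (weq_refl _) (weq_perm (dbl_cons _ _ _))) _.
  rewrite pqv; apply: (@weq_drop [:: p; q]).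
  by perm_count.
have vb z : weq (dbl v (z :: b0)) (r ++ dbl v [:: z; p]).
  apply: weq_trans _ (weq_sym (weq_cat rb (weq_refl _))).
  apply: weq_sym; apply: (@weq_drop (dbl v [:: p])).
  rewrite /dbl /b0 /=; have -> : p + eps + v = p + v + eps by g2 exp2.
  perm_count.
have good : (exists a2, size a1 = (size a2).+1 /\
    weq (dbl u a1) (dbl u (q :: a2))) -> exists p v z a' b,
    [/\ size a' = 4%N /\ size b = 4%N, aniso (dbl u a'),
    weq s (dbl u a' ++ dbl v b), weq (dbl v b) (r ++ dbl v [:: z; p])
    & z = p + u \/ [/\ h, z = p & v = u + eps]].
  move=> [a2 [a2E aa2]]; exists p, v, (p + u), a2, (p + u :: b0).
  have Aq' : weq A ([:: p + u; q + u] ++ dbl u a2).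
    apply: (@weq_consK q); apply: weq_trans qA _.
    apply: weq_trans (weq_cons _ aa2) _.
    apply: weq_trans (weq_cons _ (weq_perm (dbl_cons _ _ _))) _.
    by apply/weq_perm/permP => f /=; lia.
  have a24 : size a2 = 4%N by move: a2E; rewrite a1E5 => -[<-].
  split=> //; last by left.
  - suff: aniso ([:: p; q] ++ [:: p + u; q + u] ++ dbl u a2).
      by move=> H; apply: aniso_catr (aniso_catr H).
    apply: (aniso_weq Apq); first exact/weq_cons/weq_cons.
    by rewrite /= size_dbl a24; lia.
  - apply: weq_trans sA (weq_trans (weq_cat Aq' (weq_refl _)) (weq_perm _)).
    rewrite -catA perm_catCA perm_cat2l perm_sym.
    have <- : p + u + v = q + u by rewrite /v; g2 exp2.
    exact: dbl_cons.
have qr := reduced_in (aniso_reduced Aq) qA (mem_head _ _).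
have [q1|Nq] := eqVneq q (p + u).
  left; exists (a ++ (p + eps :: b0)); apply: weq_trans st _.
  apply: weq_trans (weq_cat (weq_refl _) rb) _.
  have -> : v = u by rewrite /v q1; g2 exp2.
  exact/weq_sym/weq_perm/dbl_cat.
right; case: qr => [|[hT eN]].
  rewrite inE (negPf Nq) /= => qa; apply: good.
  by apply: dbl_value; left.
rewrite mult_cons; case: eqP => [E mc|_ mc]; last first.
  by apply: good; apply: dbl_value; right.
(* Here q = -up, so that the entries of t are p, p, q, q and a multiple of
   <1, u>: the partner of <p, q> is again <p, q>. *)
have qe : q + eps \in dbl u a1 by rewrite mem_mult.
have [|a2 [a2E aa2]] := @dbl_value u a1 (q + eps); first by left.
have a24 : size a2 = 4%N by move: a2E; rewrite a1E5 => -[<-].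
have pe : q + eps + u = p by rewrite -E; g2 exp2.
have Aq' : weq A ([:: q; p] ++ dbl u a2).
  apply: (@weq_consK q); apply: weq_trans qA _; rewrite E.
  apply: weq_trans (weq_cons _ aa2) _.
  apply: weq_trans (weq_cons _ (weq_perm (dbl_cons _ _ _))) _; rewrite pe.
  apply: (@weq_cat [:: q + eps; q + eps] [:: q; q]); last exact: weq_refl.
  exact/weq_sym/weq_flip.
have vE : v = u + eps by rewrite /v -pe; g2 exp2.
exists p, v, p, a2, (p :: b0); split=> //; last by right.
- suff: aniso ([:: p; q] ++ [:: q; p] ++ dbl u a2).
    by move=> H; apply: aniso_catr (aniso_catr H).
  apply: (aniso_weq Apq); first exact/weq_cons/weq_cons.
  by rewrite /= size_dbl a24; lia.
- apply: weq_trans sA (weq_trans (weq_cat Aq' (weq_refl _)) (weq_perm _)).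
  rewrite -catA perm_catCA perm_cat2l perm_sym.
  have pv : p + v = q by rewrite /v; g2 exp2.
  apply: (perm_trans (dbl_cons _ _ _)); rewrite pv.
  by perm_count.
Qed.

(** The discriminant of <1, u> x s is u to the power of the dimension of s. *)
Lemma dbl_even u s : aniso (dbl u s) -> disc_trivial (dbl u s) -> ~~ odd (size s).
Proof.
move=> As /disc_trivialE[k [sE]]; rewrite size_dbl in sE.
have <- : size s = k by lia.
have sumE : \sum_(x <- dbl u s) x = u *+ size s.
  elim: s {As sE} => [|x s IH]; first by rewrite big_nil.
  rewrite (perm_big _ (dbl_cons _ _ _)) !big_cons IH /= mulrS.
  by move: (u *+ size s) => y; g2 exp2.
have even_mul (x : G) n : x *+ n = if odd n then x else 0.
  elim: n => [|n IH]; rewrite ?mulr0n // mulrS IH /=.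
  by case: (odd n); rewrite /= ?exp2 ?addr0.
rewrite sumE !even_mul; case: ifP => // os u_eps.
have := As [::]; rewrite u_eps size_dbl => /(_ (weq_dbl_eps s)).
by move: os; case: (s).
Qed.

Lemma gp3s_cat l l' : gp3s (l ++ l') = gp3s l ++ gp3s l'.
Proof. by rewrite /gp3s map_cat flatten_cat. Qed.

Lemma inI3_gp3s_le11 s : inI3 s -> (size s <= 11)%N ->
  exists l, (size l <= 1)%N /\ weq s (gp3s l).
Proof.
move=> I3 le11; have [s0|[c [a [b [d sg]]]]] := inI3_le11 I3 le11.
  by exists [::].
exists [:: (c, a, b, d)]; split=> //; exact: sg.
Qed.

Lemma inI3_cat_le11 s X Y : inI3 s -> weq s (X ++ Y) -> inI3 X ->
    (size X <= 11)%N -> (size Y <= 11)%N ->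
  exists l, (size l <= 2)%N /\ weq s (gp3s l).
Proof.
move=> I3 sXY IX leX leY; have IY := inI3_catK IX (inI3_weq sXY I3).
have [l [le_l Xl]] := inI3_gp3s_le11 IX leX.
have [l' [le_l' Yl]] := inI3_gp3s_le11 IY leY.
exists (l ++ l'); rewrite size_cat gp3s_cat; split; first lia.
exact: weq_trans sXY (weq_cat Xl Yl).
Qed.

Lemma aniso_inI3_8 r : inI3 r -> size r = 8%N -> aniso r \/ weq r [::].
Proof.
move=> Ir r8; have [t [rt At le_t]] := aniso_min r.
have [lt8|ge8] := ltnP (size t) 8.
  by right; rewrite -(inI3_small At (inI3_weq rt Ir) lt8).
by left; apply: (aniso_weq At (weq_sym rt)); rewrite r8.
Qed.

(** The two threefold Pfister forms lose two hyperbolic planes, hence share a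
    binary form. *)
Lemma inI3_size12_dbl s : aniso s -> inI3 s -> size s = 12%N ->
  exists u a, weq s (dbl u a) /\ size a = 6%N.
Proof.
move=> As I3 s12.
have [c [a [b [d [c' [a' [b' [d' sE]]]]]]]] := inI3_size12 As I3 s12.
have IA := inI3_gp3 c a b d; have IB := inI3_gp3 c' a' b' d'.
set A := gp3 c a b d in sE IA *; set B := gp3 c' a' b' d' in sE IB *.
have [AA|A0] := aniso_inI3_8 IA erefl; last first.
  by have := As _ (weq_trans sE (weq_cat A0 (weq_refl B))); rewrite s12.
have [AB|B0] := aniso_inI3_8 IB erefl; last first.
  have := As _ (weq_trans sE (weq_cat (weq_refl A) B0)).
  by rewrite s12 size_cat.
have [|p [q [A' [B' [AA' BB' AE BE]]]]] := cancel2 AA AB sE; first by rewrite s12.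
have [||l [H l6]] := linked_gp3 AA IA erefl AB IB erefl AA' BB'.
- by case: AE.
- by case: BE.
by exists (p + q), l; split=> //; apply: weq_trans sE H.
Qed.

(** Removing a threefold Pfister form leaves a twelve-dimensional multiple of
    <1, u>, so [link] writes [s] as a sum of eight-dimensional multiples of <1, u>
    and <1, v>. These share a value [e], and lose <e, -e>. What is left
    consists of two seven-dimensional forms, each of which is completed to a form
    in I^3 by one of a pair of opposite entries. *)
Lemma inI3_size14 s : aniso s -> inI3 s -> size s = 14%N ->
  exists l, (size l <= 2)%N /\ weq s (gp3s l).
Proof.
move=> As I3 s14; have [|s0 [s1 [ss J0 s04]]] := inI3_split4 As I3; first by right.
have [x [a [b E0]]] := disc_trivial_size4 J0 s04.
have sE := size_perm ss; rewrite size_cat s14 s04 in sE.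
case: s1 => [|y s1] // in ss sE *; rewrite E0 in ss.
have It := inI3_step (inI3_weq (weq_perm ss) I3).
have st := weq_trans (weq_perm ss) (weq_step x a b y s1).
have Ir := inI3_gp3 x a b (x + y); set r := gp3 x a b (x + y) in st Ir.
have t12 : size (tail3 y a b ++ s1) = 12%N by move: sE; rewrite size_cat /=; lia.
set t := tail3 y a b ++ s1 in st It t12.
have [At|nAt] := pselect (aniso t); last first.
  have [t' [tt' At' le_t']] := aniso_min t.
  apply: (@inI3_cat_le11 _ r t') => //.
    exact: weq_trans st (weq_cat (weq_refl _) tt').
  rewrite -ltnS ltn_neqAle -{2}t12 le_t' andbT; apply/eqP => t'12; apply: nAt.
  by apply: (aniso_weq At' (weq_sym tt')); rewrite t'12 t12.
have [u [al [tal al6]]] := inI3_size12_dbl At It t12.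
have Aal : aniso (dbl u al).
  by apply: (aniso_weq At tal); rewrite size_dbl al6 t12.
have [Ar|r0] := aniso_inI3_8 Ir erefl; last first.
  by have := As _ (weq_trans st (weq_cat r0 (weq_refl t))); rewrite s14 t12.
have sal : weq s (dbl u al ++ r).
  apply: weq_trans st (weq_trans (weq_cat (weq_refl _) tal) (weq_perm _)).
  by rewrite perm_catC.
have [|[c sc]|[p [v [z [al' [be]]]]]] := link Aal al6 Ar Ir erefl sal.
- by rewrite s14.
- have [c' [cc' Ac' _]] := dbl_min u c; have sc' := weq_trans sc cc'.
  have := dbl_even Ac' (inI3_disc (inI3_weq sc' I3)).
  have := aniso_size As Ac' sc'; rewrite s14 size_dbl; lia.
case=> -[al'4 be4] Aal' sab bez zE.
have [be' [bb' Abe' le_be']] := dbl_min v be; rewrite be4 in le_be'.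
have sab' : weq s (dbl u al' ++ dbl v be').
  exact: weq_trans sab (weq_cat (weq_refl _) bb').
have be'4 : size be' = 4%N.
  have := As _ sab'; rewrite s14 size_cat !size_dbl al'4.
  move: le_be'; rewrite leq_eqVlt => /orP[/eqP//|lt_be'] le; exfalso.
  have be'3 : size be' = 3%N by lia.
  have Jbe : disc_trivial (dbl v be).
    apply/disc_trivialE; exists 4%N; rewrite size_dbl be4; split=> //.
    case: be be4 {bez sab bb'} => [|b1 [|b2 [|b3 [|b4 []]]]] // _.
    by rewrite !big_cons big_nil /= !mulrS mulr0n; g2 exp2.
  by have := dbl_even Abe' (disc_trivial_weq bb' Jbe); rewrite be'3.
have nA : ~ aniso (dbl u al' ++ dbl v be').
  move=> /(_ _ (weq_sym sab')).
  by rewrite size_cat !size_dbl al'4 be'4 s14.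
have [e [A1 [eA A1E]] [B1 [eB B1E]]] := nonaniso_cat Aal' Abe' nA.
have AA1 : aniso (e :: A1) by apply: (aniso_weq Aal' eA); rewrite A1E.
have AB1 : aniso (e + eps :: B1) by apply: (aniso_weq Abe' eB); rewrite B1E.
have [a3 [a3E aa3 A1a3]] := dbl_value_weq AA1 (weq_sym eA).
have [b3 [b3E bb3 B1b3]] := dbl_value_weq AB1 (weq_sym eB).
have {}a3E : size a3 = 3%N by move: a3E; rewrite al'4 => -[<-].
have {}b3E : size b3 = 3%N by move: b3E; rewrite be'4 => -[<-].
have s3 : weq s ([:: e + u; e + eps + v] ++ dbl u a3 ++ dbl v b3).
  apply: weq_trans sab' (weq_trans (weq_cat_drop eA eB) _).
  apply: weq_trans (weq_cat A1a3 B1b3) (weq_perm _); perm_count_dbl.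
have bee : weq (dbl v (e + eps :: b3)) (r ++ dbl v [:: z; p]).
  exact: weq_trans (weq_sym (weq_trans bb' bb3)) bez.
have ev : e + eps + v = e + v + eps by g2 exp2.
have pe : p + (p + e) = e by g2 exp2.
case: zE => [zE|[hT zE vE]].
- apply: (@inI3_cat_le11 _ (dbl v (e + u :: b3)) (dbl u (e + eps + v :: a3))) => //.
  + apply: weq_trans s3 (weq_sym _).
    apply: weq_trans (weq_cat (weq_perm (dbl_cons _ _ _)) (weq_perm (dbl_cons _ _ _))) _.
    have -> : e + eps + v + u = e + u + v + eps by g2 exp2.
    apply: (@weq_drop [:: e + u + v]); perm_count_dbl.
  + have : inI3 (r ++ gp3 p v u (p + e)) by apply/inI3_cat/inI3_gp3.
    apply: inI3_weq.
    apply: (@weq_trans _ ((r ++ dbl v [:: z; p]) ++ dbl v [:: e; e + u])).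
      apply: weq_perm; rewrite zE /gp3 /gp2 /dbl pe /=.
      have -> : p + u + v = p + v + u by g2 exp2.
      have -> : e + u + v = e + v + u by g2 exp2.
      perm_count_dbl.
    apply: weq_trans (weq_cat (weq_sym bee) (weq_refl _)) _.
    apply: weq_trans _ (weq_sym (weq_perm (dbl_cons _ _ _))).
    apply: weq_trans (weq_cat (weq_perm (dbl_cons _ _ _)) (weq_refl _)) _.
    rewrite ev [dbl v [:: e; _]]/dbl /=; apply: (@weq_drop [:: e; e + v]).
    perm_count_dbl.
  + by rewrite size_dbl /= b3E.
  + by rewrite size_dbl /= a3E.
- have eu : e + eps + v = e + u by rewrite vE; g2 exp2.
  have eue : e + u + eps = e + v by rewrite vE; g2 exp2.
  apply: (@inI3_cat_le11 _ (dbl v (e + v :: b3)) (dbl u (e + v :: a3))) => //.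
  + apply: weq_trans s3 _; rewrite eu.
    apply: weq_trans (weq_cat (weq_flip _ hT) (weq_refl _)) (weq_sym _); rewrite eue.
    apply: weq_trans (weq_cat (weq_perm (dbl_cons _ _ _)) (weq_perm (dbl_cons _ _ _))) _.
    have -> : e + v + v = e by g2 exp2.
    have -> : e + v + u = e + eps by rewrite vE; g2 exp2.
    apply: (@weq_drop [:: e]); perm_count_dbl.
  + have : inI3 (r ++ gp3 p v 0 (p + e)) by apply/inI3_cat/inI3_gp3.
    apply: inI3_weq.
    apply: (@weq_trans _ ((r ++ dbl v [:: z; p]) ++ dbl v [:: e; e])).
      by apply: weq_perm; rewrite zE /gp3 /gp2 /dbl pe /= !addr0; perm_count_dbl.
    apply: weq_trans (weq_cat (weq_sym bee) (weq_refl _)) _.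
    apply: weq_trans _ (weq_sym (weq_perm (dbl_cons _ _ _))).
    apply: weq_trans (weq_cat (weq_perm (dbl_cons _ _ _)) (weq_refl _)) _.
    have -> : e + v + v = e by g2 exp2.
    rewrite ev [dbl v [:: e; _]]/dbl /=; apply: (@weq_drop [:: e; e + v]).
    perm_count_dbl.
  + by rewrite size_dbl /= b3E.
  + by rewrite size_dbl /= a3E.
Qed.

(** A form of dimension at most 15 in I^3 is a sum of two threefold Pfister
    forms up to similarity, as its anisotropic part has dimension 0, 8, 12 or 14. *)
Lemma inI3_le15 s : inI3 s -> (size s <= 15)%N ->
  exists l, (size l <= 2)%N /\ weq s (gp3s l).
Proof.
move=> I3 le15; have [t [st At le_t]] := aniso_min s.
have It := inI3_weq st I3; have [ev _] := andP (inI3_disc It).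
suff [l [le_l tl]] : exists l, (size l <= 2)%N /\ weq t (gp3s l).
  by exists l; split=> //; apply: weq_trans st tl.
have [le11|gt11] := leqP (size t) 11.
  have [l [le_l tl]] := inI3_gp3s_le11 It le11.
  by exists l; split=> //; apply: leq_trans le_l _.
have [t12|t12] : size t = 12%N \/ size t = 14%N by lia.
  have [c [a [b [d [c' [a' [b' [d' tE]]]]]]]] := inI3_size12 At It t12.
  by exists [:: (c, a, b, d); (c', a', b', d')].
exact: inI3_size14.
Qed.

(** * Sixteen-dimensional sums of three threefold Pfister forms *)

Definition gp2s (l : seq (G * G * G)) :=
  flatten [seq gp2 i.1.1 i.1.2 i.2 | i <- l].

Lemma gp2s_cat l l' : gp2s (l ++ l') = gp2s l ++ gp2s l'.
Proof. by rewrite /gp2s map_cat flatten_cat. Qed.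

Definition sum_gp2 n s := exists l, size l = n /\ weq s (gp2s l).

Lemma sum_gp2_cat m n s X Y : weq s (X ++ Y) -> sum_gp2 m X -> sum_gp2 n Y ->
  sum_gp2 (m + n) s.
Proof.
move=> sXY [l [lm Xl]] [l' [ln Yl]]; exists (l ++ l').
rewrite size_cat gp2s_cat lm ln; split=> //.
exact: weq_trans sXY (weq_cat Xl Yl).
Qed.

(** <1, u> x <x, y> is similar to a twofold Pfister form. *)
Lemma sum_gp2_dbl n u s : size s = n.*2 -> sum_gp2 n (dbl u s).
Proof.
elim: n s => [|n IH] [|x [|y s]] // sE; first by exists [::]; split=> //; apply: weq_refl.
have {}sE : size s = n.*2 by move: sE => /=; rewrite doubleS => -[].
apply: (@sum_gp2_cat 1 n _ (gp2 x u (x + y)) (dbl u s)); last exact: IH.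
  apply: weq_perm; apply: (perm_trans (dbl_cat u [:: x; y] s)).
  rewrite perm_cat2r /gp2 /dbl /=.
  have -> : x + (x + y) = y by g2 exp2.
  have -> : x + u + (x + y) = y + u by g2 exp2.
  perm_count.
by exists [:: (x, u, x + y)]; split=> //; apply: weq_refl.
Qed.

Lemma sum_gp2_disc s : disc_trivial s -> size s = 4%N -> sum_gp2 1 s.
Proof.
by move=> J s4; have [x [a [b ->]]] := disc_trivial_size4 J s4;
   exists [:: (x, a, b)]; split=> //; apply: weq_refl.
Qed.

Lemma sum_gp2_gp3s l : sum_gp2 (size l).*2 (gp3s l).
Proof.
elim: l => [|i l IH]; first by exists [::]; split=> //; apply: weq_refl.
apply: (@sum_gp2_cat 2 (size l).*2 _ _ _ _ _ IH); first exact: weq_refl.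
exists [:: (i.1.1.1, i.1.1.2, i.1.2); (i.1.1.1 + i.2, i.1.1.2, i.1.2)].
by split=> //; apply: weq_refl.
Qed.

Lemma size_gp3s l : size (gp3s l) = (8 * size l)%N.
Proof. by elim: l => //= i l; rewrite -/(gp3s l) => ->; lia. Qed.

(** [A'] is what remains of [A] when the entries of [l] are split off. *)
Definition ext A l A' := weq A (l ++ A') /\ size A = (size l + size A')%N.

Lemma ext_aniso A l A' : aniso A -> ext A l A' -> aniso A'.
Proof.
move=> AA [AE sE]; apply: (@aniso_catr l); apply: (aniso_weq AA AE).
by rewrite size_cat sE.
Qed.

Lemma ext_perm A l l' A' : perm_eq l l' -> ext A l A' -> ext A l' A'.
Proof.
move=> ll [AE sE]; rewrite /ext -(size_perm ll); split=> //.
by apply: weq_trans AE (weq_perm _); rewrite perm_cat2r.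
Qed.

Lemma ext_cat A l l' A' : ext A (l ++ l') A' -> ext A l (l' ++ A').
Proof. by rewrite /ext !size_cat addnA catA. Qed.

Lemma ext_value A l A' e : ext A l A' -> value A' e ->
  exists A'', ext A (l ++ [:: e]) A''.
Proof.
move=> [AE sE] [A'' [eE s'E]]; exists A''; rewrite /ext size_cat -catA; split.
  exact: weq_trans AE (weq_cat (weq_refl _) eE).
by rewrite sE s'E /=; lia.
Qed.

Lemma value_ext A l A' e : ext A l A' -> value A' e -> value A e.
Proof.
move=> AE /(ext_value AE)[A'' {}AE].
have [|{}AE sE] := @ext_cat A [:: e] l A''; last by exists (l ++ A'').
by apply: ext_perm AE; rewrite perm_catC.
Qed.

Lemma value_ext1 A e : value A e -> exists A', ext A [:: e] A'.
Proof. by case=> A' [AE sE]; exists A'. Qed.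

Definition pfister3 A := [/\ aniso A, inI3 A & size A = 8%N].

Section Sixteen.
Variables (s : seq G) (As : aniso s) (s16 : size s = 16%N).

Lemma four_gp3s l : weq s (gp3s l) -> (size l <= 2)%N -> sum_gp2 4 s.
Proof.
move=> sl le2; have := As sl; rewrite s16 size_gp3s => ge16.
have l2 : size l = 2%N by lia.
have [l' [l'4 ll']] := sum_gp2_gp3s l; exists l'; rewrite l'4 l2; split=> //.
exact: weq_trans sl ll'.
Qed.

Lemma four_dbl u a : weq s (dbl u a) -> sum_gp2 4 s.
Proof.
move=> sa; have [b [ab Ab _]] := dbl_min u a; have sb := weq_trans sa ab.
have := aniso_size As Ab sb; rewrite s16 size_dbl => b8.
have [|l [l4 bl]] := @sum_gp2_dbl 4 u b; first by lia.
by exists l; split=> //; apply: weq_trans sb bl.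
Qed.

Definition triple A B C :=
  [/\ pfister3 A, pfister3 B, pfister3 C & weq s (A ++ B ++ C)].

Lemma triple_swap12 A B C : triple A B C -> triple B A C.
Proof.
case=> pA pB pC sE; split=> //; apply: weq_trans sE (weq_perm _).
by rewrite perm_catCA.
Qed.

Lemma triple_swap23 A B C : triple A B C -> triple A C B.
Proof.
case=> pA pB pC sE; split=> //; apply: weq_trans sE (weq_perm _).
by rewrite perm_cat2l perm_catC.
Qed.

(** The sum of two forms that share a binary form is a multiple of <1, pq>, and
    the third summand is added by [link]. *)
Lemma triple_share A B C p q la lb A' B' : triple A B C ->
    ext A la A' -> ext B lb B' ->
    (exists la', perm_eq la [:: p, q & la']) ->
    (exists lb', perm_eq lb [:: p + eps, q + eps & lb']) ->
  sum_gp2 4 s.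
Proof.
move=> [[AA IA A8] [AB IB B8] [AC IC C8] sE] AE BE [la' pa] [lb' pb].
have [{}AE AsE] := ext_cat (ext_perm pa AE : ext A ([:: p; q] ++ la') A').
have [{}BE BsE] := ext_cat (ext_perm pb BE : ext B ([:: p + eps; q + eps] ++ lb') B').
have [||a [Ha a6]] := linked_gp3 AA IA A8 AB IB B8 AE BE.
- by move: AsE; rewrite A8 => -[].
- by move: BsE; rewrite B8 => -[].
set u := p + q in Ha.
have sE' : weq s (dbl u a ++ C).
  apply: weq_trans sE _; rewrite catA; apply: weq_cat Ha (weq_refl _).
have I3 : inI3 s.
  by apply: inI3_weq (weq_sym sE) _; do 2!apply: inI3_cat => //.
have [Aa|nAa] := pselect (aniso (dbl u a)); last first.
  have [t [at' At le_t]] := aniso_min (dbl u a).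
  have It : inI3 t by apply: inI3_weq (weq_trans Ha at') _; apply: inI3_cat.
  have [||l [le_l sl]] := inI3_cat_le11 I3 (weq_trans sE' (weq_cat at' (weq_refl _))) It.
  - rewrite -ltnS ltn_neqAle; move: le_t; rewrite size_dbl a6 => ->.
    rewrite andbT; apply/eqP => t12; apply: nAa.
    by apply: (aniso_weq At (weq_sym at')); rewrite t12 size_dbl a6.
  - by rewrite C8.
  - exact: four_gp3s sl le_l.
have [|[b sb]|[p' [v [z [a' [b [[a'4 b4] _ sab _ _]]]]]]] :=
  link Aa a6 AC IC C8 sE'.
- by rewrite s16.
- exact: four_dbl sb.
- by apply: (@sum_gp2_cat 2 2 s _ _ sab); apply: sum_gp2_dbl.
Qed.

(** If all three share a binary form, then their sum is a multiple of <1, pq>. *)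
Lemma triple_common A B C p q la lb lc A' B' C' : triple A B C ->
    ext A la A' -> ext B lb B' -> ext C lc C' ->
    (exists la', perm_eq la [:: p, q & la']) ->
    (exists lb', perm_eq lb [:: p, q & lb']) ->
    (exists lc', perm_eq lc [:: p, q & lc']) ->
  sum_gp2 4 s.
Proof.
move=> [pA pB pC sE] AE BE CE [la' pa] [lb' pb] [lc' pc].
have D X l X' l' : pfister3 X -> ext X l X' -> perm_eq l [:: p, q & l'] ->
    exists b, weq X (dbl (p + q) b).
  move=> [AX IX X8] XE pl.
  have [{}XE XsE] := ext_cat (ext_perm pl XE : ext X ([:: p; q] ++ l') X').
  have [|b [c H]] := gp3_binary_weq AX IX X8 XE.
    by move: XsE; rewrite X8 => -[].
  by exists [:: p; p + b; p + c; p + c + b].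
have [a Aa] := D _ _ _ _ pA AE pa; have [b Bb] := D _ _ _ _ pB BE pb.
have [c Cc] := D _ _ _ _ pC CE pc.
apply: (@four_dbl (p + q) (a ++ b ++ c)); apply: weq_trans sE _.
apply: weq_trans (weq_cat Aa (weq_cat Bb Cc)) _; apply: weq_sym.
apply: weq_trans (weq_perm (dbl_cat _ _ _)) (weq_cat (weq_refl _) _).
exact/weq_perm/dbl_cat.
Qed.

Lemma triple_cancel t k A B C la lb lc A' B' C' : weq t (A ++ B ++ C) ->
    ext A la A' -> ext B lb B' -> ext C lc C' ->
    perm_eq (la ++ lb ++ lc) (k ++ shift eps k) ->
  weq t (A' ++ B' ++ C').
Proof.
move=> tE [AE _] [BE _] [CE _] pk; apply: weq_trans tE _.
apply: weq_trans (weq_cat AE (weq_cat BE CE)) (@weq_drop k _ _ _).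
apply: (@perm_trans _ ((la ++ lb ++ lc) ++ (A' ++ B' ++ C'))); first perm_count.
by rewrite [X in perm_eq _ X]catA perm_cat2r.
Qed.

Lemma nonaniso_lt t X : weq t X -> (size t < size X)%N -> ~ aniso X.
Proof. by move=> tX lt AX; have := AX _ (weq_sym tX); rewrite leqNgt lt. Qed.

Ltac share_with tr AE BE p q la lb :=
  apply: (triple_share (p := p) (q := q) tr AE BE);
  [ exists la; perm_count
  | exists lb; rewrite -?[_ + eps + eps]addrA ?exp2 ?addr0; perm_count ].

(** The exceptional case of [nonaniso_cat3]. It must occur if no two of the forms
    share a binary form, since the three pairs account for at most three of the
    four hyperbolic planes that are lost. *)
Definition common_value A B C := h /\ exists y, [/\ value A y, value B y & value C y].

Lemma triple_stage3 A B C (p q r : G) A' B' C' : triple A B C ->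
    ext A [:: p; q] A' -> ext B [:: p + eps; r] B' ->
    ext C [:: q + eps; r + eps] C' ->
  sum_gp2 4 s \/ common_value A B C.
Proof.
move=> tr AE BE CE; have [[AA _ A8] [AB _ B8] [AC _ C8] sE] := tr.
have st := triple_cancel (k := [:: p; q; r]) sE AE BE CE.
have {}st : weq s (A' ++ B' ++ C') by apply: st; perm_count.
have [_ As'] := AE; have [_ Bs'] := BE; have [_ Cs'] := CE.
have nA : ~ aniso (A' ++ B' ++ C').
  by apply: nonaniso_lt st _; rewrite !size_cat; move: As' Bs' Cs' => /=; lia.
case: (nonaniso_cat3 (ext_aniso AA AE) (ext_aniso AB BE) (ext_aniso AC CE) nA).
- move=> [e /(ext_value AE)[A2 {}AE] /(ext_value BE)[B2 {}BE]]; left.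
  share_with tr AE BE p e [:: q] [:: r].
- move=> [e /(ext_value AE)[A2 {}AE] /(ext_value CE)[C2 {}CE]]; left.
  share_with (triple_swap23 tr) AE CE q e [:: p] [:: r + eps].
- move=> [e /(ext_value BE)[B2 {}BE] /(ext_value CE)[C2 {}CE]]; left.
  share_with (triple_swap23 (triple_swap12 tr)) BE CE r e [:: p + eps] [:: q + eps].
- move=> [hT [y [yA yB yC]]]; right; split=> //; exists y.
  by split; [apply: value_ext AE yA|apply: value_ext BE yB|apply: value_ext CE yC].
Qed.

Lemma ext_nil A : ext A [::] A.
Proof. by split=> //; apply: weq_refl. Qed.

Lemma triple_stage2 A B C (p q : G) A' B' C' : triple A B C ->
    ext A [:: p; q] A' -> ext B [:: p + eps] B' -> ext C [:: q + eps] C' ->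
  sum_gp2 4 s \/ common_value A B C.
Proof.
move=> tr AE BE CE; have [[AA _ A8] [AB _ B8] [AC _ C8] sE] := tr.
have st := triple_cancel (k := [:: p; q]) sE AE BE CE.
have {}st : weq s (A' ++ B' ++ C') by apply: st; perm_count.
have [_ As'] := AE; have [_ Bs'] := BE; have [_ Cs'] := CE.
have nA : ~ aniso (A' ++ B' ++ C').
  by apply: nonaniso_lt st _; rewrite !size_cat; move: As' Bs' Cs' s16 A8 B8 C8 => /=; lia.
case: (nonaniso_cat3 (ext_aniso AA AE) (ext_aniso AB BE) (ext_aniso AC CE) nA).
- move=> [e /(ext_value AE)[A2 {}AE] /(ext_value BE)[B2 {}BE]]; left.
  share_with tr AE BE p e [:: q] (@nil G).
- move=> [e /(ext_value AE)[A2 {}AE] /(ext_value CE)[C2 {}CE]]; left.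
  share_with (triple_swap23 tr) AE CE q e [:: p] (@nil G).
- move=> [e /(ext_value BE)[B2 {}BE] /(ext_value CE)[C2 {}CE]].
  exact: triple_stage3 tr AE BE CE.
- move=> [hT [y [yA yB yC]]]; right; split=> //; exists y.
  by split; [apply: value_ext AE yA|apply: value_ext BE yB|apply: value_ext CE yC].
Qed.

Lemma common_value_perm A B C : common_value B A C -> common_value A B C.
Proof. by case=> hT [y [? ? ?]]; split=> //; exists y. Qed.

Lemma common_value_perm23 A B C : common_value A C B -> common_value A B C.
Proof. by case=> hT [y [? ? ?]]; split=> //; exists y. Qed.

Lemma triple_stage1 A B C (p : G) A' B' : triple A B C ->
    ext A [:: p] A' -> ext B [:: p + eps] B' ->
  sum_gp2 4 s \/ common_value A B C.
Proof.
move=> tr AE BE; have [[AA _ A8] [AB _ B8] [AC _ C8] sE] := tr.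
have CE := ext_nil C; have st := triple_cancel (k := [:: p]) sE AE BE CE.
have {}st : weq s (A' ++ B' ++ C) by apply: st; perm_count.
have [_ As'] := AE; have [_ Bs'] := BE.
have nA : ~ aniso (A' ++ B' ++ C).
  by apply: nonaniso_lt st _; rewrite !size_cat; move: As' Bs' s16 A8 B8 C8 => /=; lia.
case: (nonaniso_cat3 (ext_aniso AA AE) (ext_aniso AB BE) AC nA).
- move=> [e /(ext_value AE)[A2 {}AE] /(ext_value BE)[B2 {}BE]]; left.
  share_with tr AE BE p e (@nil G) (@nil G).
- move=> [e /(ext_value AE)[A2 {}AE] /value_ext1[C2 {}CE]].
  exact: triple_stage2 tr AE BE CE.
- move=> [e /(ext_value BE)[B2 {}BE] /value_ext1[C2 {}CE]].
  have {}AE : ext A [:: p + eps + eps] A' by rewrite -addrA exp2 addr0.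
  have [|] := triple_stage2 (triple_swap12 tr) BE AE CE; first by left.
  by move/common_value_perm; right.
- move=> [hT [y [yA yB yC]]]; right; split=> //; exists y.
  by split=> //; [apply: value_ext AE yA|apply: value_ext BE yB].
Qed.

Lemma triple_common_value A B C : triple A B C ->
  sum_gp2 4 s \/ common_value A B C.
Proof.
move=> tr; have [[AA _ A8] [AB _ B8] [AC _ C8] sE] := tr.
have nA : ~ aniso (A ++ B ++ C).
  by apply: nonaniso_lt sE _; rewrite !size_cat; lia.
case: (nonaniso_cat3 AA AB AC nA); last by right.
- move=> [e /value_ext1[A' AE] /value_ext1[B' BE]].
  exact: triple_stage1 tr AE BE.
- move=> [e /value_ext1[A' AE] /value_ext1[B' BE]].
  have [|] := triple_stage1 (triple_swap23 tr) AE BE; first by left.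
  by move/common_value_perm23; right.
- move=> [e /value_ext1[A' AE] /value_ext1[B' BE]].
  have [|] := triple_stage1 (triple_swap23 (triple_swap12 tr)) AE BE; first by left.
  by move/common_value_perm23/common_value_perm; right.
Qed.

Ltac common_with tr AE BE CE p q la lb lc :=
  apply: (triple_common (p := p) (q := q) tr AE BE CE);
  [ exists la; perm_count | exists lb; perm_count | exists lc; perm_count ].

Section Common.
Variables (hT : h) (x : G).

Lemma ext_flip A A' : ext A [:: x; x] A' -> ext A [:: x + eps; x + eps] A'.
Proof.
case=> AE sE; split=> //; apply: weq_trans AE (weq_cat _ (weq_refl _)).
exact: weq_flip.
Qed.

(** As <x, x, x, x> vanishes, adding <x> to the sum removes the common value
    from the three summands. *)
Lemma common_cancel k A B C la lb lc A' B' C' : triple A B C ->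
    ext A (x :: la) A' -> ext B (x :: lb) B' -> ext C (x :: lc) C' ->
    perm_eq (la ++ lb ++ lc) (k ++ shift eps k) ->
  weq (x :: s) (A' ++ B' ++ C').
Proof.
move=> [_ _ _ sE] [AE _] [BE _] [CE _] pk.
apply: weq_trans (weq_cons x sE) _.
apply: weq_trans (weq_cons x (weq_cat AE (weq_cat BE CE))) _.
apply: (@weq_trans _ ([:: x; x] ++ [:: x; x] ++
    (la ++ lb ++ lc) ++ (A' ++ B' ++ C'))); first by apply: weq_perm; perm_count.
apply: weq_trans (weq_cat (weq_flip _ hT) (weq_refl _)) _.
apply: (@weq_drop ([:: x; x] ++ k)).
apply: (@perm_trans _ ([:: x; x] ++ [:: x + eps; x + eps] ++
    (k ++ shift eps k) ++ (A' ++ B' ++ C'))).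
  apply: (@perm_trans _ ([:: x + eps; x + eps] ++ [:: x; x] ++
    (k ++ shift eps k) ++ (A' ++ B' ++ C'))); last by perm_count.
  by rewrite !perm_cat2l perm_cat2r.
rewrite map_cat; perm_count.
Qed.

(** A double value [x] of [A] is also a double value -x, which cancels the common
    value in [B] and in [C]. *)
Lemma common_double A B C A' B' C' : triple A B C -> ext A [:: x; x] A' ->
  ext B [:: x] B' -> ext C [:: x] C' -> sum_gp2 4 s.
Proof.
move=> tr AE BE CE; have [[AA _ A8] [AB _ B8] [AC _ C8] sE] := tr.
have AE' := ext_flip AE.
have st := triple_cancel (k := [:: x; x]) sE AE' BE CE.
have {}st : weq s (A' ++ B' ++ C') by apply: st; perm_count.
have [_ As'] := AE; have [_ Bs'] := BE; have [_ Cs'] := CE.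
have nA : ~ aniso (A' ++ B' ++ C').
  by apply: nonaniso_lt st _; rewrite !size_cat; move: As' Bs' Cs' s16 A8 B8 C8 => /=; lia.
case: (nonaniso_cat3 (ext_aniso AA AE) (ext_aniso AB BE) (ext_aniso AC CE) nA).
- move=> [e /(ext_value AE')[A2 {}AE] /(ext_value BE)[B2 {}BE]].
  share_with tr AE BE (x + eps) e [:: x + eps] (@nil G).
- move=> [e /(ext_value AE')[A2 {}AE] /(ext_value CE)[C2 {}CE]].
  share_with (triple_swap23 tr) AE CE (x + eps) e [:: x + eps] (@nil G).
- move=> [r /(ext_value BE)[B2 {}BE] /(ext_value CE)[C2 {}CE]].
  have {}st := triple_cancel (k := [:: x; x; r]) sE AE' BE CE.
  have {}st : weq s (A' ++ B2 ++ C2) by apply: st; perm_count.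
  have [_ {}Bs'] := BE; have [_ {}Cs'] := CE.
  have {}nA : ~ aniso (A' ++ B2 ++ C2).
    by apply: nonaniso_lt st _; rewrite !size_cat; move: As' Bs' Cs' s16 A8 B8 C8 => /=; lia.
  case: (nonaniso_cat3 (ext_aniso AA AE) (ext_aniso AB BE) (ext_aniso AC CE) nA).
  + move=> [e /(ext_value AE')[A3 {}AE] /(ext_value BE)[B3 {}BE]].
    share_with tr AE BE (x + eps) e [:: x + eps] [:: r].
  + move=> [e /(ext_value AE')[A3 {}AE] /(ext_value CE)[C3 {}CE]].
    share_with (triple_swap23 tr) AE CE (x + eps) e [:: x + eps] [:: r + eps].
  + move=> [e /(ext_value BE)[B3 {}BE] /(ext_value CE)[C3 {}CE]].
    share_with (triple_swap23 (triple_swap12 tr)) BE CE r e [:: x] [:: x].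
  + move=> [_ [y [/(ext_value AE)[A3 {}AE] /(ext_value BE)[B3 {}BE]]]].
    move=> /(ext_value CE)[C3 {}CE].
    common_with tr AE BE CE x y [:: x] [:: r] [:: r + eps].
- move=> [_ [y [/(ext_value AE)[A3 {}AE] /(ext_value BE)[B3 {}BE]]]].
  move=> /(ext_value CE)[C3 {}CE].
  common_with tr AE BE CE x y [:: x] (@nil G) (@nil G).
Qed.

(** In each of the three forms, the three known entries and their product make a
    twofold Pfister form up to similarity, and so do the remaining four entries.
    The three products and -x have trivial discriminant, so that they make a
    fourth such form. *)
Lemma common_final A B C (p q r : G) A' B' C' : triple A B C ->
    ext A [:: x; p; q] A' -> ext B [:: x; p + eps; r] B' ->
    ext C [:: x; q + eps; r + eps] C' -> sum_gp2 4 s.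
Proof.
move=> tr AE BE CE; have [pA pB pC sE] := tr.
have fourth X (a b : G) X' : pfister3 X -> ext X [:: x; a; b] X' ->
    exists F, weq X' (x + a + b :: F) /\ sum_gp2 1 F.
  move=> [AX IX X8] XE; have AX' := ext_aniso AX XE; have [XX' sX'] := XE.
  have [|b' [c' H]] := gp3_binary_weq AX IX X8 XX'; first by move: sX' => /=; lia.
  set w := [:: x + b'; x + c'; x + c' + b'].
  have Hb : weq (b :: X') (dbl (x + a) w).
    apply: (@weq_consK a); apply: (@weq_consK x).
    apply: weq_trans (weq_sym XX') (weq_trans H _).
    apply: weq_trans (weq_perm (dbl_cons _ _ _)) _.
    have -> : x + (x + a) = a by g2 exp2.
    exact: weq_refl.
  have AbX : aniso (b :: X').
    apply: (@aniso_catr [:: x; a]); apply: (aniso_weq AX XX').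
    by rewrite sX'.
  have [w' [wE _ X'w']] := dbl_value_weq AbX Hb.
  have w'2 : size w' = 2%N by case: wE => <-.
  exists (dbl (x + a) w'); split; last by apply: (@sum_gp2_dbl 1); rewrite w'2.
  by have -> : x + a + b = b + (x + a) by g2 exp2.
have [F [AF FA]] := fourth _ _ _ _ pA AE.
have [F' [BF FB]] := fourth _ _ _ _ pB BE.
have [F'' [CF FC]] := fourth _ _ _ _ pC CE.
have st := common_cancel (k := [:: p; q; r]) tr AE BE CE.
have {}st : weq (x :: s) (A' ++ B' ++ C') by apply: st; perm_count.
set Q := [:: x + eps; x + p + q; x + (p + eps) + r; x + (q + eps) + (r + eps)].
have sQ : weq s (Q ++ F ++ F' ++ F'').
  apply: (@weq_consK x); apply: weq_trans st _.
  apply: weq_trans (weq_cat AF (weq_cat BF CF)) (weq_sym _).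
  by apply: (@weq_drop [:: x]); rewrite /Q; perm_count.
have JQ : disc_trivial Q.
  by rewrite /disc_trivial /= !big_cons big_nil mulr2n; apply/eqP; g2 exp2.
apply: (@sum_gp2_cat 1 3 _ _ _ sQ); first exact: sum_gp2_disc.
apply: (@sum_gp2_cat 1 2 _ _ _ (weq_refl _)) => //.
exact: (@sum_gp2_cat 1 1 _ _ _ (weq_refl _)).
Qed.

(** If nothing more cancels, then [x] is an entry of one of the remainders, hence a
    double value there. *)
Lemma common_stage3 A B C (p q : G) A' B' C' : triple A B C ->
    ext A [:: x; p; q] A' -> ext B [:: x; p + eps] B' ->
    ext C [:: x; q + eps] C' -> sum_gp2 4 s.
Proof.
move=> tr AE BE CE; have [[AA _ A8] [AB _ B8] [AC _ C8] sE] := tr.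
have st := common_cancel (k := [:: p; q]) tr AE BE CE.
have {}st : weq (x :: s) (A' ++ B' ++ C') by apply: st; perm_count.
have [_ As'] := AE; have [_ Bs'] := BE; have [_ Cs'] := CE.
have [AABC|nA] := pselect (aniso (A' ++ B' ++ C')).
  have Axs : aniso (x :: s).
    apply: (aniso_weq AABC (weq_sym st)).
    by rewrite !size_cat /= s16; move: As' Bs' Cs' s16 A8 B8 C8 => /=; lia.
  have single X l X' : aniso X -> ext X (x :: l) X' -> ext X [:: x] (l ++ X').
    by move=> AX XE; apply: (@ext_cat X [:: x]).
  have dble X l X' : ext X (x :: l) X' -> x \in X' ->
      exists X2, ext X [:: x; x] X2.
    move=> XE /value_mem /(ext_value XE) [X2 XE2]; exists (l ++ X2).
    apply: ext_cat; apply: ext_perm XE2; perm_count.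
  have nopp X l X' : aniso X -> ext X (x :: l) X' -> eps != 0 ->
      x + eps \notin X'.
    move=> AX XE eN; apply/negP => /value_mem /(ext_value XE) [X2 [H sX2]].
    have : aniso (((x :: l) ++ [:: x + eps]) ++ X2).
      by apply: (aniso_weq AX H); rewrite size_cat sX2.
    move/(@aniso_perm _ [:: x, x + eps & l ++ X2]) => H2.
    by case: (@aniso_pairF x (l ++ X2)); apply: H2; perm_count.
  case: (reduced_in (aniso_reduced Axs) st (mem_head _ _)); last first.
    case=> _ eN; rewrite !mult_cat.
    have := nopp _ _ _ AA AE eN; have := nopp _ _ _ AB BE eN.
    by have := nopp _ _ _ AC CE eN; rewrite !mem_mult; lia.
  have [AE1 BE1 CE1] := And3 (single _ _ _ AA AE) (single _ _ _ AB BE)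
    (single _ _ _ AC CE).
  rewrite !mem_cat => /or3P[/(dble _ _ _ AE)|/(dble _ _ _ BE)|/(dble _ _ _ CE)].
  - by case=> X2 XE; apply: common_double tr XE BE1 CE1.
  - by case=> X2 XE; apply: common_double (triple_swap12 tr) XE AE1 CE1.
  - case=> X2 XE.
    exact: common_double (triple_swap12 (triple_swap23 tr)) XE AE1 BE1.
case: (nonaniso_cat3 (ext_aniso AA AE) (ext_aniso AB BE) (ext_aniso AC CE) nA).
- move=> [e /(ext_value AE)[A2 {}AE] /(ext_value BE)[B2 {}BE]].
  share_with tr AE BE p e [:: x; q] [:: x].
- move=> [e /(ext_value AE)[A2 {}AE] /(ext_value CE)[C2 {}CE]].
  share_with (triple_swap23 tr) AE CE q e [:: x; p] [:: x].
- move=> [r /(ext_value BE)[B2 {}BE] /(ext_value CE)[C2 {}CE]].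
  exact: common_final tr AE BE CE.
- move=> [_ [y [/(ext_value AE)[A3 {}AE] /(ext_value BE)[B3 {}BE]]]].
  move=> /(ext_value CE)[C3 {}CE].
  common_with tr AE BE CE x y [:: p; q] [:: p + eps] [:: q + eps].
Qed.

Lemma common_stage2 A B C (p : G) A' B' C' : triple A B C ->
    ext A [:: x; p] A' -> ext B [:: x; p + eps] B' -> ext C [:: x] C' ->
  sum_gp2 4 s.
Proof.
move=> tr AE BE CE; have [[AA _ A8] [AB _ B8] [AC _ C8] sE] := tr.
have st := common_cancel (k := [:: p]) tr AE BE CE.
have {}st : weq (x :: s) (A' ++ B' ++ C') by apply: st; perm_count.
have [_ As'] := AE; have [_ Bs'] := BE; have [_ Cs'] := CE.
have nA : ~ aniso (A' ++ B' ++ C').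
  apply: nonaniso_lt st _; rewrite /= s16 !size_cat.
  by move: As' Bs' Cs' s16 A8 B8 C8 => /=; lia.
case: (nonaniso_cat3 (ext_aniso AA AE) (ext_aniso AB BE) (ext_aniso AC CE) nA).
- move=> [e /(ext_value AE)[A2 {}AE] /(ext_value BE)[B2 {}BE]].
  share_with tr AE BE p e [:: x] [:: x].
- move=> [e /(ext_value AE)[A2 {}AE] /(ext_value CE)[C2 {}CE]].
  exact: common_stage3 tr AE BE CE.
- move=> [e /(ext_value BE)[B2 {}BE] /(ext_value CE)[C2 {}CE]].
  have {}AE : ext A [:: x; p + eps + eps] A' by rewrite -addrA exp2 addr0.
  exact: common_stage3 (triple_swap12 tr) BE AE CE.
- move=> [_ [y [/(ext_value AE)[A3 {}AE] /(ext_value BE)[B3 {}BE]]]].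
  move=> /(ext_value CE)[C3 {}CE].
  common_with tr AE BE CE x y [:: p] [:: p + eps] (@nil G).
Qed.

Lemma common_stage1 A B C A' B' C' : triple A B C -> ext A [:: x] A' ->
  ext B [:: x] B' -> ext C [:: x] C' -> sum_gp2 4 s.
Proof.
move=> tr AE BE CE; have [[AA _ A8] [AB _ B8] [AC _ C8] sE] := tr.
have st := common_cancel (k := [::]) tr AE BE CE.
have {}st : weq (x :: s) (A' ++ B' ++ C') by apply: st.
have [_ As'] := AE; have [_ Bs'] := BE; have [_ Cs'] := CE.
have nA : ~ aniso (A' ++ B' ++ C').
  apply: nonaniso_lt st _; rewrite /= s16 !size_cat.
  by move: As' Bs' Cs' s16 A8 B8 C8 => /=; lia.
case: (nonaniso_cat3 (ext_aniso AA AE) (ext_aniso AB BE) (ext_aniso AC CE) nA).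
- move=> [e /(ext_value AE)[A2 {}AE] /(ext_value BE)[B2 {}BE]].
  exact: common_stage2 tr AE BE CE.
- move=> [e /(ext_value AE)[A2 {}AE] /(ext_value CE)[C2 {}CE]].
  exact: common_stage2 (triple_swap23 tr) AE CE BE.
- move=> [e /(ext_value BE)[B2 {}BE] /(ext_value CE)[C2 {}CE]].
  exact: common_stage2 (triple_swap23 (triple_swap12 tr)) BE CE AE.
- move=> [_ [y [/(ext_value AE)[A3 {}AE] /(ext_value BE)[B3 {}BE]]]].
  move=> /(ext_value CE)[C3 {}CE].
  common_with tr AE BE CE x y (@nil G) (@nil G) (@nil G).
Qed.

End Common.

Lemma triple_four A B C : triple A B C -> sum_gp2 4 s.
Proof.
move=> tr; have [//|[hT [x [/value_ext1[A' AE] /value_ext1[B' BE]]]]] :=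
  triple_common_value tr.
case/value_ext1=> C' CE; exact: common_stage1 hT _ _ _ _ _ _ _ tr AE BE CE.
Qed.

Theorem four_gp3s3 l : (size l <= 3)%N -> weq s (gp3s l) -> sum_gp2 4 s.
Proof.
case: l => [|i [|j [|k [|]]]] // _; try by move=> /four_gp3s; apply.
set A := gp3 i.1.1.1 i.1.1.2 i.1.2 i.2; set B := gp3 j.1.1.1 j.1.1.2 j.1.2 j.2.
set C := gp3 k.1.1.1 k.1.1.2 k.1.2 k.2.
have -> : gp3s [:: i; j; k] = A ++ B ++ C by [].
have IA : inI3 A by apply: inI3_gp3. have IB : inI3 B by apply: inI3_gp3.
have IC : inI3 C by apply: inI3_gp3.
have [AA|A0] := aniso_inI3_8 IA erefl; last first.
  move=> sE; apply: (@four_gp3s [:: j; k]) => //; apply: weq_trans sE _.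
  change (weq (A ++ B ++ C) (B ++ C)).
  by apply: (@weq_cat _ [::]); [|apply: weq_refl].
have [AB|B0] := aniso_inI3_8 IB erefl; last first.
  move=> sE; apply: (@four_gp3s [:: i; k]) => //; apply: weq_trans sE _.
  change (weq (A ++ B ++ C) (A ++ C)); apply: weq_cat; first exact: weq_refl.
  by apply: (@weq_cat _ [::]); [|apply: weq_refl].
have [AC|C0] := aniso_inI3_8 IC erefl; last first.
  move=> sE; apply: (@four_gp3s [:: i; j]) => //; apply: weq_trans sE _.
  change (weq (A ++ B ++ C) (A ++ B ++ [::])).
  by do 2!(apply: weq_cat; first exact: weq_refl).
by move=> sE; apply: (@triple_four A B C).
Qed.

End Sixteen.

End Witt.

(** * Isometries of forms *)

Section Isometry.
Variables (F : fieldType) (charF : (2%:R : F) != 0).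
Implicit Types (q r : qform F).

Lemma quadratic_eq0 n (D : 'M[F]_n) : D^T = D ->
  (forall v : 'rV_n, (v *m D *m v^T) 0 0 = 0) -> D = 0.
Proof.
move=> symD D0; have entry i j : D i j = 0.
  pose e k : 'rV[F]_n := delta_mx 0 k.
  have eE k l : (e k *m D *m (e l)^T) 0 0 = D k l.
    by rewrite /e -rowE trmx_delta -colE !mxE.
  have := D0 (e i + e j); rewrite linearD /= mulmxDl mulmxDr !mulmxDl.
  rewrite mxE [X in X + _]mxE [X in _ + X]mxE !D0 add0r addr0 !eE.
  have -> : D j i = D i j by rewrite -{1}symD mxE.
  by rewrite -mulr2n -mulr_natl => /eqP; rewrite mulf_eq0 (negPf charF) => /eqP.
by apply/matrixP => i j; rewrite entry mxE.
Qed.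

(** Isometry in terms of Gram matrices, with the inverse of the base change. *)
Definition congruent q r := exists (P : 'M_(qdim q, qdim r)) (Q : 'M_(qdim r, qdim q)),
  [/\ P *m Q = 1%:M, Q *m P = 1%:M & P *m gram r *m P^T = gram q].

(** The polarization of a quadratic form is determined by its values. *)
Lemma isometricP q r : isometric q r <-> congruent q r.
Proof.
split=> [[P [fP uP qP]]|[P [Q [PQ QP E]]]].
  have [/row_freeP[Q PQ] /row_fullP[Q' QP]] := (fP, uP).
  have QQ : Q' = Q by rewrite -[Q']mulmx1 -PQ mulmxA QP mul1mx.
  exists P, Q; split=> //; first by rewrite -QQ.
  have /symmetricmxP sq := gram_sym q; have /symmetricmxP sr := gram_sym r.
  apply/eqP; rewrite -subr_eq0; apply/eqP/quadratic_eq0.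
    by rewrite linearB /= !trmx_mul trmxK sq sr mulmxA.
  move=> v; rewrite mulmxBr mulmxBl mxE [X in _ + X]mxE.
  by have := qP v; rewrite /qval trmx_mul !mulmxA => ->; rewrite subrr.
exists P; split.
- by apply/row_freeP; exists Q.
- by apply/row_fullP; exists Q.
- by move=> v; rewrite /qval trmx_mul -E !mulmxA.
Qed.

Lemma isometric_refl q : isometric q q.
Proof.
by apply/isometricP; exists 1%:M, 1%:M; rewrite trmx1 !mul1mx mulmx1.
Qed.

Lemma isometric_sym q r : isometric q r -> isometric r q.
Proof.
move=> /isometricP[P [Q [PQ QP E]]]; apply/isometricP; exists Q, P.
split=> //; rewrite -E !mulmxA QP mul1mx -mulmxA -trmx_mul QP trmx1.
by rewrite mulmx1.
Qed.

Lemma isometric_trans q r s : isometric q r -> isometric r s -> isometric q s.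
Proof.
move=> /isometricP[P [Q [PQ QP E]]] /isometricP[P' [Q' [PQ' QP' E']]].
apply/isometricP; exists (P *m P'), (Q' *m Q); split.
- by rewrite mulmxA -(mulmxA P) PQ' mulmx1.
- by rewrite mulmxA -(mulmxA Q') QP mulmx1.
- by rewrite trmx_mul -E -E' !mulmxA.
Qed.

Lemma isometric_dim q r : isometric q r -> qdim q = qdim r.
Proof.
by case=> P [fP uP _]; rewrite -(eqP fP); exact/eqP.
Qed.

Lemma isometric_sum q r q' r' : isometric q r -> isometric q' r' ->
  isometric (qsum q q') (qsum r r').
Proof.
move=> /isometricP[P [Q [PQ QP E]]] /isometricP[P' [Q' [PQ' QP' E']]].
apply/isometricP; exists (block_mx P 0 0 P'), (block_mx Q 0 0 Q').
rewrite !mulmx_block !mulmx0 !mul0mx !addr0 !add0r PQ QP PQ' QP' -!scalar_mx_block.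
split=> //=; rewrite tr_block_mx !mulmx_block !trmx0 !mulmx0 !mul0mx !addr0 !add0r.
by rewrite E E'.
Qed.

Lemma isometric_tens q r q' r' : isometric q r -> isometric q' r' ->
  isometric (qtens q q') (qtens r r').
Proof.
have tens1 m n : (1%:M : 'M[F]_m) *t (1%:M : 'M_n) = 1%:M.
  apply/matrixP => i j; rewrite -[i]mxtens_unindexK -[j]mxtens_unindexK.
  case: (mxtens_unindex i) (mxtens_unindex j) => [i1 i2] [j1 j2].
  by rewrite tensmxE !mxE (can_eq (@mxtens_indexK _ _)) xpair_eqE -mulnb natrM.
move=> /isometricP[P [Q [PQ QP E]]] /isometricP[P' [Q' [PQ' QP' E']]].
apply/isometricP; exists (P *t P'), (Q *t Q').
rewrite !tensmx_mul PQ QP PQ' QP' !tens1; split=> //=.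
by rewrite trmx_tens !tensmx_mul E E'.
Qed.

Lemma isometric_scale c q r : isometric q r -> isometric (qscale c q) (qscale c r).
Proof.
move=> /isometricP[P [Q [PQ QP E]]]; apply/isometricP; exists P, Q.
by split=> //=; rewrite -scalemxAr -scalemxAl E.
Qed.

(** * Diagonal forms *)

(** The Gram matrix of [q] is diagonal, with the diagonal entries [L] in some
    order: such forms are determined by [L] up to a permutation of the basis. *)
Definition diagonal q (L : seq F) :=
  (forall i j, i != j -> gram q i j = 0) /\
  perm_eq [seq gram q i i | i <- enum 'I_(qdim q)] L.

Lemma diagonal_perm q L L' : perm_eq L L' -> diagonal q L -> diagonal q L'.
Proof. by move=> LL [D E]; split=> //; apply: perm_trans LL. Qed.

Lemma diagonal_size q L : diagonal q L -> qdim q = size L.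
Proof. by case=> _ /perm_size; rewrite size_map size_enum_ord. Qed.

Lemma diagonal_isometric q r L : diagonal q L -> diagonal r L -> isometric q r.
Proof.
move=> qL rL; have := diagonal_size rL; rewrite -(diagonal_size qL).
case: q qL => n A sA uA; case: r rL => m B sB uB [/= DB EB] [/= DA EA] mn.
subst m; have : perm_eq [seq A i i | i <- enum 'I_n] [seq B i i | i <- enum 'I_n].
  by apply: (perm_trans EA); rewrite perm_sym.
have tE (C : 'M[F]_n) : [seq C i i | i <- enum 'I_n] = [tuple C i i | i < n].
  by rewrite /= -[in LHS]val_ord_tuple.
rewrite !tE => /tuple_permP[p pE].
have pAB i : A i i = B (p i) (p i).
  have := congr1 (fun s => nth 0 s i) pE.
  by rewrite -!tnth_nth !tnth_mktuple.
apply/isometricP; exists (perm_mx p), (perm_mx p^-1).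
rewrite -!perm_mxM mulgV mulVg perm_mx1; split=> //=.
apply/matrixP => i j; rewrite tr_perm_mx -row_permE -col_permE !mxE.
have [->|ij] := eqVneq i j; first by rewrite pAB.
by rewrite DA // DB // (inj_eq perm_inj).
Qed.

Lemma diagonal_qsum q r L L' : diagonal q L -> diagonal r L' ->
  diagonal (qsum q r) (L ++ L').
Proof.
move=> [Dq Eq] [Dr Er]; split=> /=.
  move=> i j; rewrite -[i]splitK -[j]splitK.
  case: (split i) => i'; case: (split j) => j' /= ij;
    rewrite ?block_mxEul ?block_mxEur ?block_mxEdl ?block_mxEdr ?mxE //.
    by apply: Dq; apply: contraNneq ij => ->.
  by apply: Dr; apply: contraNneq ij => ->.
have E : perm_eq (enum 'I_(qdim q + qdim r))
    ([seq lshift (qdim r) i | i <- enum 'I_(qdim q)] ++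
     [seq rshift (qdim q) i | i <- enum 'I_(qdim r)]).
  apply: uniq_perm; first exact: enum_uniq.
    rewrite cat_uniq (map_inj_uniq (@lshift_inj _ _)).
    rewrite (map_inj_uniq (@rshift_inj _ _)) !enum_uniq andbT /=.
    apply/hasPn => _ /mapP[i _ ->]; apply/mapP => -[j _].
    by move/eqP; rewrite eq_rlshift.
  move=> i; rewrite mem_enum mem_cat -[i]splitK; symmetry; apply/orP.
  by case: (split i) => j /=; [left|right]; rewrite map_f ?mem_enum.
apply: (perm_trans (perm_map _ E)); rewrite map_cat.
rewrite -[X in X ++ _]map_comp -[X in _ ++ X]map_comp.
apply: perm_cat.
  rewrite (eq_map (_ : _ =1 fun i => gram q i i)) => [|i /=]; first exact: Eq.
  by rewrite block_mxEul.
rewrite (eq_map (_ : _ =1 fun i => gram r i i)) => [|i /=]; first exact: Er.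
by rewrite block_mxEdr.
Qed.

Lemma diagonal_qtens q r L L' : diagonal q L -> diagonal r L' ->
  diagonal (qtens q r) [seq a * b | a <- L, b <- L'].
Proof.
move=> [Dq Eq] [Dr Er]; split=> /=.
  move=> i j; rewrite -[i]mxtens_unindexK -[j]mxtens_unindexK.
  case: (mxtens_unindex i) => i1 i2; case: (mxtens_unindex j) => j1 j2 ij.
  rewrite tensmxE /=; have [i1j1|ij1] := eqVneq i1 j1.
    rewrite [gram r _ _]Dr ?mulr0 //; apply: contraNneq ij => ->.
    by rewrite i1j1.
  by rewrite Dq // mul0r.
have E : perm_eq (enum 'I_(qdim q * qdim r))
    [seq mxtens_index (i, j) | i <- enum 'I_(qdim q), j <- enum 'I_(qdim r)].
  apply: uniq_perm; first exact: enum_uniq.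
    apply: allpairs_uniq; rewrite ?enum_uniq // => -[i j] [i' j'] _ _ /=.
    exact: (can_inj (@mxtens_indexK _ _)).
  move=> i; rewrite mem_enum -[i]mxtens_unindexK; symmetry.
  case: (mxtens_unindex i) => i1 i2.
  by apply/allpairsP; exists (i1, i2); rewrite !mem_enum.
apply: (perm_trans (perm_map _ E)); rewrite map_allpairs.
have -> : [seq (gram q *t gram r) (mxtens_index (i, j)) (mxtens_index (i, j)) |
    i <- enum 'I_(qdim q), j <- enum 'I_(qdim r)] =
  [seq a * b | a <- [seq gram q i i | i <- enum 'I_(qdim q)],
    b <- [seq gram r i i | i <- enum 'I_(qdim r)]].
  rewrite [RHS]allpairs_mapl [RHS]allpairs_mapr.
  by apply/eq_in_allpairs => i j _ _; rewrite tensmxE.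
exact: perm_allpairs.
Qed.

Lemma diagonal_qscale c q L : diagonal q L ->
  diagonal (qscale c q) [seq val c * a | a <- L].
Proof.
move=> [Dq Eq]; split=> /= [i j ij|]; first by rewrite mxE Dq ?mulr0.
rewrite (eq_map (_ : _ =1 fun i => val c * gram q i i)) => [|i]; last by rewrite mxE.
by rewrite (map_comp (fun a => val c * a)); apply: perm_map.
Qed.

Lemma diagonal_qdiag n (t : n.-tuple (nonzero F)) :
  diagonal (qdiag t) [seq val a | a <- t].
Proof.
split=> /= [i j ij|]; first by rewrite !mxE (negPf ij).
rewrite (eq_map (_ : _ =1 fun i => val (tnth t i))) => [|i]; last by rewrite !mxE eqxx.
by rewrite (map_comp val) map_tnth_enum.
Qed.

Lemma diagonal_qzero : diagonal (qzero F) [::].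
Proof. by split=> [[]|] //=; rewrite enum_ord0. Qed.

End Isometry.

(** * Witt cancellation and diagonalization *)

Section Cancellation.
Variables (F : fieldType) (charF : (2%:R : F) != 0).
Implicit Types (q r : qform F) (a : nonzero F).

Definition unary a : qform F := qdiag [tuple a].

Lemma gram_unary a : gram (unary a) = (val a)%:M.
Proof. by apply/matrixP => i j; rewrite !mxE !ord1 (tnth_nth a). Qed.

Lemma isometric_gram q r (D : 'M_(qdim q, qdim r)) : qdim q = qdim r ->
  D *m gram r *m D^T = gram q -> isometric q r.
Proof.
case: q D => n A sA uA; case: r => m B sB uB /= D E; subst m => DE.
have uD : D \in unitmx.
  have : \det (D *m B *m D^T) != 0 by rewrite DE -unitfE -unitmxE.
  by rewrite !det_mulmx mulf_eq0 mulf_eq0 negb_or unitmxE unitfE =>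
    /andP[/norP[]].
by apply/(isometricP charF); exists D, (invmx D); rewrite mulmxV ?mulVmx.
Qed.

(** If [block_mx alpha beta gamma delta] is an isometry of <a> + r onto
    <a> + q, then delta - (1 + alpha)^-1 gamma beta is an isometry of r onto q:
    this is the given isometry followed by the reflection that restores the
    first basis vector. When alpha = -1, negate the first row and column. *)
Lemma witt_cancel_unary a q r :
  isometric (qsum (unary a) q) (qsum (unary a) r) -> isometric q r.
Proof.
move=> H; have [dim_qr] := isometric_dim H; move: H.
case/(isometricP charF) => P [_ [_ _ E]].
have {E} : (P : 'M_(1 + qdim q, 1 + qdim r)) *m
    block_mx (val a)%:M 0 0 (gram r) *m P^T = block_mx (val a)%:M 0 0 (gram q).
  by rewrite -!gram_unary; exact: E.
move: (P : 'M_(1 + qdim q, 1 + qdim r)) => {}P.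
have [/symmetricmxP sq /symmetricmxP sr] := (gram_sym q, gram_sym r).
set al := ulsubmx P; set be := ursubmx P; set ga := dlsubmx P; set de := drsubmx P.
rewrite -[P]submxK -/al -/be -/ga -/de tr_block_mx !mulmx_block.
rewrite !mulmx0 !addr0 !add0r => /eq_block_mx[E1 E2 _ E4].
have alE : al = (al 0 0)%:M by rewrite [LHS]mx11_scalar.
set c := val a in E1 E2 E4; set x := al 0 0 in alE.
have c0 : c != 0 := valP a.
have E2' : be *m gram r *m de^T = - (x * c) *: ga^T.
  move: E2; rewrite alE -scalar_mxM mul_scalar_mx => /eqP.
  by rewrite addrC addr_eq0 scaleNr => /eqP.
have E3' : de *m gram r *m be^T = - (x * c) *: ga.
  have -> : de *m gram r *m be^T = (be *m gram r *m de^T)^T.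
    by rewrite !trmx_mul trmxK sr mulmxA.
  by rewrite E2' linearZ /= trmxK.
have E1' : be *m gram r *m be^T = (c - x * c * x)%:M.
  move: E1; rewrite alE tr_scalar_mx -!scalar_mxM => /(canRL (addKr _)) ->.
  by rewrite addrC raddfB.
have E4' : de *m gram r *m de^T = gram q - c *: (ga *m ga^T).
  move: E4; rewrite mul_mx_scalar -scalemxAl => /(canRL (addKr _)) ->.
  by rewrite addrC.
have key k : k ^+ 2 * (1 - x ^+ 2) + 2%:R * k * x - 1 = 0 -> isometric q r.
  move=> kE; apply: (isometric_gram dim_qr (D := de - k *: (ga *m be))).
  have -> : (de - k *: (ga *m be))^T = de^T - k *: (be^T *m ga^T).
    by rewrite [LHS]linearB [X in _ - X]linearZ /= trmx_mul.
  rewrite !mulmxBl !mulmxBr E4'.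
  rewrite -!scalemxAl -!scalemxAr !mulmxA E3'.
  rewrite -(mulmxA ga be) -(mulmxA ga (be *m _)) E2'.
  rewrite -(mulmxA ga (be *m _) be^T) E1' mul_mx_scalar.
  rewrite -!scalemxAl -!scalemxAr.
  set g := ga *m ga^T; rewrite !scalerA -!scaleNr -!addrA -!scalerDl.
  rewrite -[RHS]addr0; congr (_ + _).
  rewrite -!scalerBl -!scalerDl -[RHS](scale0r g); congr (_ *: _).
  rewrite -[RHS](mulr0 c) -kE; ring.
have [x1|x1] := eqVneq (1 + x) 0.
  apply: (key (- 2%:R^-1)).
  have -> : x = -1 by rewrite -[x](addKr 1) x1 addr0.
  by field.
by apply: (key (1 + x)^-1); field.
Qed.

Lemma split_off_unary q : (0 < qdim q)%N -> exists a r,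
  isometric q (qsum (unary a) r) /\ qdim q = (qdim r).+1.
Proof.
case: q => -[//|n] A sA uA _; have /symmetricmxP tA := sA.
have [v v0] : exists v : 'rV_n.+1, (v *m A *m v^T) 0 0 != 0.
  apply: contrapT => nex; have A0 : A = 0.
    apply: (quadratic_eq0 charF tA) => v; apply/eqP/negP => /negP v0.
    by apply: nex; exists v.
  by move: uA; rewrite A0 unitmxE det0 unitr0.
have rv : \rank v = 1%N.
  apply/eqP; rewrite eqn_leq rank_leq_row lt0n mxrank_eq0.
  by apply: contraNneq v0 => ->; rewrite !mul0mx mxE.
pose U := row_ebase v : 'M_(1 + n).
have uU : U \in unitmx by apply: row_ebase_unit.
pose B : 'M_(1 + n) := U *m A *m U^T.
have tB : B^T = B by rewrite /B !trmx_mul trmxK tA mulmxA.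
have uB : B \in unitmx by rewrite /B !unitmx_mul unitmx_tr uU uA.
have B00 : B 0 0 != 0.
  pose w : 'rV_n.+1 := row 0 U.
  have vE : v = (col_ebase v 0 0) *: w.
    rewrite -[LHS]mulmx_ebase rv [col_ebase v]mx11_scalar mul_scalar_mx !mxE eqxx.
    rewrite mulr1n -scalemxAl; congr (_ *: _); rewrite /w rowE; congr (_ *m _).
    by apply/rowP => j; rewrite !mxE /= andbT eq_sym.
  have -> : B 0 0 = (w *m A *m w^T) 0 0.
    rewrite /B /w -row_mul [LHS]mxE [RHS]mxE.
    by apply: eq_bigr => k _; rewrite !mxE.
  apply: contraNneq v0 => w0.
  rewrite vE [(_ *: w)^T]linearZ /= -!scalemxAl -scalemxAr.
  by rewrite mxE [X in _ * X]mxE w0 !mulr0.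
pose b : 'rV_n := ursubmx B; pose D := drsubmx B; pose x := B 0 0.
have BE : B = block_mx x%:M b b^T D.
  have -> : b^T = dlsubmx B by rewrite /b trmx_ursub tB.
  rewrite -[LHS]submxK; congr (block_mx _ _ _ _).
  by rewrite [LHS]mx11_scalar; congr (_%:M); rewrite /x mxE mxE;
    apply: (congr2 (fun_of_matrix B)); apply: val_inj.
pose E : 'M_(1 + n) := block_mx 1%:M 0 (- x^-1 *: b^T) 1%:M.
pose D' := D - x^-1 *: (b^T *m b).
have uE : E \in unitmx by rewrite unitmxE det_lblock !det1 mulr1 unitr1.
have tD : D^T = D by rewrite /D trmx_drsub tB.
have EBE : E *m B *m E^T = block_mx x%:M 0 0 D'.
  rewrite BE /E tr_block_mx !mulmx_block !trmx1 !trmx0 !mul1mx !mul0mx.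
  rewrite !mulmx1 !mulmx0 !addr0 linearZ /= trmxK.
  rewrite mul_scalar_mx mul_mx_scalar !scalerA mulrN mulfV //.
  rewrite !scaleN1r !addNr mul0mx add0r; congr (block_mx _ _ _ _).
  by rewrite /D' -scalemxAl scaleNr addrC.
have : E *m B *m E^T \in unitmx by rewrite !unitmx_mul !unitmx_tr uE uU uA.
rewrite EBE => uBE.
have uD' : D' \in unitmx.
  by move: uBE; rewrite unitmxE det_ublock unitrM -!unitmxE => /andP[].
have sD' : D' \is symmetricmx.
  by apply/symmetricmxP; rewrite /D' linearB linearZ /= trmx_mul trmxK tD.
exists (exist _ x B00 : nonzero F), (QForm sD' uD'); split=> //.
apply/isometric_sym/(isometricP charF) => //.
exists (E *m U), (invmx (E *m U)); rewrite mulmxV ?mulVmx ?unitmx_mul ?uE //.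
split=> //; transitivity (E *m B *m E^T); first by rewrite trmx_mul /B !mulmxA.
rewrite EBE; pose a : nonzero F := exist _ x B00.
exact: (congr1 (fun M => block_mx M 0 0 D') (esym (gram_unary a))).
Qed.

Definition diag_form (L : seq (nonzero F)) : qform F := qdiag (in_tuple L).

Lemma diagonal_diag_form L : diagonal (diag_form L) [seq val a | a <- L].
Proof. exact: diagonal_qdiag. Qed.

Lemma diag_form_cat L L' :
  isometric (diag_form (L ++ L')) (qsum (diag_form L) (diag_form L')).
Proof.
apply: (diagonal_isometric charF (diagonal_diag_form _)); rewrite map_cat.
by apply: diagonal_qsum; apply: diagonal_diag_form.
Qed.

Lemma unary_diag_form a : isometric (unary a) (diag_form [:: a]).
Proof.
apply: (diagonal_isometric charF) (diagonal_diag_form [:: a]).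
exact: (diagonal_qdiag [tuple a]).
Qed.

Lemma form_diagonalizable q : exists L, isometric q (diag_form L).
Proof.
have [n] := ubnP (qdim q); elim: n q => [|n IH] q; first by rewrite ltn0.
rewrite ltnS => le_q; have [q0|q_gt0] := posnP (qdim q).
  exists [::]; apply: (diagonal_isometric charF (L := [::])).
    case: q q0 {le_q} => m A sA uA /= m0; subst m.
    by split=> [[]|] //=; rewrite enum_ord0.
  exact: diagonal_diag_form.
have [a [r [qar qE]]] := split_off_unary q_gt0.
have [|L rL] := IH r; first by rewrite -qE.
exists (a :: L); apply: (isometric_trans charF qar).
apply: (isometric_trans charF) (isometric_sym charF (diag_form_cat [:: a] L)).
exact: isometric_sum (unary_diag_form a) rL.
Qed.

Lemma qsum_comm q r : isometric (qsum q r) (qsum r q).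
Proof.
have [L qL] := form_diagonalizable q; have [M rM] := form_diagonalizable r.
apply: (isometric_trans charF (isometric_sum charF qL rM)).
apply: (isometric_trans charF _
  (isometric_sum charF (isometric_sym charF rM) (isometric_sym charF qL))).
apply: (diagonal_isometric charF
  (diagonal_qsum (diagonal_diag_form L) (diagonal_diag_form M))).
apply: diagonal_perm (diagonal_qsum (diagonal_diag_form M) (diagonal_diag_form L)).
by rewrite perm_catC.
Qed.

Lemma qsum_assoc q r s : isometric (qsum q (qsum r s)) (qsum (qsum q r) s).
Proof.
have [L qL] := form_diagonalizable q; have [M rM] := form_diagonalizable r.
have [N sN] := form_diagonalizable s; have D := diagonal_diag_form.
apply: (isometric_trans charF (isometric_sum charF qL (isometric_sum charF rM sN))).
apply: (isometric_trans charF _ (isometric_sum charF (isometric_sum charF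
  (isometric_sym charF qL) (isometric_sym charF rM)) (isometric_sym charF sN))).
apply: (diagonal_isometric charF (diagonal_qsum (D L) (diagonal_qsum (D M) (D N)))).
rewrite catA; exact: diagonal_qsum (diagonal_qsum (D L) (D M)) (D N).
Qed.

Lemma qsum0 q r : qdim r = 0%N -> isometric (qsum r q) q.
Proof.
move=> r0; have [L qL] := form_diagonalizable q; have [M rM] := form_diagonalizable r.
have M0 : M = [::].
  by apply/nilP; rewrite /nilp -[size M]/(qdim (diag_form M)) -(isometric_dim rM) r0.
apply: (isometric_trans charF (isometric_sum charF rM qL)).
apply: (isometric_trans charF _ (isometric_sym charF qL)).
apply: (diagonal_isometric charF _ (diagonal_diag_form L)).
by rewrite M0; apply: (diagonal_qsum (diagonal_diag_form [::]) (diagonal_diag_form L)).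
Qed.

Theorem witt_cancel s q r : isometric (qsum s q) (qsum s r) -> isometric q r.
Proof.
have tr := isometric_trans charF; have sy := isometric_sym charF.
have [L] := form_diagonalizable s; elim: L s => [|a L IH] s sL H.
  have s0 : qdim s = 0%N by rewrite (isometric_dim sL).
  exact: tr _ _ _ (sy _ _ (qsum0 q s0)) (tr _ _ _ H (qsum0 r s0)).
have aL t : isometric (qsum s t) (qsum (unary a) (qsum (diag_form L) t)).
  apply: (tr _ _ _ (isometric_sum charF sL (isometric_refl charF t))).
  apply: (tr _ _ _ _ (sy _ _ (qsum_assoc _ _ _))).
  apply: (isometric_sum charF) (isometric_refl charF t).
  apply: (tr _ _ _ (diag_form_cat [:: a] L)).
  exact: (isometric_sum charF (sy _ _ (unary_diag_form a)) (isometric_refl charF _)).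
apply: (IH _ (isometric_refl charF (diag_form L))); apply: (@witt_cancel_unary a).
exact: tr (sy _ _ (aL q)) (tr _ _ _ H (aL r)).
Qed.

End Cancellation.

(** * The group of square classes *)

Section SquareClasses.
Variable F : fieldType.
Implicit Types a b c : nonzero F.

Lemma nonzero_mul_subproof a b : val a * val b != 0.
Proof. by rewrite mulf_neq0 ?(valP a) ?(valP b). Qed.

Definition nonzero_mul a b : nonzero F :=
  exist (fun x : F => x != 0) _ (nonzero_mul_subproof a b).

Lemma same_square_class_refl a : same_square_class a a.
Proof. by exists (nonzero1 F); rewrite expr1n mulr1. Qed.

Lemma same_square_class_sym a b : same_square_class a b -> same_square_class b a.
Proof.
case=> c E; have c0 := valP c; have Vc : (val c)^-1 != 0 by rewrite invr_eq0.
by exists (exist (fun x : F => x != 0) _ Vc); rewrite E /= exprVn mulfK // expf_neq0.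
Qed.

Lemma same_square_class_trans a b c : same_square_class a b ->
  same_square_class b c -> same_square_class a c.
Proof.
move=> [d E] [e E']; exists (nonzero_mul d e); rewrite E E' /= exprMn -mulrA.
by congr (_ * _); apply: mulrC.
Qed.

Lemma same_square_class_mul a b a' b' : same_square_class a a' ->
  same_square_class b b' -> same_square_class (nonzero_mul a b) (nonzero_mul a' b').
Proof.
by move=> [d E] [e E']; exists (nonzero_mul d e); rewrite /= E E' exprMn mulrACA.
Qed.

Definition square_rel : rel (nonzero F) := fun a b => `[< same_square_class a b >].

Lemma square_rel_equiv : equiv_class_of square_rel.
Proof.
split.
- by move=> a; apply/asboolP/same_square_class_refl.
- by move=> a b; apply/asboolP/asboolP => /same_square_class_sym.
- move=> b a c /asboolP ab /asboolP bc; apply/asboolP.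
  exact: same_square_class_trans ab bc.
Qed.

Canonical square_equiv := EquivRelPack square_rel_equiv.

Definition square_class := {eq_quot square_equiv}%qT.

HB.instance Definition _ : EqQuotient _ square_equiv square_class :=
  EqQuotient.on square_class.
HB.instance Definition _ := Choice.on square_class.

Definition cls a : square_class := (\pi_(square_class) a)%qT.

Lemma cls_eq a b : (cls a = cls b) <-> same_square_class a b.
Proof. by split=> [/eqmodP/asboolP|H]; last exact/eqmodP/asboolP. Qed.

Lemma cls_repr (x : square_class) : cls (repr x) = x.
Proof. exact: reprK. Qed.

Definition class_add (x y : square_class) := cls (nonzero_mul (repr x) (repr y)).

Lemma cls_mul a b : cls (nonzero_mul a b) = class_add (cls a) (cls b).
Proof. by apply/cls_eq/same_square_class_mul; apply/cls_eq; rewrite cls_repr. Qed.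

Lemma class_addA : associative class_add.
Proof.
move=> x y z; rewrite -[x]cls_repr -[y]cls_repr -[z]cls_repr -!cls_mul.
by congr cls; apply: val_inj; rewrite /= mulrA.
Qed.

Lemma class_addC : commutative class_add.
Proof. by move=> x y; congr cls; apply: val_inj; rewrite /= mulrC. Qed.

Lemma class_add0 : left_id (cls (nonzero1 F)) class_add.
Proof.
move=> x; rewrite -[x]cls_repr -cls_mul; congr cls; apply: val_inj.
by rewrite /= mul1r.
Qed.

Lemma class_addN : left_inverse (cls (nonzero1 F)) id class_add.
Proof.
move=> x; rewrite -[x]cls_repr -cls_mul; apply/cls_eq; exists (repr x).
by rewrite /= mul1r expr2.
Qed.

HB.instance Definition _ := GRing.isZmodule.Build square_class
  class_addA class_addC class_add0 class_addN.

Lemma clsM a b : cls (nonzero_mul a b) = cls a + cls b.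
Proof. exact: cls_mul. Qed.

Lemma square_class_exp2 (x : square_class) : x + x = 0.
Proof. exact: class_addN. Qed.

End SquareClasses.

(** * Values of diagonal forms over a rigid field *)

Section Rigid.
Variables (F : fieldType) (charF : (2%:R : F) != 0) (rigidF : rigid F).
Implicit Types (a b c : nonzero F) (L M : seq (nonzero F)) (q r : qform F).

Local Notation exp2 := (@square_class_exp2 F).

Definition minus1 : square_class F := cls (nonzero_opp (nonzero1 F)).
Definition level2 : bool := `[< exists p q : F, p ^+ 2 + q ^+ 2 = -1 >].

Local Notation weq := (weq minus1 level2).
Local Notation aniso := (aniso minus1 level2).
Local Notation reduced := (reduced minus1 level2).

Lemma nonzeroM a b : val (nonzero_mul a b) = val a * val b.
Proof. by []. Qed.

Lemma nonzeroN a : val (nonzero_opp a) = - val a.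
Proof. by []. Qed.

Lemma nonzeroE : val (nonzero1 F) = 1.
Proof. by []. Qed.

Lemma clsN a : cls (nonzero_opp a) = cls a + minus1.
Proof. by rewrite -clsM; congr cls; apply: val_inj; rewrite /= mulrN mulr1. Qed.

Lemma cls1 : cls (nonzero1 F) = 0.
Proof. by []. Qed.

Definition evalL L (f : nat -> F) : F :=
  \sum_(i < size L) val (nth (nonzero1 F) L i) * f i ^+ 2.

Lemma evalL_cons a L f :
  evalL (a :: L) f = val a * f 0%N ^+ 2 + evalL L (fun i => f i.+1).
Proof. exact: big_ord_recl. Qed.

Lemma binary_zero a b (s t : F) : val a * s ^+ 2 + val b * t ^+ 2 = 0 ->
  s != 0 \/ t != 0 -> cls a = cls b + minus1.
Proof.
move=> E st; have a0 := valP a; have b0 := valP b.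
have s0 : s != 0.
  case: st => // t0; apply: contraNneq t0 => s0; move/eqP: E.
  by rewrite s0 expr0n mulr0 add0r mulf_eq0 (negPf b0) sqrf_eq0.
have t0 : t != 0.
  apply: contraNneq s0 => t0; move/eqP: E.
  by rewrite t0 expr0n mulr0 addr0 mulf_eq0 (negPf a0) sqrf_eq0.
rewrite -clsN; apply/cls_eq.
have c0 : t / s != 0 by rewrite mulf_neq0 ?invr_eq0.
exists (exist (fun x : F => x != 0) _ c0) => /=.
apply: (@mulIf _ (s ^+ 2)); rewrite ?expf_neq0 // expr_div_n -mulrA mulfVK ?expf_neq0 //.
by rewrite mulNr; apply/eqP; rewrite -addr_eq0; apply/eqP.
Qed.

Definition coordinate L (v : 'rV[F]_(qdim (diag_form L))) (i : nat) : F :=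
  oapp (v 0) 0 (insub i).

Lemma coordinate_ord L (v : 'rV[F]_(qdim (diag_form L))) (i : 'I_(size L)) :
  coordinate v i = v 0 i.
Proof. by rewrite /coordinate valK. Qed.

Lemma qval_coordinate L (v : 'rV[F]_(qdim (diag_form L))) :
  qval v = evalL L (coordinate v).
Proof.
rewrite /qval /evalL mul_mx_diag mxE; apply: eq_bigr => i _.
rewrite !mxE (tnth_nth (nonzero1 F)) coordinate_ord /=.
by rewrite -mulrA mulrCA.
Qed.

Lemma qval_row L (f : nat -> F) :
  qval (\row_(i < qdim (diag_form L)) f i : 'rV_(qdim (diag_form L))) = evalL L f.
Proof.
by rewrite qval_coordinate; apply: eq_bigr => i _; rewrite coordinate_ord mxE.
Qed.

Lemma evalL_pair a b f :
  evalL [:: a; b] f = val a * f 0%N ^+ 2 + val b * f 1%N ^+ 2.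
Proof. by rewrite !evalL_cons /evalL big_ord0 addr0. Qed.

Lemma binary_classes a b : cls a + cls b != minus1 ->
  exists beta gamma, forall x s t, val x = val a * s ^+ 2 + val b * t ^+ 2 ->
    cls x = beta \/ cls x = gamma.
Proof.
move=> ab; have [|b0 [c0 H]] := rigidF (q := diag_form [:: a; b]) erefl.
  move=> v; rewrite qval_coordinate evalL_pair => E; apply/rowP => j.
  rewrite -coordinate_ord mxE; apply: contra_neq_eq ab => vj.
  rewrite (binary_zero E); first by rewrite addrAC exp2 add0r.
  by case: j vj => -[|[|]] //= lt_j vj; [left|right].
exists (cls b0), (cls c0) => x s t xE; have [|E|E] := H x.
- exists (\row_i (if val i is 0%N then s else t)).
  by rewrite (qval_row [:: a; b] (fun i => if i is 0%N then s else t)) evalL_pair.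
- by left; apply/cls_eq.
- by right; apply/cls_eq.
Qed.

(** Rigidity leaves no third class besides those of [a] and [b] if these differ.
    If they agree, say with that of 1, and the value x = p^2 + q^2 is not a square,
    then <1, -x> represents 1, -x and -1, so that two of these agree, and x is -1 up
    to squares. *)
Lemma binary_value a b x s t : cls a + cls b != minus1 ->
    val x = val a * s ^+ 2 + val b * t ^+ 2 ->
  [\/ cls x = cls a, cls x = cls b |
      [/\ level2, cls a = cls b & cls x = cls a + minus1]].
Proof.
move=> ab xE; have [beta [gamma H]] := binary_classes ab.
have Ha : cls a = beta \/ cls a = gamma by apply: (H a 1 0); ring.
have Hb : cls b = beta \/ cls b = gamma by apply: (H b 0 1); ring.
have Hx := H x s t xE.
have [xa|Nxa] := eqVneq (cls x) (cls a); first by constructor 1.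
have [xb|Nxb] := eqVneq (cls x) (cls b); first by constructor 2.
have {H beta gamma Ha Hb Hx} Eab : cls a = cls b.
  case: Ha Hb Hx Nxa Nxb => -> [] -> // [] -> //; by rewrite eqxx.
constructor 3; have [d bE] : same_square_class b a by apply/cls_eq.
have a0 := valP a; pose P := val a * s; pose Q := val a * val d * t.
have wE : val (nonzero_mul x a) = P ^+ 2 + Q ^+ 2.
  by rewrite nonzeroM xE bE /P /Q; ring.
set w := nonzero_mul x a in wE; have w0 := valP w.
have N1 : minus1 != 0 by rewrite eq_sym; move: ab; rewrite Eab exp2.
have cw : cls w = cls x + cls a := clsM x a.
have Nw : cls w != 0 by rewrite cw eq_addr0 ?exp2 //; exact: square_class_exp2.
have P0 : P != 0.
  apply: contraNneq Nw => P0; have Q0 : Q != 0.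
    by apply: contraNneq w0 => Q0; rewrite wE P0 Q0 expr0n addr0.
  apply/eqP; rewrite -cls1; apply/cls_eq; exists (exist (fun x : F => x != 0) _ Q0).
  by rewrite wE P0 expr0n add0r mul1r.
have [|beta [gamma H]] := @binary_classes (nonzero1 F) (nonzero_opp w).
  rewrite clsN cls1 add0r; apply: contra Nw => /eqP E; apply/eqP.
  by apply: (addIr minus1); rewrite E add0r.
have H1 := H (nonzero1 F) 1 0; have Hw := H (nonzero_opp w) 0 1.
have Hm := H (nonzero_opp (nonzero1 F)) (Q / P) P^-1.
have {}H1 : 0 = beta \/ 0 = gamma by rewrite -cls1; apply: H1; rewrite nonzeroE nonzeroN; ring.
have {}Hw : cls w + minus1 = beta \/ cls w + minus1 = gamma.
  by rewrite -clsN; apply: Hw; rewrite nonzeroE nonzeroN; ring.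
have {}Hm : minus1 = beta \/ minus1 = gamma.
  by apply: Hm; rewrite !nonzeroN nonzeroE wE; field.
have wm : cls w = minus1.
  have Nwm : cls w + minus1 <> minus1.
    by move=> E; case/eqP: Nw; apply: (addIr minus1); rewrite E add0r.
  have wm0 : cls w + minus1 = 0 -> cls w = minus1.
    by move=> E; apply: (addIr minus1); rewrite E exp2.
  move/eqP: N1 => N1.
  by case: H1 Hw Hm => <- [] Ew [] Em; try (by case: N1); try (exact: wm0);
    case: Nwm; rewrite Ew -Em.
split=> //; last by rewrite -wm cw addrCA exp2 addr0.
have [c wc] : same_square_class w (nonzero_opp (nonzero1 F)) by apply/cls_eq.
have c0 := valP c; apply/asboolP; exists (P / val c), (Q / val c).
have -> : (P / val c) ^+ 2 + (Q / val c) ^+ 2 = (P ^+ 2 + Q ^+ 2) / val c ^+ 2.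
  by field.
by rewrite -wE wc nonzeroN nonzeroE mulfK // expf_neq0.
Qed.

Lemma reduced_consF (x : square_class F) g : reduced (x :: g) ->
  x + minus1 \in g \/ [/\ level2, minus1 != 0 & (1 < mult g x)%N] -> False.
Proof.
move=> R; have := R x; rewrite /shortens !mult_cons eqxx mem_mult.
have [e0|eN] := eqVneq minus1 0.
  by rewrite e0 addr0 => H [|[]] //; lia.
move=> /negP H [c|[hT _ c]]; apply: H.
  by rewrite [(0 < _ + mult _ (x + _))%N]addn_gt0 c orbT.
by rewrite hT; apply/orP; right; exact: c.
Qed.

(** By induction on the entries: the value of a tail is an entry of it, or the
    opposite of a double one, and [binary_value] tells what a further entry can
    add to it. The hyperbolic case is
    excluded as the form is [reduced]. *)
Lemma reduced_value L : reduced (map (@cls F) L) -> forall f,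
  (evalL L f = 0 -> forall i, (i < size L)%N -> f i = 0) /\
  (forall x, val x = evalL L f -> cls x \in map (@cls F) L \/
     [/\ level2, minus1 != 0 & (1 < mult (map (@cls F) L) (cls x + minus1))%N]).
Proof.
elim: L => [|a L IH] R f.
  by split=> // x; rewrite /evalL big_ord0 => xE; have := valP x; rewrite xE eqxx.
rewrite evalL_cons; set y := evalL L _.
have {IH} [IH0 IHx] := IH (reduced_cons R) (fun i => f i.+1); rewrite -/y in IH0 IHx.
have lift z : cls z \in map (@cls F) L \/ [/\ level2, minus1 != 0 &
      (1 < mult (map (@cls F) L) (cls z + minus1))%N] ->
    cls z \in map (@cls F) (a :: L) \/ [/\ level2, minus1 != 0 &
      (1 < mult (map (@cls F) (a :: L)) (cls z + minus1))%N].
  case=> [zL|[hT e c]]; [left|right]; first by rewrite inE zL orbT.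
  by split=> //; apply: leq_trans c (leq_addl _ _).
have opp z : val z = y -> cls z = cls a + minus1 -> False.
  move=> zy za; apply: (reduced_consF R); case: (IHx z zy); rewrite za; first by left.
  by rewrite -addrA exp2 addr0; right.
have [f0|f0] := eqVneq (f 0%N) 0.
  rewrite f0 expr0n mulr0 add0r; split=> [y0 [|i] // /IH0 -> //|x xy].
  exact/lift/IHx.
have [y0|y0] := eqVneq y 0.
  rewrite y0 addr0; split=> [/eqP|x xE].
    by rewrite mulf_eq0 (negPf (valP a)) sqrf_eq0 (negPf f0).
  left; rewrite inE; apply/orP; left; apply/eqP/cls_eq.
  by exists (exist (fun x : F => x != 0) _ f0).
pose z : nonzero F := exist (fun x : F => x != 0) _ y0.
have az : cls a + cls z != minus1.
  apply/eqP => E; apply: (opp z) => //; rewrite -E addrA exp2 add0r //.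
split=> [E|x xE].
  by case/eqP: az; rewrite (@binary_zero a z (f 0%N) 1) ?expr1n ?mulr1 //;
    [rewrite addrAC exp2 add0r|left].
have xE' : val x = val a * f 0%N ^+ 2 + val z * 1 ^+ 2 by rewrite expr1n mulr1.
have [xa|xz|[hT za xa]] := binary_value az xE'.
- by left; rewrite xa /= mem_head.
- by rewrite xz; apply: lift; apply: IHx.
have [e0|eN] := eqVneq minus1 0; first by left; rewrite xa e0 addr0 /= mem_head.
right; split=> //; rewrite xa -addrA exp2 addr0 map_cons.
rewrite mult_cons eqxx.
case: (IHx z erefl) => [|[_ _ c]]; first by rewrite -za mem_mult; lia.
exfalso; apply: (reduced_consF R); left.
by rewrite mem_mult za; apply: ltnW.
Qed.

End Rigid.

(** * Forms and lists of square classes *)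

Section WittClass.
Variables (F : fieldType) (charF : (2%:R : F) != 0) (rigidF : rigid F).
Implicit Types (a b c d : nonzero F) (L M : seq (nonzero F)) (q r : qform F).
Implicit Types (x y : square_class F) (g : seq (square_class F)).

Local Notation exp2 := (@square_class_exp2 F).
Local Notation eps := (@minus1 F).
Local Notation lvl2 := (@level2 F).
Local Notation weq := (weq (@minus1 F) (@level2 F)).
Local Notation aniso := (aniso (@minus1 F) (@level2 F)).
Local Notation reduced := (reduced (@minus1 F) (@level2 F)).
Local Notation irefl := (isometric_refl charF).
Local Notation isym := (isometric_sym charF).
Local Notation itrans := (isometric_trans charF).
Local Notation isum := (isometric_sum charF).

Lemma binary_isometric a b c d (p q r s : F) :
    val c = val a * p ^+ 2 + val b * q ^+ 2 ->
    val d = val a * r ^+ 2 + val b * s ^+ 2 ->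
    val a * p * r + val b * q * s = 0 ->
  isometric (diag_form [:: c; d]) (diag_form [:: a; b]).
Proof.
move=> cE dE ort; pose P := \matrix_(i < 2, j < 2)
  (if val i is 0 then if val j is 0 then p else q
   else if val j is 0 then r else s).
apply: (@isometric_gram _ charF (diag_form [:: c; d]) (diag_form [:: a; b]) P) => //.
have entry i j : (P *m gram (diag_form [:: a; b]) *m P^T) i j =
    P i ord0 * val a * P j ord0 + P i (lift ord0 ord0) * val b * P j (lift ord0 ord0).
  rewrite mul_mx_diag mxE !big_ord_recl big_ord0 addr0 !mxE.
  by rewrite !(tnth_nth a).
have id1 (A B t u : F) : t * A * t + u * B * u = A * t ^+ 2 + B * u ^+ 2 by ring.
have id2 (A B t u v w : F) : t * A * v + u * B * w = A * t * v + B * u * w by ring.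
have id3 (A B t u v w : F) : v * A * t + w * B * u = A * t * v + B * u * w by ring.
apply/matrixP => i j; rewrite entry !mxE (tnth_nth a).
case: i => -[|[|//]] lt_i; case: j => -[|[|//]] lt_j; rewrite /= ?mulr1n ?mulr0n.
- exact: etrans (id1 _ _ _ _) (esym cE).
- exact: etrans (id2 _ _ _ _ _ _) ort.
- exact: etrans (id3 _ _ _ _ _ _) ort.
- exact: etrans (id1 _ _ _ _) (esym dE).
Qed.

Lemma diag_form_perm L M : perm_eq L M -> isometric (diag_form L) (diag_form M).
Proof.
move=> LM; apply: (diagonal_isometric charF (diagonal_diag_form L)).
apply: diagonal_perm (diagonal_diag_form M).
by apply: perm_map; rewrite perm_sym.
Qed.

Lemma diag_form_cons_congr a b L M : cls a = cls b ->
  isometric (diag_form L) (diag_form M) ->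
  isometric (diag_form (a :: L)) (diag_form (b :: M)).
Proof.
move=> /cls_eq[c ab] LM; apply: itrans (diag_form_cat charF [:: a] L) _.
apply: itrans _ (isym (diag_form_cat charF [:: b] M)); apply: isum LM.
apply: (@isometric_gram _ charF (diag_form [:: a]) (diag_form [:: b]) (val c)%:M) => //.
apply/matrixP => i j; rewrite mul_scalar_mx tr_scalar_mx mul_mx_scalar !mxE.
rewrite !(tnth_nth a) !ord1 /= !mulr1n mulrA -expr2 mulrC; exact: esym ab.
Qed.

Lemma diag_form_classes L M : perm_eq (map (@cls F) L) (map (@cls F) M) ->
  isometric (diag_form L) (diag_form M).
Proof.
elim: L M => [|a L IH] M LM.
  case: M LM => [|b M]; first by move=> _; apply: irefl.
  by move/perm_size.
have /mapP[b bM ab] : cls a \in map (@cls F) M by rewrite -(perm_mem LM) mem_head.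
have MM := perm_to_rem bM; apply: itrans _ (isym (diag_form_perm MM)).
apply: (diag_form_cons_congr ab (IH _ _)).
rewrite -(perm_cons (cls a)); apply: (perm_trans LM).
by rewrite (permPl (perm_map _ MM)) /= ab.
Qed.

Definition gform g : qform F := diag_form (map repr g).

Lemma map_cls_repr g : map (@cls F) (map repr g) = g.
Proof. by rewrite -map_comp map_id_in // => x _; apply: cls_repr. Qed.

Lemma gform_classes L : isometric (diag_form L) (gform (map (@cls F) L)).
Proof. by apply: diag_form_classes; rewrite map_cls_repr. Qed.

Lemma gform_perm g g' : perm_eq g g' -> isometric (gform g) (gform g').
Proof. by move=> gg; apply/diag_form_perm/perm_map. Qed.

Lemma gform_cat g g' : isometric (gform (g ++ g')) (qsum (gform g) (gform g')).
Proof. by rewrite /gform map_cat; apply: diag_form_cat. Qed.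

Lemma gform_cat_congr g1 g2 g1' g2' : isometric (gform g1) (gform g1') ->
  isometric (gform g2) (gform g2') ->
  isometric (gform (g1 ++ g2)) (gform (g1' ++ g2')).
Proof.
move=> H1 H2; apply: itrans (gform_cat _ _) _.
exact: itrans (isum H1 H2) (isym (gform_cat _ _)).
Qed.

Lemma gform_cancel g g1 g2 : isometric (gform (g ++ g1)) (gform (g ++ g2)) ->
  isometric (gform g1) (gform g2).
Proof.
move=> H; apply: (witt_cancel charF (s := gform g)).
exact: itrans (isym (gform_cat _ _)) (itrans H (gform_cat _ _)).
Qed.

Lemma diagonalizable_gform q : exists g, isometric q (gform g).
Proof.
have [L qL] := form_diagonalizable charF q; exists (map (@cls F) L).
exact: itrans qL (gform_classes L).
Qed.

Lemma qdim_gform g : qdim (gform g) = size g.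
Proof. by rewrite /gform /= size_map. Qed.

Lemma gform_flip x : lvl2 -> isometric (gform [:: x; x]) (gform [:: x + eps; x + eps]).
Proof.
move=> /asboolP[p [q pq]]; pose a : nonzero F := repr x.
have E : map (@cls F) [:: nonzero_opp a; nonzero_opp a] = [:: x + eps; x + eps].
  by rewrite /= clsN cls_repr.
rewrite -E; apply: itrans _ (gform_classes _); apply: isym.
have N1 z : z * p ^+ 2 + z * q ^+ 2 = - z :> F by rewrite -mulrDr pq mulrN mulr1.
apply: (@binary_isometric _ _ _ _ p q (- q) p); rewrite ?nonzeroN.
- by rewrite N1.
- by rewrite sqrrN addrC N1.
- by ring.
Qed.

Lemma gform_hyp x : isometric (gform [:: x; x + eps]) (gform [:: 0; eps]).
Proof.
pose a : nonzero F := repr x; pose b : nonzero F := nonzero1 F.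
have E : map (@cls F) [:: a; nonzero_opp a] = [:: x; x + eps].
  by rewrite /= clsN cls_repr.
have E0 : map (@cls F) [:: b; nonzero_opp b] = [:: 0; eps] by [].
rewrite -E -E0; apply: itrans (isym (gform_classes _)) (itrans _ (gform_classes _)).
have b1 : val b = 1 by [].
apply: (@binary_isometric _ _ _ _ ((val a + 1) / 2%:R) ((val a - 1) / 2%:R)
  ((val a - 1) / 2%:R) ((val a + 1) / 2%:R)); rewrite ?nonzeroN b1; by field.
Qed.

Definition planes m : seq (square_class F) := flatten (nseq m [:: 0; eps]).

Lemma planesS m : planes m.+1 = [:: 0; eps] ++ planes m.
Proof. by []. Qed.

Lemma size_planes m : size (planes m) = m.*2.
Proof. by elim: m => // m IH; rewrite planesS size_cat IH. Qed.

Lemma weq_planes m : weq (planes m) [::].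
Proof.
elim: m => [|m IH]; first exact: weq_refl.
rewrite planesS; apply: (@weq_cat _ _ _ _ [::] _ [::]) => //.
have := weq_pair exp2 eps lvl2 0; by rewrite add0r.
Qed.

Lemma hyperbolic_planes m : isometric (hyperbolic F m) (gform (planes m)).
Proof.
elim: m => [|m IH].
  rewrite /hyperbolic big_ord0; apply: (diagonal_isometric charF (@diagonal_qzero F)).
  exact: (diagonal_diag_form [::]).
rewrite /hyperbolic big_ord_recl planesS.
apply: itrans _ (isym (gform_cat _ _)); apply: isum IH.
apply: itrans _ (gform_classes [:: nonzero1 F; nonzero_opp (nonzero1 F)]).
apply: (diagonal_isometric charF (diagonal_qdiag _)).
exact: diagonal_diag_form.
Qed.

Lemma nonreduced_split g : ~ reduced g -> exists x g',
  isometric (gform g) (gform ([:: x; x + eps] ++ g')) /\ weq g ([:: x; x + eps] ++ g').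
Proof.
move=> nR; have [x] : exists x, shortens eps lvl2 g x.
  by apply: contrapT => nex; apply: nR => x; apply/negP => ex; apply: nex; exists x.
have P g' : perm_eq g ([:: x; x + eps] ++ g') -> exists x g',
    isometric (gform g) (gform ([:: x; x + eps] ++ g')) /\
    weq g ([:: x; x + eps] ++ g').
  by move=> gg; exists x, g'; split; [apply: gform_perm|apply: weq_perm].
rewrite /shortens; have [e0|eN] := eqVneq eps 0.
  move=> /count_perm[g' gg]; apply: (P g').
  by rewrite e0 addr0.
case/orP=> [/andP[c c']|/andP[hT /count_perm[g' /= gg]]].
  have [g1 /= gg1] := count_perm (n := 1) c.
  have [|g2 /= gg2] := @count_perm _ (x + eps) g1 1.
    move: c'; rewrite (mult_perm gg1) mult_cons; case: eqP => // E.
    by case/eqP: eN; apply: (addrI x); rewrite -E addr0.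
  by apply: (P g2); apply: (perm_trans gg1); rewrite /= perm_cons.
exists x, (x + eps :: g'); split.
  apply: itrans (gform_perm gg) _.
  apply: (@gform_cat_congr [:: x] _ [:: x]); first exact: irefl.
  apply: (@gform_cat_congr [:: x; x] _ [:: x + eps; x + eps]); last exact: irefl.
  exact: gform_flip.
apply: weq_trans (weq_perm _ _ gg) _; apply: weq_cons.
apply: (@weq_cat _ _ _ [:: x; x] [:: x + eps; x + eps]); last exact: weq_refl.
exact: (weq_flip exp2).
Qed.

Lemma anisotropic_isometric q r : isometric q r -> anisotropic q -> anisotropic r.
Proof.
move=> /isym[P [fP uP qP]] Aq v v0; have [Q PQ] := row_freeP fP.
have vP0 : v *m P = 0 by apply: Aq; rewrite qP.
by rewrite -[v]mulmx1 -PQ mulmxA vP0 mul0mx.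
Qed.

Lemma reduced_anisotropic g : reduced g -> anisotropic (gform g).
Proof.
rewrite -{1}(map_cls_repr g) => R v; rewrite qval_coordinate => E.
have [H _] := reduced_value charF rigidF R (coordinate v).
by apply/rowP => i; rewrite -coordinate_ord mxE; apply: H.
Qed.

Lemma anisotropic_reduced g : anisotropic (gform g) -> reduced g.
Proof.
move=> Ag; apply: contrapT => /nonreduced_split[x [g' [gg _]]].
have := anisotropic_isometric gg Ag.
rewrite /gform map_cat /=; set a : nonzero F := repr x; set b : nonzero F := repr _.
have [c bc] : same_square_class b (nonzero_opp a).
  by apply/cls_eq; rewrite clsN !cls_repr.
pose f i := if i is 0 then val c else if i is 1 then 1 else 0 : F.
move=> /(_ (\row_i f i)); rewrite (qval_row _ f) !evalL_cons /=.
rewrite [evalL _ _]big1 ?addr0 => [|i _]; last by rewrite expr0n mulr0.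
rewrite expr1n mulr1 bc nonzeroN mulNr subrr => /(_ erefl)/rowP/(_ (lift ord0 ord0)).
by rewrite !mxE => /eqP; rewrite oner_eq0.
Qed.

(** By [reduced_value], an entry of one form is, up to the defining relations of
    [weq], also an entry of the other if that one is anisotropic, and can be
    cancelled; otherwise both forms split off a hyperbolic plane. *)
Theorem isometric_weq g g' : isometric (gform g) (gform g') -> weq g g'.
Proof.
have [n] := ubnP (size g); elim: n g g' => [|n IH] g g' //; rewrite ltnS => le_g gg.
have sE : size g = size g' by have := isometric_dim gg; rewrite !qdim_gform.
have [R|nR] := pselect (reduced g').
  case: g => [|x g1] in le_g gg sE *.
    by case: g' sE {gg R} => // _; apply: weq_refl.
  have [v vE] : exists v : 'rV_(qdim (gform g')), qval v = val (repr x).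
    have [P [_ _ qP]] := gg.
    pose f i := if i is 0 then 1 else 0 : F.
    exists ((\row_i f i) *m P); rewrite qP (qval_row _ f) evalL_cons /=.
    by rewrite [evalL _ _]big1 ?addr0 ?expr1n ?mulr1 // => i _; rewrite expr0n mulr0.
  have : exists g2, isometric (gform g') (gform ([:: x] ++ g2)) /\ weq g' ([:: x] ++ g2).
    rewrite -(map_cls_repr g') in R.
    have [_ H] := reduced_value charF rigidF R (coordinate v).
    have := H (repr x); rewrite -qval_coordinate vE cls_repr map_cls_repr => /(_ erefl).
    case=> [/perm_head[g2 gg2]|[hT _ /count_perm[g2 /= gg2]]].
      by exists g2; split; [apply: gform_perm|apply: weq_perm].
    have xE : x + eps + eps = x by rewrite -addrA exp2 addr0.
    exists (x :: g2); split.
      apply: itrans (gform_perm gg2) _.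
      apply: (@gform_cat_congr [:: x + eps; x + eps] _ [:: x; x]); last exact: irefl.
      by have := gform_flip (x + eps) hT; rewrite xE.
    apply: weq_trans (weq_perm _ _ gg2) _.
    apply: (@weq_cat _ _ _ [:: x + eps; x + eps] [:: x; x]); last exact: weq_refl.
    by have := weq_flip exp2 eps (x + eps) hT; rewrite xE.
  case=> g2 [gg2 wg2]; apply: weq_trans (weq_sym wg2).
  apply: weq_cons; apply: IH; first by move: le_g => /=; lia.
  exact: (@gform_cancel [:: x]) (itrans gg gg2).
have [y [g2 [gg2 wg2]]] := nonreduced_split nR.
have [x [g1 [gg1 wg1]]] : exists x g1,
    isometric (gform g) (gform ([:: x; x + eps] ++ g1)) /\ weq g ([:: x; x + eps] ++ g1).
  apply: nonreduced_split => /reduced_anisotropic/(anisotropic_isometric gg).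
  by move/anisotropic_reduced.
have drop (z : square_class F) (r : seq (square_class F)) : weq ([:: z; z + eps] ++ r) r.
  apply: (@weq_cat _ _ _ _ [::]); last exact: weq_refl.
  exact: (weq_pair exp2).
apply: weq_trans wg1 (weq_trans (drop _ _) _).
apply: weq_trans _ (weq_sym (weq_trans wg2 (drop _ _))).
apply: IH.
  by have := isometric_dim gg1; rewrite !qdim_gform => E; move: le_g; rewrite E /=; lia.
apply: (@gform_cancel [:: 0; eps]).
have H (z : square_class F) (r : seq (square_class F)) :
    isometric (gform ([:: 0; eps] ++ r)) (gform ([:: z; z + eps] ++ r)).
  by apply: gform_cat_congr (irefl _); apply/isym/gform_hyp.
apply: itrans (H x g1) (itrans (isym gg1) (itrans gg (itrans gg2 (isym (H y g2))))).
Qed.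

End WittClass.

(** * Witt classes of forms *)

(** The product of two binary forms is similar to a twofold Pfister form, and a
    further binary factor makes it threefold: this is why such forms generate I^2
    and I^3. *)
Lemma perm_pair_pair (G : zmodType) (exp2 : forall x : G, x + x = 0) (x y z w : G) :
  perm_eq [seq u + v | u <- [:: x; y], v <- [:: z; w]] (gp2 (x + z) (x + y) (z + w)).
Proof.
have -> : gp2 (x + z) (x + y) (z + w) = [:: x + z; y + z; x + w; y + w].
  by rewrite /gp2; congr [:: _; _; _; _]; g2 exp2.
rewrite /=; perm_count.
Qed.

Lemma perm_gp2_pair (G : zmodType) (exp2 : forall x : G, x + x = 0) (c a b z w : G) :
  perm_eq [seq u + v | u <- gp2 c a b, v <- [:: z; w]] (gp3 (c + z) a b (z + w)).
Proof.
have -> : gp3 (c + z) a b (z + w) =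
    [:: c + z; c + a + z; c + b + z; c + a + b + z;
        c + w; c + a + w; c + b + w; c + a + b + w].
  by rewrite /gp3 /gp2 /=; congr [:: _; _; _; _; _; _; _; _]; g2 exp2.
rewrite /gp2 /=; perm_count.
Qed.

Section Representation.
Variables (F : fieldType) (charF : (2%:R : F) != 0) (rigidF : rigid F).
Implicit Types (a b c d : nonzero F) (L M : seq (nonzero F)) (q r : qform F).
Implicit Types (x y : square_class F) (g : seq (square_class F)).

Local Notation exp2 := (@square_class_exp2 F).
Local Notation eps := (@minus1 F).
Local Notation lvl2 := (@level2 F).
Local Notation weq := (weq (@minus1 F) (@level2 F)).
Local Notation inI3 := (inI3 (@minus1 F) (@level2 F)).
Local Notation irefl := (isometric_refl charF).
Local Notation isym := (isometric_sym charF).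
Local Notation itrans := (isometric_trans charF).
Local Notation isum := (isometric_sum charF).
Local Notation wrefl := (@weq_refl _ eps lvl2).

Definition witt_class q g := exists g', isometric q (gform g') /\ weq g' g.

Lemma witt_class_ex q : exists g, [/\ witt_class q g, isometric q (gform g)
  & size g = qdim q].
Proof.
have [g qg] := diagonalizable_gform charF q; exists g.
split=> //; last by rewrite (isometric_dim qg) qdim_gform.
by exists g; split=> //; apply: wrefl.
Qed.

Lemma witt_class_isometric q r g : isometric q r -> witt_class q g ->
  witt_class r g.
Proof. by move=> qr [g' [qg gg]]; exists g'; split=> //; apply: itrans (isym qr) qg. Qed.

Lemma witt_class_weq q g g' : weq g g' -> witt_class q g -> witt_class q g'.
Proof. by move=> gg [g1 [qg g1g]]; exists g1; split=> //; apply: weq_trans g1g gg. Qed.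

Lemma witt_class_unique q g g' : witt_class q g -> witt_class q g' -> weq g g'.
Proof.
move=> [g1 [qg1 g1g]] [g2 [qg2 g2g]].
apply: weq_trans (weq_sym g1g) (weq_trans _ g2g).
by apply: isometric_weq => //; apply: itrans (isym qg1) qg2.
Qed.

Lemma witt_class_sum q r g g' : witt_class q g -> witt_class r g' ->
  witt_class (qsum q r) (g ++ g').
Proof.
move=> [g1 [qg1 g1g]] [g2 [qg2 g2g]]; exists (g1 ++ g2); split.
  exact: itrans (isum qg1 qg2) (isym (gform_cat charF _ _)).
exact: weq_cat.
Qed.

Lemma witt_class_bigsum k (s : 'I_k -> qform F) (t : 'I_k -> seq (square_class F)) :
    (forall i, witt_class (s i) (t i)) ->
  witt_class (\big[@qsum F/qzero F]_(i < k) s i) (\big[cat/[::]]_(i < k) t i).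
Proof.
elim: k s t => [|k IH] s t H.
  rewrite !big_ord0; exists [::]; split; last exact: wrefl.
  apply: (diagonal_isometric charF (@diagonal_qzero F)).
  exact: (diagonal_diag_form [::]).
rewrite !big_ord_recl; apply: witt_class_sum (H _) _.
by apply: IH => i; apply: H.
Qed.

Lemma witt_class_hyperbolic m : witt_class (hyperbolic F m) [::].
Proof.
by exists (planes F m); split; [apply: hyperbolic_planes|apply: weq_planes].
Qed.

Lemma witt_class_equiv q r g : witt_equiv q r -> witt_class q g -> witt_class r g.
Proof.
move=> [m [n qr]] qg; have [g' [rg' _ _]] := witt_class_ex r.
apply: (witt_class_weq _ rg').
have := witt_class_sum qg (witt_class_hyperbolic m).
move/(witt_class_isometric qr)/witt_class_unique => H.
have := H _ (witt_class_sum rg' (witt_class_hyperbolic n)).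
by rewrite !cats0 => /weq_sym.
Qed.

(** Conversely to [isometric_weq]: the generating steps of [weq_ind] are isometries
    up to hyperbolic planes. *)
Lemma weq_planes_isometric g g' : weq g g' -> exists m n,
  isometric (gform (g ++ planes F m)) (gform (g' ++ planes F n)).
Proof.
move=> gg; have cyc (g1 g2 g3 : seq (square_class F)) :
    isometric (gform (g1 ++ g2 ++ g3)) (gform (g2 ++ g1 ++ g3)).
  by apply: (gform_perm charF); rewrite perm_catCA.
pose P (r : seq (square_class F)) := exists m n,
  isometric (gform (g ++ planes F m)) (gform (r ++ planes F n)).
apply: (@weq_ind _ exp2 eps lvl2 P _ _ _ g g' gg); rewrite /P.
- move=> r t rt [m [n H]]; exists m, n; apply: itrans H _.
  by apply: (gform_perm charF); rewrite perm_cat2r.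
- move=> x r; have hx t : isometric (gform ([:: x; x + eps] ++ t))
      (gform ([:: 0; eps] ++ t)).
    by apply: gform_cat_congr (irefl _) => //; apply: gform_hyp.
  split=> -[m [n H]].
    exists m.+1, n; rewrite planesS; apply: itrans (cyc _ _ _) _.
    apply: itrans _ (isym (hx _)).
    by apply: gform_cat_congr H => //; apply: irefl.
  exists m, n.+1; apply: itrans H _; rewrite planesS.
  by apply: itrans (hx _) (cyc _ _ _).
- move=> x r hT [m [n H]]; exists m, n; apply: itrans H _.
  apply: (@gform_cat_congr _ charF [:: x; x] _ [:: x + eps; x + eps]).
    exact: gform_flip.
  exact: irefl.
- by exists 0%N, 0%N; apply: irefl.
Qed.

Lemma witt_class_planes q g : witt_class q g -> exists m n,
  isometric (qsum q (hyperbolic F m)) (gform (g ++ planes F n)).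
Proof.
move=> [g' [qg gg]]; have [m [n H]] := weq_planes_isometric gg; exists m, n.
apply: itrans (isum qg (hyperbolic_planes charF m)) _.
exact: itrans (isym (gform_cat charF _ _)) H.
Qed.

Lemma qsum_planes q m n g k : isometric (qsum q (hyperbolic F m)) (gform (g ++ planes F n)) ->
  isometric (qsum q (hyperbolic F (m + k))) (gform (g ++ planes F (n + k))).
Proof.
move=> H; have pD i j : planes F (i + j) = planes F i ++ planes F j.
  by rewrite /planes nseqD flatten_cat.
have hD : isometric (hyperbolic F (m + k)) (qsum (hyperbolic F m) (hyperbolic F k)).
  apply: itrans (hyperbolic_planes charF _) _; rewrite pD.
  apply: itrans (gform_cat charF _ _) _.
  by apply: isum; apply/isym/hyperbolic_planes.
apply: itrans (isum (irefl q) hD) _.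
apply: itrans (qsum_assoc charF _ _ _) _; rewrite pD catA.
apply: itrans _ (isym (gform_cat charF _ _)).
exact: isum H (hyperbolic_planes charF k).
Qed.

Lemma witt_equiv_class q r g : witt_class q g -> witt_class r g -> witt_equiv q r.
Proof.
move=> /witt_class_planes[m [n H]] /witt_class_planes[m' [n' H']].
exists (m + n')%N, (m' + n)%N; apply: itrans (qsum_planes n' H) _.
by rewrite addnC; apply/isym/qsum_planes.
Qed.

Lemma isometric_class q r g : witt_class q g -> witt_class r g ->
  qdim q = qdim r -> isometric q r.
Proof.
move=> qg rg dqr; have [m [n H]] := witt_equiv_class qg rg.
have dH i : qdim (hyperbolic F i) = i.*2.
  by rewrite (isometric_dim (hyperbolic_planes charF i)) qdim_gform size_planes.
have mn : m = n by have := isometric_dim H; rewrite /= !dH dqr; lia.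
subst n; apply: (witt_cancel charF (s := hyperbolic F m)).
apply: itrans (qsum_comm charF _ _) _.
exact: itrans H (qsum_comm charF _ _).
Qed.

(** * Products and the ideal I^3 *)

Definition pairs g g' := [seq x + y | x <- g, y <- g'].

Lemma pairs_consr g y g' :
  perm_eq (pairs g (y :: g')) ([seq x + y | x <- g] ++ pairs g g').
Proof.
by apply/permPl/(perm_allpairs_consr (fun x y => x + y) g (fun=> y) (fun=> g')).
Qed.

Lemma pairsC g g' : perm_eq (pairs g g') (pairs g' g).
Proof.
elim: g' => [|y g' IH]; first by rewrite /pairs allpairs0r.
apply: (perm_trans (pairs_consr _ _ _)); apply: perm_cat IH.
by rewrite (eq_map (fun x => addrC x y)).
Qed.

Lemma weq_pairsl g1 g2 g : weq g1 g2 -> weq (pairs g1 g) (pairs g2 g).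
Proof.
move=> gg; elim: g => [|y g IH].
  by rewrite /pairs !allpairs0r; apply: wrefl.
have H h := weq_perm eps lvl2 (pairs_consr h y g).
apply: weq_trans (H g1) (weq_trans _ (weq_sym (H g2))).
exact: weq_cat (weq_shift exp2 y gg) IH.
Qed.

Lemma weq_pairs g1 g2 g3 g4 : weq g1 g2 -> weq g3 g4 ->
  weq (pairs g1 g3) (pairs g2 g4).
Proof.
have C g g' := weq_perm eps lvl2 (pairsC g g').
move=> H H'; apply: weq_trans (weq_pairsl _ H) (weq_trans (C _ _) _).
exact: weq_trans (weq_pairsl _ H') (C _ _).
Qed.

Lemma witt_class_diagonal q L : diagonal q (map val L) ->
  witt_class q (map (@cls F) L).
Proof.
move=> qL; exists (map (@cls F) L); split; last exact: wrefl.
apply: itrans _ (gform_classes charF L).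
exact: diagonal_isometric qL (diagonal_diag_form L).
Qed.

Lemma witt_class_tens q r g g' : witt_class q g -> witt_class r g' ->
  witt_class (qtens q r) (pairs g g').
Proof.
move=> [g1 [qg1 g1g]] [g2 [qg2 g2g]]; apply: witt_class_weq (weq_pairs g1g g2g) _.
apply: (witt_class_isometric (isym (isometric_tens charF qg1 qg2))).
pose L := [seq nonzero_mul a b | a <- map repr g1, b <- map repr g2].
have -> : pairs g1 g2 = map (@cls F) L.
  rewrite map_allpairs /L allpairs_mapl allpairs_mapr.
  by apply: eq_allpairs => x y; rewrite clsM !cls_repr.
apply: witt_class_diagonal.
have := diagonal_qtens (diagonal_diag_form (map repr g1)) (diagonal_diag_form (map repr g2)).
by rewrite allpairs_mapl allpairs_mapr /L map_allpairs.
Qed.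

Lemma witt_class_scale c q g : witt_class q g ->
  witt_class (qscale c q) [seq x + cls c | x <- g].
Proof.
move=> [g1 [qg1 g1g]]; apply: witt_class_weq (weq_shift exp2 _ g1g) _.
apply: (witt_class_isometric (isym (isometric_scale charF c qg1))).
have -> : [seq x + cls c | x <- g1] =
    map (@cls F) [seq nonzero_mul c a | a <- map repr g1].
  by rewrite -!map_comp; apply: eq_map => x /=; rewrite clsM cls_repr addrC.
apply: witt_class_diagonal.
have := diagonal_qscale c (diagonal_diag_form (map repr g1)).
by rewrite -!map_comp.
Qed.

(** A property of lists holds on a product of ideals as soon as it is additive,
    invariant under Witt equivalence, and holds for products of two elements. *)
Lemma ideal_mul_class (I J : qform F -> Prop)
    (PI PJ PK : seq (square_class F) -> Prop) :
    (forall q g, I q -> witt_class q g -> PI g) ->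
    (forall q g, J q -> witt_class q g -> PJ g) ->
    (forall g g', PI g -> PJ g' -> PK (pairs g g')) ->
    PK [::] -> (forall g g', PK g -> PK g' -> PK (g ++ g')) ->
    (forall g g', weq g g' -> PK g -> PK g') ->
  forall q g, ideal_mul I J q -> witt_class q g -> PK g.
Proof.
move=> HI HJ HIJ PK0 PKD PKW q g [n [x [y [Ix Jy qE]]]] qg.
pose gx i := sval (cid (witt_class_ex (x i))).
pose gy i := sval (cid (witt_class_ex (y i))).
have xE i : witt_class (x i) (gx i) by case: (svalP (cid (witt_class_ex (x i)))).
have yE i : witt_class (y i) (gy i) by case: (svalP (cid (witt_class_ex (y i)))).
have := witt_class_bigsum (fun i => witt_class_tens (xE i) (yE i)).
have := witt_class_equiv qE qg => H1 H2.
apply: PKW (witt_class_unique H2 H1) _.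
apply: (big_ind PK) => // i _; apply: HIJ; [exact: HI (xE i)|exact: HJ (yE i)].
Qed.

Lemma even_list_ind (P : seq (square_class F) -> Prop) : P [::] ->
  (forall x y g, P g -> P [:: x, y & g]) -> forall g, ~~ odd (size g) -> P g.
Proof.
move=> P0 P2 g; have [n] := ubnP (size g); elim: n g => [|n IH] [|x [|y g]] //=.
by rewrite negbK ltnS => le_g ev; apply/P2/IH => //; lia.
Qed.

Lemma pairs_consr2 g x y g' : perm_eq (pairs g [:: x, y & g'])
  (pairs g [:: x; y] ++ pairs g g').
Proof.
apply: (perm_trans (pairs_consr _ _ _)); apply: perm_trans
  (_ : perm_eq _ ([seq z + x | z <- g] ++ [seq z + y | z <- g] ++ pairs g g')) _.
  by rewrite perm_cat2l; apply: pairs_consr.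
rewrite catA perm_cat2r perm_sym; apply: (perm_trans (pairs_consr _ _ _)).
rewrite perm_cat2l; apply: (perm_trans (pairs_consr _ _ _)).
by rewrite /pairs allpairs0r cats0.
Qed.

Lemma pairs_consl2 x y g g' : perm_eq (pairs [:: x, y & g] g')
  (pairs [:: x; y] g' ++ pairs g g').
Proof. by rewrite /pairs /= cats0 catA. Qed.

Lemma pairs_even g g' : ~~ odd (size g) -> ~~ odd (size g') ->
  exists l, weq (pairs g g') (gp2s l).
Proof.
have cat2 g1 g2 g3 : perm_eq g1 (g2 ++ g3) -> (exists l, weq g2 (gp2s l)) ->
    (exists l, weq g3 (gp2s l)) -> exists l, weq g1 (gp2s l).
  move=> gg [l H] [l' H']; exists (l ++ l'); rewrite gp2s_cat.
  exact: weq_trans (weq_perm _ _ gg) (weq_cat H H').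
move=> + ev'; move: g; apply: even_list_ind; first by exists [::]; apply: wrefl.
move=> x y g Hg; apply: (cat2 _ _ _ (pairs_consl2 _ _ _ _)) => // {Hg}.
move: g' ev'; apply: even_list_ind => [|z w g' Hg'].
  by exists [::]; apply: wrefl.
apply: (cat2 _ _ _ (pairs_consr2 _ _ _ _)) => //.
exists [:: (x + z, x + y, z + w)]; apply: weq_perm.
exact: (perm_pair_pair exp2 x y z w).
Qed.

Lemma pairs_I3 l g : ~~ odd (size g) -> inI3 (pairs (gp2s l) g).
Proof.
move: g; apply: even_list_ind => [|z w g Hg].
  by rewrite /pairs allpairs0r; apply: inI3_nil.
apply: (inI3_weq exp2 (weq_sym (weq_perm eps lvl2 (pairs_consr2 _ _ _ _)))).
apply: inI3_cat Hg; elim: l => [|[[c a] b] l IH]; first exact: inI3_nil.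
rewrite -cat1s gp2s_cat /pairs allpairs_cat; apply: inI3_cat IH.
have E := perm_gp2_pair exp2 c a b z w.
have := inI3_gp3 exp2 eps lvl2 (c + z) a b (z + w).
exact: (inI3_weq exp2 (weq_sym (weq_perm eps lvl2 E))).
Qed.

Lemma fund_ideal_even q g : fund_ideal q -> witt_class q g -> ~~ odd (size g).
Proof.
rewrite /fund_ideal => ev [g' [qg gg]].
by rewrite -(odd_size_weq exp2 gg) -qdim_gform -(isometric_dim qg).
Qed.

Lemma fund_ideal3_inI3 q g : fund_ideal3 q -> witt_class q g -> inI3 g.
Proof.
apply: (ideal_mul_class (PI := fun g => exists l, weq g (gp2s l))
  (PJ := fun g => ~~ odd (size g))) => {q g}.
- apply: (ideal_mul_class fund_ideal_even fund_ideal_even pairs_even).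
  + by exists [::]; apply: wrefl.
  + move=> g g' [l H] [l' H']; exists (l ++ l').
    by rewrite gp2s_cat; apply: weq_cat.
  + by move=> g g' gg [l H]; exists l; apply: weq_trans (weq_sym gg) H.
- exact: fund_ideal_even.
- move=> g g' [l H] ev; apply: (inI3_weq exp2 (weq_sym (weq_pairsl g' H))).
  exact: pairs_I3.
- exact: inI3_nil.
- by move=> g g'; apply: inI3_cat.
- by move=> g g'; apply: (inI3_weq exp2).
Qed.

End Representation.

(** * Pfister forms and the equivalence *)

Lemma pfister2_list (G : zmodType) (exp2 : forall x : G, x + x = 0) (c a b : G) :
  [seq x + c | x <- [seq u + v | u <- [:: 0; b],
                     v <- [seq u + v | u <- [:: 0; a], v <- [:: 0]]]] = gp2 c a b.
Proof. by rewrite /gp2 /=; congr [:: _; _; _; _]; g2 exp2. Qed.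

Lemma pfister3_list (G : zmodType) (exp2 : forall x : G, x + x = 0) (c a b d : G) :
  [seq x + c | x <- [seq u + v | u <- [:: 0; d],
                     v <- [seq u + v | u <- [:: 0; b],
                           v <- [seq u + v | u <- [:: 0; a], v <- [:: 0]]]]] =
  gp3 c a b d.
Proof.
by rewrite /gp3 /gp2 /=; congr [:: _; _; _; _; _; _; _; _]; g2 exp2.
Qed.

Section PfisterForms.
Variables (F : fieldType) (charF : (2%:R : F) != 0) (rigidF : rigid F).
Implicit Types (q r : qform F) (c : nonzero F) (x y : square_class F).

Local Notation exp2 := (@square_class_exp2 F).
Local Notation eps := (@minus1 F).
Local Notation lvl2 := (@level2 F).

Lemma witt_class_qdiag n (t : n.-tuple (nonzero F)) :
  witt_class (qdiag t) (map (@cls F) t).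
Proof.
by apply: (witt_class_diagonal charF); apply: diagonal_qdiag.
Qed.

Lemma witt_class_pfister n c (t : n.-tuple (nonzero F)) :
  witt_class (qscale c (pfister t)) [seq x + cls c |
    x <- \big[@pairs F/[:: 0]]_(i < n) [:: 0; cls (tnth t i) + eps]].
Proof.
apply: (witt_class_scale charF); apply: big_ind2 => [|q g r g'|i _].
- exact: (witt_class_qdiag [tuple nonzero1 F]).
- exact: (witt_class_tens charF).
- rewrite -clsN.
  exact: (witt_class_qdiag [tuple nonzero1 F; nonzero_opp (tnth t i)]).
Qed.

Lemma GP2_class q : GP 2 q ->
  exists i : _ * _ * _, witt_class q (gp2 i.1.1 i.1.2 i.2).
Proof.
move=> [c [t /(isometric_sym charF) qt]].
exists (cls c, cls (tnth t (lift ord0 ord0)) + eps, cls (tnth t ord0) + eps).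
apply: (witt_class_isometric charF qt).
rewrite -(pfister2_list exp2); have := witt_class_pfister c t.
by rewrite !big_ord_recl big_ord0.
Qed.

Lemma GP3_class q : GP 3 q ->
  exists i : _ * _ * _ * _, witt_class q (gp3 i.1.1.1 i.1.1.2 i.1.2 i.2).
Proof.
move=> [c [t /(isometric_sym charF) qt]].
exists (cls c, cls (tnth t (lift ord0 (lift ord0 ord0))) + eps,
  cls (tnth t (lift ord0 ord0)) + eps, cls (tnth t ord0) + eps).
apply: (witt_class_isometric charF qt).
rewrite -(pfister3_list exp2); have := witt_class_pfister c t.
by rewrite !big_ord_recl big_ord0.
Qed.

(** <<slot x>> is <1, x>, as << >> carries a sign. *)
Definition slot x : nonzero F := nonzero_opp (repr x).

Lemma cls_slot x : cls (slot x) + eps = x.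
Proof. by rewrite clsN cls_repr -addrA exp2 addr0. Qed.

Lemma class_GP2 (i : square_class F * square_class F * square_class F) :
  exists q, GP 2 q /\ witt_class q (gp2 i.1.1 i.1.2 i.2).
Proof.
case: i => -[c a] b; pose t := [tuple slot b; slot a].
exists (qscale (repr c) (pfister t)); split.
  by exists (repr c), t; apply: (isometric_refl charF).
have := witt_class_pfister (repr c) t.
rewrite !big_ord_recl big_ord0 !(tnth_nth (nonzero1 F)) /= !cls_slot.
by rewrite cls_repr -(pfister2_list exp2).
Qed.

Lemma class_GP3 (i : square_class F * square_class F * square_class F * square_class F) :
  exists q, GP 3 q /\ witt_class q (gp3 i.1.1.1 i.1.1.2 i.1.2 i.2).
Proof.
case: i => -[[c a] b] d; pose t := [tuple slot d; slot b; slot a].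
exists (qscale (repr c) (pfister t)); split.
  by exists (repr c), t; apply: (isometric_refl charF).
have := witt_class_pfister (repr c) t.
rewrite !big_ord_recl big_ord0 !(tnth_nth (nonzero1 F)) /= !cls_slot.
by rewrite cls_repr -(pfister3_list exp2).
Qed.

Lemma qdim_GP2 q : GP 2 q -> qdim q = 4%N.
Proof.
by move=> [c [t /isometric_dim->]]; rewrite /pfister /= !big_ord_recl big_ord0.
Qed.

Lemma qdim_bigsum k (s : 'I_k -> qform F) :
  qdim (\big[@qsum F/qzero F]_(i < k) s i) = (\sum_(i < k) qdim (s i))%N.
Proof. exact: big_morph. Qed.

Lemma flatten_big (A : Type) (f : A -> seq (square_class F)) (l : seq A) :
  \big[cat/[::]]_(i <- l) f i = flatten (map f l).
Proof. by elim: l => [|i l IH]; rewrite ?big_nil ?big_cons //= IH. Qed.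

Section Families.
Variables (A : Type) (f : A -> seq (square_class F)) (P : qform F -> Prop).

Lemma realize_classes : (forall i, exists q, P q /\ witt_class q (f i)) ->
  forall l, exists s : 'I_(size l) -> qform F, (forall i, P (s i)) /\
    witt_class (\big[@qsum F/qzero F]_(i < size l) s i) (flatten (map f l)).
Proof.
move=> H l; pose t := in_tuple l; exists (fun i => sval (cid (H (tnth t i)))).
split=> [i|]; first by case: (svalP (cid (H (tnth t i)))).
rewrite -flatten_big big_tnth; apply: (witt_class_bigsum charF) => i.
by case: (svalP (cid (H (tnth t i)))).
Qed.

Lemma classes_of_sum : (forall q, P q -> exists i, witt_class q (f i)) ->
  forall k (s : 'I_k -> qform F), (forall i, P (s i)) -> exists l, size l = k /\
    witt_class (\big[@qsum F/qzero F]_(i < k) s i) (flatten (map f l)).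
Proof.
move=> H k s Ps; pose a i := sval (cid (H _ (Ps i))).
pose l := [tuple a i | i < k]; exists l; split; first by rewrite size_tuple.
rewrite -flatten_big big_tuple; apply: (witt_class_bigsum charF) => i.
by rewrite tnth_mktuple; exact: (svalP (cid (H _ (Ps i)))).
Qed.

End Families.
End PfisterForms.

Theorem proposition6p1 (F : fieldType) (charF : (2%:R : F) != 0)
    (rigidF : rigid F) (phi : qform F) (dim_phi : qdim phi = 16%N)
    (aniso_phi : anisotropic phi) (phi_I3 : fund_ideal3 phi) :
  [<->
       exists s : 'I_4 -> qform F, (forall i, GP 2 (s i)) /\
         isometric phi (\big[@qsum F/qzero F]_(i < 4) s i);
       exists s : qform F, GP 2 s /\ subform s phi;
       exists (k : nat) (s : 'I_k -> qform F),
         [/\ (k <= 3)%N, forall i, GP 3 (s i)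
           & witt_equiv phi (\big[@qsum F/qzero F]_(i < k) s i)]].
Proof.
have exp2 := @square_class_exp2 F.
tfae.
- move=> [s [GPs H]]; exists (s ord0); split; first exact: GPs.
  move: H; rewrite big_ord_recl => H.
  by exists (\big[@qsum F/qzero F]_(i < 3) s (lift ord0 i)).
- move=> [s [GPs [r phi_sr]]].
  have [[[c a] b] /= sE] := GP2_class charF GPs.
  have [g [rE _ sg]] := witt_class_ex charF r.
  have sz : size g = 12%N.
    have := isometric_dim phi_sr; rewrite dim_phi /= (qdim_GP2 GPs) -sg.
    by rewrite -[16%N]/(4 + 12)%N => /addnI.
  have phiE := witt_class_isometric charF (isometric_sym charF phi_sr)
    (witt_class_sum charF sE rE).
  have I3 := fund_ideal3_inI3 charF rigidF phi_I3 phiE.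
  case: g sz phiE I3 {rE sg} => // y g [sz] phiE I3.
  (* Any further entry y will do: what is left has dimension 3 + 11 = 14. *)
  have st := weq_step exp2 (minus1 F) (level2 F) c a b y g.
  have [|l [le_l lE]] := inI3_le15 exp2 (inI3_step exp2 I3).
    by rewrite size_cat sz.
  have [t [GPt tE]] := realize_classes charF (@class_GP3 _ charF) ((c, a, b, c + y) :: l).
  exists (size l).+1, t; split=> //.
  apply: (witt_equiv_class charF phiE); apply: witt_class_weq tE.
  apply: weq_sym; apply: weq_trans st (weq_cat _ lE); exact: weq_refl.
- move=> [k [s [le_k GPs phi_s]]].
  have [l [sl lE]] := classes_of_sum charF (@GP3_class _ charF) GPs.
  have [g [phiE phi_g sg]] := witt_class_ex charF phi.
  have gl := witt_class_unique charF rigidF (witt_class_equiv charF rigidF phi_s phiE) lE.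
  have R := anisotropic_reduced charF (anisotropic_isometric charF phi_g aniso_phi).
  rewrite dim_phi in sg; rewrite -sl in le_k.
  have [l4 [sl4 gl4]] := four_gp3s3 exp2 (reduced_aniso exp2 R) sg le_k gl.
  have [t [GPt tE]] := realize_classes charF (@class_GP2 _ charF) l4.
  rewrite sl4 in t GPt tE; exists t; split=> //.
  apply: (isometric_class charF phiE (witt_class_weq (weq_sym gl4) tE)).
  rewrite dim_phi qdim_bigsum (eq_bigr (fun=> 4%N)) => [|i _].
    by rewrite sum_nat_const card_ord.
  exact: qdim_GP2.
Qed.
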